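(* Let $n\ge 2$, $1<k\le n$, and let $a\in\mathbb{R}^{n+1}$ with $|a|>1$. (a) The operator $F_a$ is injective on the set of functions $f\in C(\mathbb{S}^n)$ satisfying the functional equation $f=W_af$. (b) The kernel of $F_a$ on $C(\mathbb{S}^n)$ has the form $$\ker(F_a)=\{f\in C(\mathbb{S}^n):\ f=-W_af\}.$$
   Context: $\mathbb{S}^n$ is the unit sphere and $\mathbb{B}^{n+1}$ the open unit ball in $\mathbb{R}^{n+1}$. $\mathcal{T}_a(n+1,k)$ is the set of all $k$-dimensional affine planes in $\mathbb{R}^{n+1}$ that pass through the point $a$ and meet $\mathbb{B}^{n+1}$. For $f\in C(\mathbb{S}^n)$, $$(F_a f)(\tau)=\int_{\mathbb{S}^n\cap\tau}f(x)\,d\sigma(x),\qquad \tau\in\mathcal{T}_a(n+1,k),$$ where $d\sigma$ is the $(k-1)$-dimensional surface area measure on the subsphere $\mathbb{S}^n\cap\tau$. For $x\in\mathbb{S}^n$, $\tau_ax\in\mathbb{S}^n$ denotes the second point at which the straight line through $a$ and $x$ meets $\mathbb{S}^n$ (with $\tau_ax=x$ if this line is tangent to $\mathbb{S}^n$); explicitly $$\tau_ax=\frac{(|a|^2-1)\,x+2(1-x\cdot a)\,a}{|x-a|^2}.$$ The operator $W_a$ is defined by $$(W_af)(x)=\left(\frac{|a|^2-1}{|a-x|^2}\right)^{k-1}f(\tau_ax),\qquad x\in\mathbb{S}^n.$$ *)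

(* Defs.v *)
From HB Require Import structures.
From mathcomp Require Import all_boot all_order all_algebra.
From mathcomp Require Import all_classical all_reals all_analysis.
From mathcomp Require Import measurable_realfun.
Set Implicit Arguments.
Unset Strict Implicit.
Unset Printing Implicit Defensive.
Import Order.TTheory GRing.Theory Num.Theory.
Import numFieldNormedType.Exports.
Local Open Scope classical_set_scope.
Local Open Scope ring_scope.

(* R^m carries the sigma-algebra generated by the coordinate maps, which is
   the Borel sigma-algebra of the usual topology of 'rV[R]_m. *)
Definition rV_display : measure_display.
Proof. exact: default_measure_display. Qed.

Section measurable_rV.
Context {R : realType} (m : nat).

Let coord (i : 'I_m) (x : 'rV[R]_m) : R := x ord0 i.

Let rV_set0 : g_sigma_preimage coord set0.
Proof. exact: sigma_algebra0. Qed.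

Let rV_setC A : g_sigma_preimage coord A -> g_sigma_preimage coord (~` A).
Proof. exact: sigma_algebraC. Qed.

Let rV_bigcup (F : (set 'rV[R]_m)^nat) :
  (forall i, g_sigma_preimage coord (F i)) ->
  g_sigma_preimage coord (\bigcup_i (F i)).
Proof. exact: sigma_algebra_bigcup. Qed.

HB.instance Definition _ := @isMeasurable.Build rV_display
  'rV[R]_m (g_sigma_preimage coord) rV_set0 rV_setC rV_bigcup.

Lemma measurable_coord (i : 'I_m) :
  measurable_fun [set: 'rV[R]_m] (fun x => x ord0 i : R).
Proof.
move=> _ Y mY; rewrite setTI; apply: sub_sigma_algebra => /=.
rewrite -bigcup_seq/=; exists i => /=; first by rewrite mem_index_enum.
by exists Y => //; rewrite setTI.
Qed.

Lemma measurable_fun_rV d (T : measurableType d) (f : T -> 'rV[R]_m) :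
  (forall i, measurable_fun [set: T] (fun t => f t ord0 i : R)) ->
  measurable_fun [set: T] f.
Proof.
move=> mf _ A mA; rewrite setTI; move: A mA.
suff : g_sigma_preimage coord `<=` [set A | measurable (f @^-1` A)] by [].
apply: smallest_sub.
  split=> [|A|F] /=.
  - by rewrite preimage_set0.
  - by rewrite setTD -preimage_setC; exact: measurableC.
  - by move=> mF; rewrite preimage_bigcup; exact: bigcup_measurable.
rewrite -bigcup_seq/=; apply: bigcup_sub => i _ A [B mB <-] /=.
rewrite setTI; have := mf i measurableT B mB.
by rewrite setTI.
Qed.

End measurable_rV.

Section lebesgue_rV.
Context {R : realType}.

Definition rV_cons k (p : R * 'rV[R]_k) : 'rV[R]_k.+1 :=
  row_mx p.1%:M p.2 : 'rV[R]_(1 + k).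

Lemma rV_cons0 k p : @rV_cons k p ord0 ord0 = p.1.
Proof.
rewrite /rV_cons mxE; case: splitP => j //= _.
by rewrite !ord1 mxE eqxx.
Qed.

Lemma rV_consS k p j : @rV_cons k p ord0 (lift ord0 j) = p.2 ord0 j.
Proof.
rewrite /rV_cons mxE; case: splitP => [i|i] /=; first by case: i => -[].
by rewrite /bump/= !add1n => -[] /ord_inj ->.
Qed.

Lemma measurable_rV_cons k : measurable_fun setT (@rV_cons k).
Proof.
apply: measurable_fun_rV => i; case: (unliftP ord0 i) => [j ->|->].
  rewrite [X in measurable_fun _ X](_ : _ =
    (fun x : 'rV[R]_k => x ord0 j : R) \o snd); last first.
    by apply/funext => p /=; rewrite rV_consS.
  by apply: measurableT_comp; [exact: measurable_coord|exact: measurable_snd].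
rewrite [X in measurable_fun _ X](_ : _ = fst); last first.
  by apply/funext => p /=; rewrite rV_cons0.
exact: measurable_fst.
Qed.

Section step.
Variables (k : nat) (mu : {sigma_finite_measure set 'rV[R]_k -> \bar R}).

Definition rV_cons_measure : set 'rV[R]_k.+1 -> \bar R :=
  pushforward (@lebesgue_measure R \x mu)%E (@rV_cons k).

HB.instance Definition _ := Measure.copy rV_cons_measure
  (measure_function_pushforward__canonical__measure_function_Measure
    (@lebesgue_measure R \x mu)%E (@measurable_rV_cons k)).

Let rV_cons_sigma_finite : sigma_finite setT rV_cons_measure.
Proof.
have /sigma_finiteP[/= F [FT ndF mF]] := sigma_finiteT (@lebesgue_measure R).
have /sigma_finiteP[/= G [GT ndG mG]] := sigma_finiteT mu.
pose tl (x : 'rV[R]_k.+1) : 'rV[R]_k := \row_j x ord0 (lift ord0 j).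
have mtl : measurable_fun setT tl.
  apply: measurable_fun_rV => i.
  rewrite [X in measurable_fun _ X](_ : _ =
    (fun x : 'rV[R]_k.+1 => x ord0 (lift ord0 i) : R)).
    exact: measurable_coord.
  by apply/funext => x; rewrite mxE.
pose H i := [set x : 'rV[R]_k.+1 | F i (x ord0 ord0)] `&` tl @^-1` (G i).
exists H.
  apply/seteqP; split => // x _.
  have : (\bigcup_i F i) (x ord0 ord0) by rewrite -FT.
  have : (\bigcup_i G i) (tl x) by rewrite -GT.
  move=> [i _ Gi] [j _ Fj]; exists (maxn i j) => //; split => /=.
    by move/subsetPset : (ndF _ _ (leq_maxr i j)); exact.
  by move/subsetPset : (ndG _ _ (leq_maxl i j)); exact.
move=> i; have [mFi Fi] := mF i; have [mGi Gi] := mG i; split.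
  apply: measurableI; rewrite -[X in measurable X]setTI.
    exact: (measurable_coord ord0 measurableT mFi).
  exact: mtl.
rewrite /rV_cons_measure /pushforward /= (_ : _ @^-1` _ = F i `*` G i).
  rewrite product_measure1E//; apply: lte_mul_pinfty => //.
  by rewrite ge0_fin_numE.
have tlE p : tl (rV_cons p) = p.2.
  by apply/rowP => j; rewrite mxE rV_consS.
by apply/seteqP; split => p /=; rewrite /H /= rV_cons0 tlE.
Qed.

HB.instance Definition _ := Measure_isSigmaFinite.Build _ _ _
  rV_cons_measure rV_cons_sigma_finite.

End step.

(* k-dimensional Lebesgue measure on R^k, as an iterated product measure. *)
Fixpoint lebesgue_rV k : {sigma_finite_measure set 'rV[R]_k -> \bar R} :=
  match k with
  | 0 => \d_ (0 : 'rV[R]_0)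
  | k'.+1 => rV_cons_measure (lebesgue_rV k')
  end.

End lebesgue_rV.

(* The norm `|x| of the library on 'rV[R]_m is the sup norm. *)
Definition dotv (R : realType) m (x y : 'rV[R]_m) : R :=
  \sum_(i < m) x ord0 i * y ord0 i.

Definition enorm (R : realType) m (x : 'rV[R]_m) : R := Num.sqrt (dotv x x).

Definition eball (R : realType) m : set 'rV[R]_m := [set x | enorm x < 1].

Definition esphere (R : realType) m : set 'rV[R]_m := [set x | enorm x = 1].

Section surface_measure.
Context {R : realType}.

Lemma measurable_enorm m : measurable_fun [set: 'rV[R]_m] (@enorm R m).
Proof.
apply: (@measurableT_comp _ _ _ _ _ _ (@Num.sqrt R)).
  by apply: continuous_measurable_fun => x; exact: sqrt_continuous.
rewrite /dotv; apply: measurable_sum => i.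
by apply: measurable_funM; exact: measurable_coord.
Qed.

Lemma measurable_eball m : measurable (@eball R m).
Proof.
have -> : @eball R m = setT `&` @enorm R m @^-1` `]-oo, 1[%classic.
  by apply/seteqP; split => x; rewrite setTI /eball /= in_itv.
exact: measurable_enorm.
Qed.

Definition normalize m (x : 'rV[R]_m) : 'rV[R]_m := (enorm x)^-1 *: x.

Lemma measurable_normalize m : measurable_fun setT (@normalize m).
Proof.
apply: measurable_fun_rV => i.
rewrite [X in measurable_fun _ X](_ : _ =
    (fun x : 'rV[R]_m => (enorm x `^ (-1)) * x ord0 i)); last first.
  by apply/funext => x; rewrite mxE powR_inv1// sqrtr_ge0.
apply: measurable_funM; last exact: measurable_coord.
apply: (@measurableT_comp _ _ _ _ _ _ (@powR R ^~ (-1))).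
  exact: measurable_powR.
exact: measurable_enorm.
Qed.

(* Surface area measure of the unit sphere of R^k, by polar coordinates:
   sigma(A) = k * lambda_k {t theta | theta in A, 0 < t < 1}. *)
Section sphere_area.
Variable k : nat.

Definition cone_measure : set 'rV[R]_k -> \bar R :=
  pushforward (mrestr (lebesgue_rV k) (@measurable_eball k)) (@normalize k).

HB.instance Definition _ := Measure.copy cone_measure
  (measure_function_pushforward__canonical__measure_function_Measure
    (mrestr (lebesgue_rV k) (@measurable_eball k)) (@measurable_normalize k)).

Definition sphere_area : {measure set 'rV[R]_k -> \bar R} :=
  mscale (k%:R : R)%:nng cone_measure.

End sphere_area.

(* Image of the area measure of the unit sphere of R^k, scaled by r^(k-1),
   under theta |-> c + r theta U; when the rows of U are orthonormal this is
   the area measure of a (k-1)-sphere of center c and radius r. *)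
Section subsphere_area.
Variables (m k : nat) (c : 'rV[R]_m) (U : 'M[R]_(k, m)) (r : {nonneg R}).

Definition subsphere_param (t : 'rV[R]_k) : 'rV[R]_m :=
  c + r%:num *: (t *m U).

Lemma measurable_subsphere_param : measurable_fun setT subsphere_param.
Proof.
apply: measurable_fun_rV => i.
rewrite [X in measurable_fun _ X](_ : _ = (fun t : 'rV[R]_k =>
    c ord0 i + r%:num * \sum_(j < k) t ord0 j * U j i)); last first.
  by apply/funext => t; rewrite !mxE.
apply: measurable_funD => //; apply: measurable_funM => //.
apply: measurable_sum => j; apply: measurable_funM => //.
exact: measurable_coord.
Qed.

Definition subsphere_image : set 'rV[R]_m -> \bar R :=
  pushforward (sphere_area k) subsphere_param.

HB.instance Definition _ := Measure.copy subsphere_image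
  (measure_function_pushforward__canonical__measure_function_Measure
    (sphere_area k) measurable_subsphere_param).

Definition subsphere_area : {measure set 'rV[R]_m -> \bar R} :=
  mscale (r%:num ^+ k.-1)%:nng subsphere_image.

End subsphere_area.
End surface_measure.

Section planes.
Context {R : realType} {m : nat}.

Definition affine_plane (k : nat) (tau : set 'rV[R]_m) : Prop :=
  exists (p : 'rV[R]_m) (V : 'M[R]_(k, m)),
    row_free V /\ tau = [set x | (x - p <= V)%MS].

Definition planes_through (a : 'rV[R]_m) (k : nat) : set (set 'rV[R]_m) :=
  [set tau | [/\ affine_plane k tau, tau a & tau `&` @eball R m !=set0]].

(* c is the orthogonal projection of the origin on tau, and the rows of U are
   an orthonormal basis of the direction of tau. *)
Definition plane_frame k (tau : set 'rV[R]_m)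
    (cU : 'rV[R]_m * 'M[R]_(k, m)) : Prop :=
  [/\ cU.2 *m cU.2^T = 1%:M, cU.1 *m cU.2^T = 0 &
      tau = [set x | (x - cU.1 <= cU.2)%MS]].

(* Surface area of the section of the unit sphere by a k-plane tau, a
   (k-1)-sphere of center c and radius sqrt (1 - |c|^2).  The frame of tau is
   chosen arbitrarily: the measure does not depend on it because the area
   measure of the unit sphere of R^k is invariant under orthogonal maps. *)
Definition section_area k (tau : set 'rV[R]_m) :
    {measure set 'rV[R]_m -> \bar R} :=
  let cU := xget (0, 0) (@plane_frame k tau) in
  subsphere_area cU.1 cU.2 (Num.sqrt (1 - dotv cU.1 cU.1))%:nng.

End planes.

Section transforms.
Context {R : realType} {m : nat}.
Implicit Types (a x : 'rV[R]_m) (f : 'rV[R]_m -> R).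

(* C(S^(m-1)): only the values of f on the sphere are relevant. *)
Definition continuous_on_sphere f : Prop :=
  {within @esphere R m, continuous f}.

(* The operator F_a is the restriction of f |-> funk k f to the planes tau in
   planes_through a k. *)
Definition funk k f (tau : set 'rV[R]_m) : R :=
  (\int[section_area k tau]_(x in @esphere R m `&` tau) f x)%R.

Definition second_point a x : 'rV[R]_m :=
  (enorm (x - a) ^+ 2)^-1 *:
    ((enorm a ^+ 2 - 1) *: x + (2 * (1 - dotv x a)) *: a).

Definition Wop a k f x : R :=
  ((enorm a ^+ 2 - 1) / enorm (a - x) ^+ 2) ^+ k.-1 * f (second_point a x).

End transforms.

(* Main.v *)
(* The lines through [a] meet the sphere in pairs [x], [tau_a x].  In an affine
   chart [Y] of the space of these lines, the k-planes through [a] (inside a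
   fixed (k+1)-plane) are the hyperplanes, and the integral of [f] over a section
   of the sphere is, up to a constant, the integral over a hyperplane of
   [rho * h], where [rho] has compact support and depends only on [a], and
   [h Y = f (x) q ^ (k-1) + f (tau_a x) q' ^ (k-1)], [q] and [q'] being
   proportional to the distances from [a] to [x] and [tau_a x].  If all these
   integrals vanish, Fubini's theorem gives the vanishing of all exponential
   moments of [rho * h], hence [h = 0] on the support of [rho], which says that
   [f = - W_a f]; conversely [f = - W_a f] makes [h] vanish.  Injectivity on
   [{f | f = W_a f}] follows by applying this to the difference of two
   functions. *)

Require Import Defs.
From HB Require Import structures.
From mathcomp Require Import all_boot all_order all_algebra.
From mathcomp Require Import all_classical all_reals all_analysis.
From mathcomp Require Import measurable_realfun ring lra.
Set Implicit Arguments.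
Unset Strict Implicit.
Unset Printing Implicit Defensive.
Import Order.TTheory GRing.Theory Num.Theory.
Import numFieldNormedType.Exports.
Local Open Scope classical_set_scope.
Local Open Scope ring_scope.


(** * Image measures and iterated Lebesgue integrals on row vectors *)

(** Exponentials serve as test functions for two reasons: exp(theta . Y) is constant on the
    hyperplanes orthogonal to [theta], and moving [theta] by a basis vector multiplies it by
    exp(Y_i). So powers of 1 - c * sum_i (2 cosh(Y_i - Y0_i) - 2) are also tested, and they peak at
    any prescribed [Y0]. This local form suits a density that is unbounded: [rho] blows up like the
    inverse square root of the discriminant at tangent lines, and the points of tangency have to be
    reached too. Near [Y0], the argument uses only that [rho] has positive mass. The density itself
    comes from the cone over the sphere. A point v = (s, w) of the ball is described by m = bet |v|
    - s and y = w / m. Since m is homogeneous of degree one, y depends only on the ray of v, and the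
    change of variables splits into a one-variable substitution s -> m at fixed w and a dilation w =
    m y at fixed m. Integral identities are stated for non-negative functions and applied to the
    positive and negative parts of f, so that Tonelli's theorem applies. *)

Lemma ge0_integral_mrestr d (T : measurableType d) (R : realType)
    (mu : {measure set T -> \bar R}) (D : set T) (mD : measurable D)
    (f : T -> \bar R) :
  measurable_fun setT f -> (forall x, 0 <= f x)%E ->
  (\int[mrestr mu mD]_x f x = \int[mu]_(x in D) f x)%E.
Proof.
move=> mf f0.
rewrite (ge0_negligible_integral (mu := mrestr mu mD) (measurableC mD))//;
  last by rewrite /= /mrestr setICl measure0.
rewrite setDE setTI setCK; apply: eq_measure_integral => A mA AD /=.
by rewrite /mrestr; congr (mu _); rewrite setIidl.
Qed.

Lemma measurable_fun_if_set d (T : measurableType d) (R : realType) (D : set T)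
    (f : T -> \bar R) :
  measurable D -> measurable_fun D f -> measurable_fun setT (f \_ D).
Proof. by move=> mD mf; apply/(measurable_restrictT f mD). Qed.

Section density.
Context {R : realType}.
Local Notation mu := (@lebesgue_measure R).
(* [R] and [measurableTypeR R] are convertible, but as measurable types they
   are not unified; the latter is the type of the sets measured by [mu]. *)
Local Notation RB := (measurableTypeR R).
Variables (D : set RB) (F : RB -> RB) (h : RB -> R).
Hypotheses (mD : measurable D) (mF : measurable_fun setT F)
  (mh : measurable_fun setT h) (h0 : forall x, D x -> 0 <= h x).

Let G : set (RB * RB) :=
  [set p | [/\ D p.1, 0 < (p.2 : R) & (p.2 : R) < h p.1]].

Let mG : measurable G.
Proof.
have -> : G = (fst @^-1` D) `&` (snd @^-1` `]0, +oo[%classic)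
    `&` ((fun p : RB * RB => h p.1 - p.2) @^-1` `]0, +oo[%classic).
  apply/seteqP; split => -[s u] /=; rewrite /G /= !in_itv /= !andbT subr_gt0.
    by case.
  by move=> [[]].
apply: measurableI.
  apply: measurableI; rewrite -[X in measurable X]setTI.
  - exact: measurable_fst.
  - exact: measurable_snd.
rewrite -[X in measurable X]setTI.
apply: measurable_funB => //.
by apply: measurableT_comp => //; exact: measurable_fst.
Qed.

Let mFf : measurable_fun setT (fun p : RB * RB => F p.1).
Proof. by apply: measurableT_comp => //; exact: measurable_fst. Qed.

(* The measure with density [h], pushed forward along [F], is realized as the
   image of the planar measure of the subgraph of [h]. *)
Let nu := pushforward (mrestr (mu \x mu)%E mG) (fun p => F p.1).

HB.instance Definition _ := Measure.copy nu
  (measure_function_pushforward__canonical__measure_function_Measure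
    (mrestr (mu \x mu)%E mG) mFf).

Let integral_nu (Phi : RB -> \bar R) :
  measurable_fun setT Phi -> (forall x, 0 <= Phi x)%E ->
  (\int[nu]_x Phi x = \int[mu]_(s in D) (Phi (F s) * (h s)%:E))%E.
Proof.
move=> mPhi Phi0.
have mPF : measurable_fun setT (fun p : RB * RB => Phi (F p.1)).
  by apply: measurableT_comp.
rewrite ge0_integral_pushforward//= preimage_setT.
rewrite (ge0_integral_mrestr _ mG mPF)// integral_mkcond.
rewrite (fubini_tonelli1 (m1 := mu) (m2 := mu)); last 2 first.
- by apply: measurable_fun_if_set => //; exact: measurable_funTS.
- by move=> x; rewrite patchE; case: ifP.
rewrite [RHS]integral_mkcond; apply: eq_integral => s _.
rewrite /fubini_F patchE; case: ifPn => [sD|sD]; last first.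
  apply: integral0_eq => u _; rewrite patchE ifN//.
  by apply: contra sD => /set_mem[? _ _]; exact/mem_set.
rewrite (_ : (fun y => _) =
    (cst (Phi (F s))) \_ `]0, h s[%classic); last first.
  apply/funext => u; rewrite !patchE /=.
  have -> // : ((s, u) \in G) = (u \in `]0, h s[%classic).
  apply/idP/idP => [/set_mem[_ u0 uh]|/set_mem].
    by apply/mem_set; rewrite /= in_itv /= u0 uh.
  rewrite /= in_itv /= => /andP[u0 uh]; apply/mem_set; split => //.
  exact: set_mem.
rewrite -integral_mkcond integral_cst//=.
congr (_ * _)%E; rewrite lebesgue_measure_itv /= lte_fin.
by case: ltgtP (h0 (set_mem sD)) => // [_ _|<- //]; rewrite sube0.
Qed.

(** Half-open intervals are stable under intersection, generate the Borel sets and exhaust the line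
    by sets of finite measure. Hence the image under [F] of the measure of density [h] is Lebesgue
    measure on [J] as soon as the two agree on these intervals. It is applied to affine maps and to
    monotone substitutions. *)
Lemma ge0_integral_transfer (J : set RB) :
  measurable J ->
  (forall c d, c < d ->
    (\int[mu]_(s in D) ((\1_(`]c, d]%classic) (F s))%:E * (h s)%:E) =
     mu (J `&` `]c, d]))%E) ->
  forall Phi : RB -> \bar R,
  measurable_fun setT Phi -> (forall x, 0 <= Phi x)%E ->
  (\int[mu]_(x in J) Phi x = \int[mu]_(s in D) (Phi (F s) * (h s)%:E))%E.
Proof.
move=> mJ Jcd Phi mPhi Phi0.
rewrite -(integral_nu mPhi Phi0) -(ge0_integral_mrestr _ mJ mPhi Phi0).
apply: eq_measure_integral => A mA _.
pose g (n : nat) : set R := `](- n%:R), n%:R]%classic.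
apply: (@measure_unique _ R RB (@ocitv R) g _ _ _ _ (mrestr mu mJ) nu) => //.
- exact: ocitvI.
- by move=> n; exists (- n%:R, n%:R).
- apply/seteqP; split=> // x _ /=.
  exists (Num.trunc `|x|).+1 => //; rewrite /g /= in_itv /=.
  have := truncnS_gt `|x|; rewrite ltr_norml => /andP[-> /ltW ->] //.
- move=> _ [[c d]] _ <-; suff : mu (`]c, d] `&` J) = nu `]c, d] by [].
  rewrite setIC; have [cd|dc] := ltP c d; last first.
    by rewrite set_itv_ge ?bnd_simp -?leNgt// setI0 !measure0.
  rewrite -Jcd//; pose I : RB -> \bar R := fun x => (\1_(`]c, d]%classic) x)%:E.
  have mI : measurable_fun setT I by exact/measurable_EFinP.
  rewrite -[LHS](integral_nu mI); last by move=> x; rewrite lee_fin.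
  by rewrite integral_indic// setIT.
- move=> n; suff : (mu (g n `&` J) < +oo)%E by [].
  apply: (@le_lt_trans _ _ (mu (g n))).
    apply: (le_measure mu); last exact: subIsetl.
      by apply/mem_set; apply: measurableI => //; exact: measurable_itv.
    by apply/mem_set; exact: measurable_itv.
  rewrite /g lebesgue_measure_itv /=.
  by case: ifPn => _; [rewrite -EFinB; exact: ltry | exact: ltry].
Qed.

End density.

Section lebesgue_affine.
Context {R : realType}.
Local Notation RB := (measurableTypeR R).
Local Notation mu := (@lebesgue_measure R).

Lemma lebesgue_measure_ocitv (a b : R) : a < b ->
  mu `]a, b]%classic = (b - a)%:E.
Proof. by move=> ab; rewrite lebesgue_measure_itv /= lte_fin ab -EFinB. Qed.

Lemma ge0_integral_affine (p c : R) (Phi : RB -> \bar R) : 0 < p ->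
  measurable_fun setT Phi -> (forall x, 0 <= Phi x)%E ->
  (\int[mu]_x Phi x = p%:E * \int[mu]_s Phi (p * s + c)%R)%E.
Proof.
move=> p0 mPhi Phi0.
have maff : measurable_fun setT ((fun s => p * s + c) : RB -> RB).
  by apply: measurable_funD => //; exact: mulrl_measurable.
rewrite (ge0_integral_transfer (D := setT) (F := (fun s => p * s + c) : RB -> RB)
  (h := cst p))//=; last 2 first.
- by move=> _ _; exact: ltW.
- move=> a b ab; rewrite setTI.
  under eq_integral do rewrite muleC.
  have E s : (\1_(`]a, b]%classic) (p * s + c) : R) =
      \1_(`](a - c) / p, (b - c) / p]%classic) s.
    rewrite !indicE; congr ((nat_of_bool _)%:R).
    rewrite !mem_setE !in_itv /= ltr_pdivrMr// ler_pdivlMr// (mulrC s).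
    by rewrite ltrBlDr lerBrDr.
  under eq_integral do rewrite E.
  rewrite ge0_integralZl//; last 2 first.
  + exact/measurable_EFinP.
  + by rewrite lee_fin ltW.
  rewrite integral_indic// setIT lebesgue_measure_ocitv//.
  transitivity (p%:E * ((b - c) / p - (a - c) / p)%:E)%E.
    congr (_ * _)%E; apply: lebesgue_measure_ocitv.
    by rewrite ltr_pM2r ?invr_gt0// ltrD2r.
  rewrite -EFinM; congr EFin; field; exact: lt0r_neq0.
under eq_integral do rewrite muleC.
rewrite ge0_integralZl//; last by rewrite lee_fin ltW.
by apply: measurableT_comp.
Qed.

Lemma ge0_integral_opp (Phi : RB -> \bar R) :
  measurable_fun setT Phi -> (forall x, 0 <= Phi x)%E ->
  (\int[mu]_x Phi x = \int[mu]_s Phi (- s)%R)%E.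
Proof.
move=> mPhi Phi0.
rewrite -(preimage_setT (-%R : _ -> RB)) -ge0_integral_pushforward//=.
apply: eq_measure_integral => A mA _; exact/esym/lebesgue_measureN.
Qed.

End lebesgue_affine.

Section lebesgue_rV_theory.
Context {R : realType}.
Local Notation mu := (@lebesgue_measure R).
Local Notation lam := (@lebesgue_rV R).

Definition rV_tail k (v : 'rV[R]_k.+1) : 'rV[R]_k := \row_j v ord0 (lift ord0 j).

Lemma rV_consK k (v : 'rV[R]_k.+1) : rV_cons (v ord0 ord0, rV_tail v) = v.
Proof.
apply/rowP => i; case: (unliftP ord0 i) => [j ->|->].
  by rewrite rV_consS mxE.
by rewrite rV_cons0.
Qed.

Lemma rV_consD k s t (v w : 'rV[R]_k) :
  rV_cons (s, v) + rV_cons (t, w) = rV_cons (s + t, v + w).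
Proof.
apply/rowP => i; rewrite mxE; case: (unliftP ord0 i) => [j ->|->].
  by rewrite !rV_consS mxE.
by rewrite !rV_cons0.
Qed.

Lemma rV_consZ k p s (v : 'rV[R]_k) :
  p *: rV_cons (s, v) = rV_cons (p * s, p *: v).
Proof.
apply/rowP => i; rewrite mxE; case: (unliftP ord0 i) => [j ->|->].
  by rewrite !rV_consS mxE.
by rewrite !rV_cons0.
Qed.

Lemma measurable_affine_rV m n (A : 'M[R]_(m, n)) (c : 'rV[R]_n) :
  measurable_fun setT (fun v : 'rV[R]_m => v *m A + c).
Proof.
apply: measurable_fun_rV => i.
rewrite [X in measurable_fun _ X](_ : _ =
    (fun v : 'rV[R]_m => \sum_j v ord0 j * A j i + c ord0 i)); last first.
  by apply/funext => t; rewrite !mxE.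
apply: measurable_funD => //.
apply: measurable_sum => j; apply: measurable_funM => //.
exact: measurable_coord.
Qed.

Lemma measurable_mulmx m n (A : 'M[R]_(m, n)) :
  measurable_fun setT (fun v : 'rV[R]_m => v *m A).
Proof.
by under eq_fun do rewrite -[_ *m _]addr0; exact: measurable_affine_rV.
Qed.

Lemma measurable_addr_rV m (c : 'rV[R]_m) :
  measurable_fun setT (fun v : 'rV[R]_m => v + c).
Proof.
by under eq_fun do rewrite -[X in X + _]mulmx1; exact: measurable_affine_rV.
Qed.

Lemma measurable_scale_rV m (p : R) :
  measurable_fun setT (fun v : 'rV[R]_m => p *: v).
Proof.
by under eq_fun do rewrite -mul_mx_scalar; exact: measurable_mulmx.
Qed.

Lemma measurable_rV_cons2 d (T : measurableType d) k (f : T -> R)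
    (g : T -> 'rV[R]_k) :
  measurable_fun setT f -> measurable_fun setT g ->
  measurable_fun setT (fun t => rV_cons (f t, g t)).
Proof.
move=> mf mg; apply: (measurableT_comp (@measurable_rV_cons R k)).
exact: measurable_fun_pair.
Qed.

Lemma measurable_coord_comp d (T : measurableType d) k (g : T -> 'rV[R]_k) i :
  measurable_fun setT g -> measurable_fun setT (fun t => g t ord0 i : R).
Proof. by move=> mg; apply: (measurableT_comp (measurable_coord i)). Qed.

Lemma measurable_scale_comp d (T : measurableType d) k (f : T -> R)
    (g : T -> 'rV[R]_k) :
  measurable_fun setT f -> measurable_fun setT g ->
  measurable_fun setT (fun t => f t *: g t).
Proof.
move=> mf mg; apply: measurable_fun_rV => i.
under eq_fun do rewrite mxE.
by apply: measurable_funM => //; exact: measurable_coord_comp.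
Qed.

Lemma measurable_add_comp d (T : measurableType d) k (f g : T -> 'rV[R]_k) :
  measurable_fun setT f -> measurable_fun setT g ->
  measurable_fun setT (fun t => f t + g t).
Proof.
move=> mf mg; apply: measurable_fun_rV => i.
under eq_fun do rewrite mxE.
by apply: measurable_funD => //; exact: measurable_coord_comp.
Qed.

Section fubini.
Variables (k : nat) (H : 'rV[R]_k.+1 -> \bar R).
Hypotheses (mH : measurable_fun setT H) (H0 : forall v, (0 <= H v)%E).

Let Hc (p : measurableTypeR R * 'rV[R]_k) := H (rV_cons p).

Let mHc : measurable_fun setT Hc.
Proof. by apply: (measurableT_comp mH); exact: measurable_rV_cons. Qed.

Let Hc0 p : (0 <= Hc p)%E. Proof. exact: H0. Qed.

Let integral_cons : (\int[lam k.+1]_v H v = \int[(mu \x lam k)%E]_p Hc p)%E.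
Proof.
have mrc : measurable_fun setT
    (@rV_cons R k : measurableTypeR R * 'rV[R]_k -> 'rV[R]_k.+1).
  exact: measurable_rV_cons.
have := ge0_integral_pushforward mrc (mu \x lam k)%E measurableT mH
  (fun x _ => H0 x).
by rewrite preimage_setT.
Qed.

Lemma ge0_integral_rV_cons :
  (\int[lam k.+1]_v H v = \int[mu]_s \int[lam k]_w H (rV_cons (s, w)))%E.
Proof. by rewrite integral_cons (fubini_tonelli1 Hc mHc Hc0). Qed.

Lemma ge0_integral_rV_cons' :
  (\int[lam k.+1]_v H v = \int[lam k]_w \int[mu]_s H (rV_cons (s, w)))%E.
Proof. by rewrite integral_cons (fubini_tonelli2 Hc mHc Hc0). Qed.

Lemma measurable_integral_rV_cons :
  measurable_fun setT (fun s : measurableTypeR R =>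
    (\int[lam k]_w H (rV_cons (s, w)))%E).
Proof. exact: (measurable_fun_fubini_tonelli_F Hc mHc Hc0). Qed.

End fubini.

Lemma ge0_integral_rV_shift k (c : 'rV[R]_k) (H : 'rV[R]_k -> \bar R) :
  measurable_fun setT H -> (forall v, 0 <= H v)%E ->
  (\int[lam k]_v H (v + c)%R = \int[lam k]_v H v)%E.
Proof.
elim: k c H => [|k IH] c H mH H0.
  by apply: eq_integral => v _; rewrite !thinmx0.
rewrite !ge0_integral_rV_cons//; last first.
  by apply: (measurableT_comp mH); exact: measurable_addr_rV.
rewrite [RHS](ge0_integral_affine (c ord0 ord0) ltr01); last 2 first.
- exact: measurable_integral_rV_cons.
- by move=> x; exact: integral_ge0.
rewrite mul1e; apply: eq_integral => s _; rewrite mul1r.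
rewrite -[RHS](IH (rV_tail c)); last 2 first.
- by apply: (measurableT_comp mH); exact: measurable_rV_cons2.
- by move=> v; exact: H0.
by apply: eq_integral => w _; rewrite -[in LHS](rV_consK c) rV_consD.
Qed.

Lemma ge0_integral_rV_scale k (p : R) (H : 'rV[R]_k -> \bar R) : 0 < p ->
  measurable_fun setT H -> (forall v, 0 <= H v)%E ->
  (\int[lam k]_v H v = (p ^+ k)%:E * \int[lam k]_v H (p *: v)%R)%E.
Proof.
move=> p0; elim: k H => [|k IH] H mH H0.
  by rewrite mul1e; apply: eq_integral => v _; rewrite !thinmx0.
rewrite !ge0_integral_rV_cons//; last first.
  by apply: (measurableT_comp mH); exact: measurable_scale_rV.
rewrite [LHS](ge0_integral_affine 0 p0); last 2 first.
- exact: measurable_integral_rV_cons.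
- by move=> x; exact: integral_ge0.
rewrite exprS EFinM -muleA; congr (_ * _)%E.
rewrite -ge0_integralZl//; last 3 first.
- have := @measurable_integral_rV_cons k (fun v => H (p *: v)).
  apply=> //; apply: (measurableT_comp mH); exact: measurable_scale_rV.
- by move=> x _; exact: integral_ge0.
- by rewrite lee_fin exprn_ge0// ltW.
apply: eq_integral => s _; rewrite addr0 IH; last 2 first.
- by apply: (measurableT_comp mH); exact: measurable_rV_cons2.
- by move=> v; exact: H0.
by congr (_ * _)%E; apply: eq_integral => w _; rewrite rV_consZ.
Qed.

End lebesgue_rV_theory.

(** * Euclidean inner product and norm on row vectors *)

Section dot_product.
Context {R : realType}.

Lemma dotvE m (x y : 'rV[R]_m) : dotv x y = (x *m y^T) ord0 ord0.
Proof. by rewrite mxE; apply: eq_bigr => i _; rewrite mxE. Qed.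

Lemma dotvC m (x y : 'rV[R]_m) : dotv x y = dotv y x.
Proof. by apply: eq_bigr => i _; rewrite mulrC. Qed.

Lemma dotvDl m (x y z : 'rV[R]_m) : dotv (x + y) z = dotv x z + dotv y z.
Proof. by rewrite -big_split; apply: eq_bigr => i _; rewrite mxE mulrDl. Qed.

Lemma dotvZl m p (x y : 'rV[R]_m) : dotv (p *: x) y = p * dotv x y.
Proof. by rewrite mulr_sumr; apply: eq_bigr => i _; rewrite mxE mulrA. Qed.

Lemma dotvDr m (x y z : 'rV[R]_m) : dotv z (x + y) = dotv z x + dotv z y.
Proof. by rewrite dotvC dotvDl !(dotvC _ z). Qed.

Lemma dotvZr m p (x y : 'rV[R]_m) : dotv y (p *: x) = p * dotv y x.
Proof. by rewrite dotvC dotvZl dotvC. Qed.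

Lemma dotvNl m (x y : 'rV[R]_m) : dotv (- x) y = - dotv x y.
Proof. by rewrite -scaleN1r dotvZl mulN1r. Qed.

Lemma dotvNr m (x y : 'rV[R]_m) : dotv y (- x) = - dotv y x.
Proof. by rewrite dotvC dotvNl dotvC. Qed.

Lemma dotv0l m (x : 'rV[R]_m) : dotv 0 x = 0.
Proof. by rewrite -(scale0r 0) dotvZl mul0r. Qed.

Lemma dotv_ge0 m (x : 'rV[R]_m) : 0 <= dotv x x.
Proof. by apply: sumr_ge0 => i _; rewrite -expr2 sqr_ge0. Qed.

Lemma dotv_eq0 m (x : 'rV[R]_m) : (dotv x x == 0) = (x == 0).
Proof.
apply/eqP/eqP => [|->]; last by rewrite dotv0l.
move/psumr_eq0P => H; apply/rowP => i; rewrite mxE; apply/eqP.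
have /eqP : x ord0 i * x ord0 i = 0.
  by apply: H => // j _; rewrite -expr2 sqr_ge0.
by rewrite mulf_eq0 orbb.
Qed.

Lemma enorm_sqr m (x : 'rV[R]_m) : enorm x ^+ 2 = dotv x x.
Proof. by rewrite sqr_sqrtr// dotv_ge0. Qed.

Lemma enorm_ge0 m (x : 'rV[R]_m) : 0 <= enorm x.
Proof. exact: sqrtr_ge0. Qed.

Lemma enorm_eq0 m (x : 'rV[R]_m) : (enorm x == 0) = (x == 0).
Proof. by rewrite -dotv_eq0 -enorm_sqr sqrf_eq0. Qed.

Lemma enormZ m p (x : 'rV[R]_m) : enorm (p *: x) = `|p| * enorm x.
Proof.
by rewrite /enorm dotvZl dotvZr mulrA -expr2 sqrtrM ?sqr_ge0// sqrtr_sqr.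
Qed.

Lemma enormN m (x : 'rV[R]_m) : enorm (- x) = enorm x.
Proof. by rewrite -scaleN1r enormZ normrN1 mul1r. Qed.

Lemma dotv_mulmx m n (Q : 'M[R]_(m, n)) (x y : 'rV[R]_m) :
  Q *m Q^T = 1%:M -> dotv (x *m Q) (y *m Q) = dotv x y.
Proof.
move=> QQ; rewrite !dotvE trmx_mul mulmxA -(mulmxA x) QQ mulmx1 //.
Qed.

Lemma enorm_mulmx m n (Q : 'M[R]_(m, n)) (x : 'rV[R]_m) :
  Q *m Q^T = 1%:M -> enorm (x *m Q) = enorm x.
Proof. by move=> QQ; rewrite /enorm dotv_mulmx. Qed.

Lemma sqr_coord_le m (x : 'rV[R]_m) i : x ord0 i ^+ 2 <= dotv x x.
Proof.
rewrite /dotv (bigD1 i)//= expr2 lerDl sumr_ge0// => j _.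
by rewrite -expr2 sqr_ge0.
Qed.

Lemma coord_le_enorm m (x : 'rV[R]_m) i : `|x ord0 i| <= enorm x.
Proof. by rewrite -sqrtr_sqr ler_wsqrtr// sqr_coord_le. Qed.

Lemma dotv_cons m s t (x y : 'rV[R]_m) :
  dotv (rV_cons (s, x)) (rV_cons (t, y)) = s * t + dotv x y.
Proof.
rewrite /dotv big_ord_recl !rV_cons0; congr (_ + _).
by apply: eq_bigr => i _; rewrite !rV_consS.
Qed.

End dot_product.

(** * Invariance of Lebesgue measure under orthogonal maps *)

Section lebesgue_orth.
Context {R : realType}.
Local Notation lam := (@lebesgue_rV R).

Definition rV_box k (c : 'rV[R]_k) (e : R) : set 'rV[R]_k :=
  [set v | forall i, `|v ord0 i - c ord0 i| < e].

Lemma measurable_rV_box k (c : 'rV[R]_k) e : measurable (rV_box c e).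
Proof.
have -> : rV_box c e =
    \bigcap_(i in [set: 'I_k]) ((fun v : 'rV[R]_k => v ord0 i) @^-1`
      `](c ord0 i - e), (c ord0 i + e)[%classic).
  apply/seteqP; split => v H i => [_|]; first by rewrite /= in_itv /= -ltr_distl.
  by have := H i I; rewrite /= in_itv /= -ltr_distl.
apply: fin_bigcap_measurable => // i _; rewrite -[X in measurable X]setTI.
exact: (measurable_coord i).
Qed.

Lemma integral_indic_rV k (A : set 'rV[R]_k) : measurable A ->
  (\int[lam k]_v (\1_A v)%:E = lam k A)%E.
Proof. by move=> mA; rewrite integral_indic// setIT. Qed.

Lemma lebesgue_rV_box k (c : 'rV[R]_k) (e : R) : 0 < e ->
  lam k (rV_box c e) = ((2 * e) ^+ k)%:E.
Proof.
move=> e0; elim: k c => [|k IH] c.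
  rewrite /= diracE expr0 mem_set// => -[]//.
rewrite -integral_indic_rV; last exact: measurable_rV_box.
rewrite ge0_integral_rV_cons//; last first.
  by apply/measurable_EFinP/measurable_indic; exact: measurable_rV_box.
have E s w : (\1_(rV_box c e) (rV_cons (s, w)))%:E =
   ((\1_(`](c ord0 ord0 - e), (c ord0 ord0 + e)[%classic) s)%:E *
    (\1_(rV_box (rV_tail c) e) w)%:E)%E :> \bar R.
  rewrite !indicE -EFinM -natrM mulnb; congr ((nat_of_bool _)%:R%:E).
  apply/idP/andP => [/set_mem H|[/set_mem /= s_in /set_mem H]].
    split; apply/mem_set => /=.
      by have := H ord0; rewrite rV_cons0 in_itv /= ltr_distl.
    by move=> i; have := H (lift ord0 i); rewrite rV_consS mxE.
  apply/mem_set => i; case: (unliftP ord0 i) => [j ->|->].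
    by have := H j; rewrite rV_consS mxE.
  by rewrite rV_cons0; move: s_in; rewrite in_itv /= -ltr_distl.
under eq_integral => s _.
  under eq_integral do rewrite E.
  rewrite ge0_integralZl//; last first.
    by apply/measurable_EFinP/measurable_indic; exact: measurable_rV_box.
  rewrite integral_indic_rV; last exact: measurable_rV_box.
  rewrite IH muleC.
  over.
rewrite ge0_integralZl//; last 2 first.
- exact/measurable_EFinP.
- by rewrite lee_fin exprn_ge0// mulr_ge0// ltW.
rewrite integral_indic// setIT.
transitivity (((2 * e) ^+ k)%:E * (2 * e)%:E)%E; last first.
  by rewrite -EFinM -exprSr.
congr (_ * _)%E.
have : @lebesgue_measure R `](c ord0 ord0 - e), (c ord0 ord0 + e)[%classic =
    (2 * e)%:E by rewrite lebesgue_measure_itv /= lte_fin ltrD2l gtrN// -EFinB;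
  congr EFin; ring.
by [].
Qed.

Lemma eball_sub_box k : @eball R k `<=` rV_box 0 1.
Proof.
move=> v; rewrite /eball /= => v1 i; rewrite mxE subr0.
exact: le_lt_trans (coord_le_enorm _ _) v1.
Qed.

Lemma lebesgue_eball_fin k : (lam k (@eball R k) < +oo)%E.
Proof.
apply: (@le_lt_trans _ _ (lam k (rV_box 0 1))).
  apply: le_measure; rewrite ?inE; [exact: measurable_eball| |].
  - exact: measurable_rV_box.
  - exact: eball_sub_box.
by rewrite lebesgue_rV_box// ltry.
Qed.

Lemma lebesgue_eball_gt0 k : (0 < lam k (@eball R k))%E.
Proof.
(* If all coordinates are below [e] <= 1 in absolute value, the squared norm is at most k e, which
   is less than 1. *)
pose e : R := k.+1%:R^-1.
have e0 : 0 < e by rewrite invr_gt0 ltr0n.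
apply: (@lt_le_trans _ _ (lam k (rV_box 0 e))).
  by rewrite lebesgue_rV_box// lte_fin exprn_gt0// mulr_gt0.
apply: le_measure; rewrite ?inE; [exact: measurable_rV_box| |].
  exact: measurable_eball.
move=> v ve; rewrite /eball /= /enorm -[ltRHS]sqrtr1 ltr_sqrt//.
apply: (@le_lt_trans _ _ (\sum_(i < k) e)).
  apply: ler_sum => i _; have := ve i; rewrite mxE subr0 => vi.
  apply: le_trans (ler_norm _) _; rewrite normrM -[leRHS]mulr1.
  apply: ler_pM => //; first exact: ltW.
  by apply: le_trans (ltW vi) _; rewrite invf_le1 ?ltr0n// ler1n.
rewrite sumr_const card_ord -[_ *+ _]mulr_natl ltr_pdivrMr ?ltr0n//.
by rewrite mul1r ltr_nat.
Qed.

Lemma ge0_integral_rV_orth k (Q : 'M[R]_k) (H : 'rV[R]_k -> \bar R) :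
  Q *m Q^T = 1%:M -> measurable_fun setT H -> (forall v, 0 <= H v)%E ->
  (\int[lam k]_v H (v *m Q)%R = \int[lam k]_v H v)%E.
Proof.
move=> QQ mH H0; have QQ' := mulmx1C QQ.
pose g (x : 'rV[R]_k) : \bar R := (\1_(@eball R k) x)%:E.
have mg : measurable_fun setT g.
  by apply/measurable_EFinP/measurable_indic; exact: measurable_eball.
have g0 x : (0 <= g x)%E by rewrite lee_fin.
have ig : (\int[lam k]_x g x = lam k (@eball R k))%E.
  by apply: integral_indic_rV; exact: measurable_eball.
have gE x y : g (x - y *m Q) = g (y - x *m Q^T).
  have : enorm (x - y *m Q) = enorm (y - x *m Q^T).
    rewrite -enormN opprB -[in RHS](enorm_mulmx _ QQ) mulmxBl -mulmxA QQ'.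
    by rewrite mulmx1.
  rewrite /g !indicE => E; congr ((nat_of_bool _)%:R%:E).
  by apply/idP/idP => /set_mem; rewrite /eball /= => h; apply/mem_set;
     rewrite /eball /= -?E// E.
(* Evaluating [\int\int 1_B (x) H (y Q + x)] in both orders gives
   [|B| \int H (y Q)] and [|B| \int H], because the ball [B] is symmetric and
   invariant under [Q]. *)
have I1 : (\int[lam k]_x \int[lam k]_y (g x * H (y *m Q + x)%R) =
    (\int[lam k]_v H (v *m Q)%R) * lam k (@eball R k))%E.
  have mHQ : measurable_fun setT (fun v => H (v *m Q)).
    by apply: (measurableT_comp mH); exact: measurable_mulmx.
  rewrite -ig -ge0_integralZl//; last exact: integral_ge0.
  apply: eq_integral => x _; rewrite ge0_integralZl//; last first.
    by apply: (measurableT_comp mH); exact: measurable_affine_rV.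
  rewrite muleC; congr (_ * _)%E.
  rewrite -[RHS](ge0_integral_rV_shift (x *m Q^T))//.
  by apply: eq_integral => y _; rewrite mulmxDl -mulmxA QQ' mulmx1.
have mQ2 : measurable_fun setT (fun p : 'rV[R]_k * 'rV[R]_k => p.2 *m Q).
  by apply: (measurableT_comp (measurable_mulmx Q)); exact: measurable_snd.
have I2 : (\int[lam k]_y \int[lam k]_x (g x * H (y *m Q + x)%R) =
    (\int[lam k]_v H v) * lam k (@eball R k))%E.
  have E y : (\int[lam k]_x (g x * H (y *m Q + x)%R) =
      \int[lam k]_x (g (x - y *m Q)%R * H x))%E.
    rewrite -[LHS](ge0_integral_rV_shift (- (y *m Q))); last 2 first.
    - apply: emeasurable_funM => //.
      apply: (measurableT_comp mH).
      by rewrite (_ : +%R _ = fun x => x + y *m Q); [exact: measurable_addr_rV|];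
        apply/funext => x; rewrite addrC.
    - by move=> v; exact: mule_ge0.
    by apply: eq_integral => x _; rewrite (addrC (y *m Q)) subrK.
  under eq_integral do rewrite E.
  rewrite -(fubini_tonelli (m1 := lam k) (m2 := lam k)
    (fun p : 'rV[R]_k * 'rV[R]_k => g (p.1 - p.2 *m Q)%R * H p.1)%E); last 2 first.
  - apply: emeasurable_funM; last first.
      by apply: (measurableT_comp mH); exact: measurable_fst.
    apply: (measurableT_comp mg); apply: measurable_add_comp.
      exact: measurable_fst.
    under eq_fun do rewrite -mulmxN.
    by apply: (measurableT_comp (measurable_mulmx (- Q))); exact: measurable_snd.
  - by move=> p; exact: mule_ge0.
  rewrite /= -ig [RHS]muleC -ge0_integralZl//; last exact: integral_ge0.
  apply: eq_integral => x _; under eq_integral do rewrite muleC gE.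
  rewrite ge0_integralZl//; last first.
    by apply: (measurableT_comp mg); exact: measurable_addr_rV.
  by rewrite muleC; congr (_ * _)%E; rewrite ge0_integral_rV_shift.
have : (\int[lam k]_x \int[lam k]_y (g x * H (y *m Q + x)%R) =
    \int[lam k]_y \int[lam k]_x (g x * H (y *m Q + x)%R))%E.
  rewrite (fubini_tonelli (m1 := lam k) (m2 := lam k)
    (fun p : 'rV[R]_k * 'rV[R]_k => g p.1 * H (p.2 *m Q + p.1)%R)%E)//.
    apply: emeasurable_funM.
      by apply: (measurableT_comp mg); exact: measurable_fst.
    by apply: (measurableT_comp mH); exact: measurable_add_comp.
  by move=> p; exact: mule_ge0.
rewrite I1 I2.
(* The factor |B| can be cancelled in the extended reals because it is positive and finite. *)
have := lebesgue_eball_fin k; have := lebesgue_eball_gt0 k.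
case: (lam k (@eball R k)) => // b b0 _.
by rewrite !(muleC _ b%:E) => /(congr1 (fun z => (b^-1)%:E * z)%E);
  rewrite !muleA -EFinM mulVf ?gt_eqF// !mul1e.
Qed.

End lebesgue_orth.

(** * The chart of the sphere by lines through an exterior point *)

(** The inverse is expressed through [powR], which is measurable; squaring makes the base
    non-negative, and the outer factor [f x] restores the sign. At zeros of [f] both sides take the
    default value 0. *)
Lemma measurable_funV d (T : measurableType d) (R : realType) (f : T -> R) :
  measurable_fun setT f -> measurable_fun setT (fun x => (f x)^-1).
Proof.
move=> mf; have -> : (fun x => (f x)^-1) = (fun x => f x * (f x ^+ 2) `^ (-1)).
  apply/funext => x; rewrite powR_inv1 ?sqr_ge0// expr2 invfM mulrA.
  have [->|f0] := eqVneq (f x) 0; first by rewrite invr0 mulr0.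
  by rewrite divff// mul1r.
apply: measurable_funM => //; apply: (@measurableT_comp _ _ _ _ _ _ (@powR R ^~ (-1))).
  exact: measurable_powR.
exact: measurable_funX.
Qed.

Section substitution.
Context {R : realType}.
Local Notation RB := (measurableTypeR R).
Local Notation mu := (@lebesgue_measure R).
Variables (F F' S : R -> R) (a : R).
Hypotheses (dF : forall x : R, is_derive x 1 F (F' x)) (cF' : continuous F')
  (F'0 : forall x, a < x -> 0 <= F' x)
  (Finc : forall x y, a <= x -> x < y -> F x < F y)
  (aS : forall m, F a <= m -> a <= S m)
  (FS : forall m, F a <= m -> F (S m) = m).

Let cF : continuous F.
Proof.
by move=> x; apply: differentiable_continuous; apply/derivable1_diffP;
  case: (dF x).
Qed.

Let ltF x y : a <= x -> a <= y -> (F x < F y) = (x < y).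
Proof.
move=> ax ay; apply/idP/idP; last exact: Finc.
by case: (ltgtP x y) => // [yx|->]; rewrite ?ltxx// => /lt_trans/(_ (Finc ay yx));
  rewrite ltxx.
Qed.

Let leF x y : a <= x -> a <= y -> (F x <= F y) = (x <= y).
Proof. by move=> ax ay; rewrite !leNgt ltF. Qed.

Let FTC s t : s < t ->
  (\int[mu]_(x in `]s, t]) (F' x)%:E = (F t - F s)%:E)%E.
Proof.
move=> st; rewrite integral_itv_obnd_cbnd; last first.
  by apply/measurable_EFinP; apply: measurable_funTS;
    exact: continuous_measurable_fun.
rewrite (continuous_FTC2 (F := F)) ?EFinB//.
- exact: continuous_subspaceT.
- split; first by move=> x _; case: (dF x).
  + exact/cvg_at_right_filter/cF.
  + exact/cvg_at_left_filter/cF.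
- by move=> x _; rewrite derive1E; apply: derive_val.
Qed.

(** By the transfer principle only intervals have to be checked. [S] supplies the preimages of their
    endpoints, and the integral of [F'] between these is the increment of [F]. *)
Lemma ge0_integral_substitution (Phi : RB -> \bar R) :
  measurable_fun setT Phi -> (forall x, 0 <= Phi x)%E ->
  (\int[mu]_(m in `]F a, +oo[) Phi m =
   \int[mu]_(s in `]a, +oo[) (Phi (F s) * (F' s)%:E))%E.
Proof.
move=> mPhi Phi0.
have mF : measurable_fun setT F by exact: continuous_measurable_fun.
have mF' : measurable_fun setT F' by exact: continuous_measurable_fun.
apply: (@ge0_integral_transfer R `]a, +oo[%classic F F') => //.
  by move=> x /=; rewrite in_itv /= andbT; exact: F'0.
move=> c d cd.
(* The interval is clipped to the range of [F], where [S] is a right inverse. *)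
pose c' := Num.max c (F a).
have FaC : F a <= c' by rewrite le_max lexx orbT.
have Jcd : `]F a, +oo[%classic `&` `]c, d]%classic = `]c', d]%classic.
  apply/seteqP; split => x /=; rewrite !in_itv /= andbT gt_max.
    by move=> [-> /andP[-> ->]].
  by move=> /andP[/andP[-> ->] ->].
transitivity (\int[mu]_(s in `]a, +oo[)
    (((\1_(`]c', d]%classic) (F s))%:E * (F' s)%:E)))%E.
  apply: eq_integral => s; rewrite inE /= in_itv /= andbT => as_.
  congr (_%:E * _)%E; rewrite !indicE; congr ((nat_of_bool _)%:R).
  by rewrite !mem_setE !in_itv /= gt_max (Finc (lexx a) as_) andbT.
rewrite Jcd; have [cd'|dc'] := ltP c' d; last first.
  have -> : `]c', d]%classic = set0 :> set R.
    by apply: set_itv_ge; rewrite bnd_simp -leNgt.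
  rewrite measure0.
  by apply: integral0_eq => s _; rewrite indicE in_set0 mul0e.
have Fad : F a <= d by apply: le_trans FaC (ltW cd').
rewrite lebesgue_measure_ocitv// -[in RHS](FS FaC) -[in RHS](FS Fad).
have SS : S c' < S d by rewrite -ltF ?FS// aS.
rewrite -FTC// [RHS]integral_mkcond [LHS]integral_mkcond.
apply: eq_integral => s _; rewrite !patchE !mem_setE !in_itv /= andbT.
have [as_|sa] := ltP a s; last first.
  by rewrite ltNge (le_trans sa)//= aS.
have asW := ltW as_.
rewrite indicE mem_setE in_itv /= -[in X in X < _](FS FaC) -[in X in _ <= X](FS Fad).
rewrite ltF ?leF ?aS//.
by case: ifP => _; rewrite ?mul1e ?mul0e.
Qed.

End substitution.

(* [chart_root bet eta Y], for [eta = 1] or [-1], is a root of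
   [(1 + Y) q ^ 2 - 2 bet q + (bet ^ 2 - 1)]: the line from [bet e_1] with
   direction [(- 1, y)], [Y = |y| ^ 2], meets the unit sphere at
   [bet e_1 + q (- 1, y)]. *)
Definition chart_disc {R : realType} (bet Y : R) : R := 1 - (bet ^+ 2 - 1) * Y.

Definition chart_root {R : realType} (bet eta Y : R) : R :=
  (bet + eta * Num.sqrt (chart_disc bet Y)) / (1 + Y).

Section chart_root.
Context {R : realType}.
Variables (bet eta Y : R).
Hypotheses (bet1 : 1 < bet) (eta1 : eta ^+ 2 = 1) (Y0 : 0 <= Y).

Let b2 : 0 < bet ^+ 2 - 1. Proof. by rewrite subr_gt0 exprn_egt1. Qed.

Lemma chart_disc_le1 : chart_disc bet Y <= 1.
Proof. by rewrite gerDl oppr_le0 mulr_ge0// ltW. Qed.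

Lemma sqrt_chart_disc_le1 : Num.sqrt (chart_disc bet Y) <= 1.
Proof. by rewrite -sqrtr1 ler_wsqrtr// chart_disc_le1. Qed.

Let num_gt0 : 0 < bet + eta * Num.sqrt (chart_disc bet Y).
Proof.
have h := le_lt_trans sqrt_chart_disc_le1 bet1.
have /orP[/eqP ->|/eqP ->] : (eta == 1) || (eta == -1).
- by rewrite -sqrf_eq1 eta1.
- by rewrite mul1r ltr_pwDl// ?sqrtr_ge0// (lt_trans ltr01).
by rewrite mulN1r subr_gt0.
Qed.

(** Positivity also holds off the chart domain: the square root of a negative discriminant is 0, and
    in all cases it is at most 1 < [bet]. *)
Lemma chart_root_gt0 : 0 < chart_root bet eta Y.
Proof. by rewrite divr_gt0// ltr_pwDl. Qed.

(** Vieta's formula: [bet ^+ 2 - 1] is the power of the exterior point with respect to the sphere,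
    and [1 + Y] is the squared length of the direction of the line. *)
Lemma chart_rootN : 0 <= chart_disc bet Y ->
  chart_root bet eta Y * chart_root bet (- eta) Y = (bet ^+ 2 - 1) / (1 + Y).
Proof.
move=> d0; have Y1 : 1 + Y != 0 by rewrite gt_eqF// ltr_pwDl.
rewrite /chart_root mulf_div mulrC mulrA.
transitivity ((bet ^+ 2 - eta ^+ 2 * Num.sqrt (chart_disc bet Y) ^+ 2) /
   (1 + Y) ^+ 2); first by field.
by rewrite eta1 sqr_sqrtr// /chart_disc; field.
Qed.

Lemma chart_rootV : 0 <= chart_disc bet Y ->
  (chart_root bet eta Y)^-1 =
  (bet - eta * Num.sqrt (chart_disc bet Y)) / (bet ^+ 2 - 1).
Proof.
move=> d0; have q0 := lt0r_neq0 chart_root_gt0.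
have Y1 : 1 + Y != 0 by rewrite gt_eqF// ltr_pwDl.
apply: (mulfI q0); rewrite mulfV//.
have -> : bet - eta * Num.sqrt (chart_disc bet Y) =
    chart_root bet (- eta) Y * (1 + Y) by rewrite divfK// mulNr.
by rewrite 2!mulrA chart_rootN// divfK// divff// gt_eqF.
Qed.

Lemma chart_root_eq : 0 <= chart_disc bet Y ->
  (1 + Y) * chart_root bet eta Y ^+ 2 = 2 * bet * chart_root bet eta Y - (bet ^+ 2 - 1).
Proof.
move=> d0; have Y1 : 1 + Y != 0 by rewrite gt_eqF// ltr_pwDl.
rewrite /chart_root; set D := Num.sqrt _.
have D2 : D ^+ 2 = 1 - (bet ^+ 2 - 1) * Y by rewrite sqr_sqrtr.
apply/eqP; rewrite -subr_eq0.
rewrite (_ : _ - _ = (eta ^+ 2 * D ^+ 2 - (1 - (bet ^+ 2 - 1) * Y)) / (1 + Y)).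
  by rewrite eta1 D2 mul1r subrr mul0r.
by field.
Qed.

End chart_root.

(* The fibres [w = const] of the chart.  For a point [v = (s, w)] with
   [kap = |w|], the quantity [m = bet |v| - s] takes each value above its
   minimum twice; the two branches are exchanged by [s |-> - s], that is by
   changing the sign [eta]. *)
Section branch.
Context {R : realType}.
Local Notation RB := (measurableTypeR R).
Local Notation mu := (@lebesgue_measure R).
Variables (bet kap eta : R).
Hypotheses (bet1 : 1 < bet) (kap0 : 0 < kap) (eta1 : eta ^+ 2 = 1).

Let b2 : 0 < bet ^+ 2 - 1. Proof. by rewrite subr_gt0 exprn_egt1. Qed.
Let bet0 : 0 < bet. Proof. exact: lt_trans bet1. Qed.

Let nv s := Num.sqrt (s ^+ 2 + kap ^+ 2).
Let F s := bet * nv s - eta * s.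
Let F' s := bet * s / nv s - eta.
Let g := Num.sqrt (bet ^+ 2 - 1).
(** [a] is the critical point of [F], with minimum value [g * kap]. [S m] is the preimage of [m] to
    the right of [a], and [dm m] is the value of [nv * F'] there. *)
Let a := eta * kap / g.
Let dm m := Num.sqrt (m ^+ 2 - (bet ^+ 2 - 1) * kap ^+ 2).
Let S m := (eta * m + bet * dm m) / (bet ^+ 2 - 1).

Let g0 : 0 < g. Proof. by rewrite sqrtr_gt0. Qed.
Let g2 : g ^+ 2 = bet ^+ 2 - 1. Proof. by rewrite sqr_sqrtr// ltW. Qed.
Let nv2_gt0 s : 0 < s ^+ 2 + kap ^+ 2.
Proof. by rewrite ltr_wpDl ?sqr_ge0// exprn_gt0. Qed.
Let nv0 s : 0 < nv s. Proof. by rewrite sqrtr_gt0. Qed.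
Let nv2 s : nv s ^+ 2 = s ^+ 2 + kap ^+ 2. Proof. by rewrite sqr_sqrtr// ltW. Qed.

Let nv_a : nv a = bet * kap / g.
Proof.
rewrite /nv (_ : _ + _ = (bet * kap / g) ^+ 2).
  by rewrite sqrtr_sqr ger0_norm// divr_ge0 ?mulr_ge0 ?ltW.
rewrite /a !exprMn exprVn g2 eta1; field; exact: lt0r_neq0.
Qed.

Let Fa : F a = g * kap.
Proof.
rewrite /F nv_a /a.
rewrite (_ : _ - _ = (bet ^+ 2 - eta ^+ 2) * kap / g); last by field; exact: lt0r_neq0.
rewrite eta1 -g2; field; exact: lt0r_neq0.
Qed.

Let F'_gt0 s : a < s -> 0 < F' s.
Proof.
move=> as_; rewrite /F' subr_gt0 ltr_pdivlMr//.
have ag : a * g = eta * kap by rewrite /a divfK// gt_eqF.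
have key : (bet * s) ^+ 2 - nv s ^+ 2 = (g * s - kap) * (g * s + kap).
  rewrite nv2 exprMn; transitivity (g ^+ 2 * s ^+ 2 - kap ^+ 2).
    by rewrite g2; ring.
  by ring.
have /orP[/eqP e1|/eqP e1] : (eta == 1) || (eta == -1).
- by rewrite -sqrf_eq1 eta1.
- have gs : kap < g * s.
    by rewrite -[kap]mul1r -e1 -ag mulrC ltr_pM2l.
  have s0 : 0 < s by rewrite -(pmulr_rgt0 _ g0) (lt_trans kap0).
  rewrite e1 mul1r -ltr_sqr ?nnegrE ?mulr_ge0 ?ltW// -subr_gt0 key.
  by rewrite mulr_gt0// ?subr_gt0// addr_gt0 ?mulr_gt0.
have gs : - kap < g * s.
  by rewrite -[kap]mul1r -mulNr -e1 -ag mulrC ltr_pM2l.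
rewrite e1 mulN1r ltrNl; have [s0|s0] := leP 0 s.
  by apply: le_lt_trans (nv0 s); rewrite oppr_le0 mulr_ge0// ltW.
rewrite -mulrN -ltr_sqr ?nnegrE ?mulr_ge0 ?oppr_ge0 ?ltW// -subr_gt0 mulrN sqrrN.
rewrite -opprB key oppr_gt0 nmulr_rlt0 ?subr_lt0.
  by rewrite -ltrBlDr sub0r.
by apply: lt_trans kap0; rewrite pmulr_rlt0.
Qed.

Let nvF' s : nv s * F' s = bet * s - eta * nv s.
Proof. by rewrite /F'; field; exact: lt0r_neq0. Qed.

Let F2 s : F s ^+ 2 - (bet ^+ 2 - 1) * kap ^+ 2 = (nv s * F' s) ^+ 2.
Proof.
have -> : kap ^+ 2 = nv s ^+ 2 - s ^+ 2 by rewrite nv2; ring.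
rewrite nvF' /F; apply/eqP; rewrite -subr_eq0.
rewrite (_ : _ - _ = (1 - eta ^+ 2) * (nv s ^+ 2 - s ^+ 2)); last by ring.
by rewrite eta1 subrr mul0r.
Qed.

Let dmF s : a <= s -> dm (F s) = bet * s - eta * nv s.
Proof.
rewrite le_eqVlt => /orP[/eqP <-|as_].
  rewrite Fa /dm exprMn g2 subrr sqrtr0 nv_a /a; field; exact: lt0r_neq0.
by rewrite /dm F2 sqrtr_sqr nvF' ger0_norm// -nvF' mulr_ge0// ltW// F'_gt0.
Qed.

Let SF s : a <= s -> S (F s) = s.
Proof.
move=> as_; rewrite /S dmF// /F.
rewrite (_ : _ + _ = bet ^+ 2 * s - eta ^+ 2 * s); last by ring.
by rewrite eta1 -mulrBl mulrAC divff ?mul1r// gt_eqF.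
Qed.

Let gk0 : 0 < g * kap. Proof. exact: mulr_gt0. Qed.

Let dm2 m : g * kap <= m -> dm m ^+ 2 = m ^+ 2 - (bet ^+ 2 - 1) * kap ^+ 2.
Proof.
move=> gm; rewrite sqr_sqrtr// subr_ge0 -g2 -exprMn ler_sqr ?nnegrE ?(ltW gk0)//.
exact: le_trans (ltW gk0) gm.
Qed.

Let dm_ge0 m : 0 <= dm m. Proof. exact: sqrtr_ge0. Qed.

Let eta_le x y : 0 <= x -> x <= y -> 0 <= y + eta * x.
Proof.
move=> x0 xy; have /orP[/eqP ->|/eqP ->] : (eta == 1) || (eta == -1).
- by rewrite -sqrf_eq1 eta1.
- by rewrite mul1r addr_ge0// (le_trans x0).
by rewrite mulN1r subr_ge0.
Qed.

Let dm_le m : g * kap <= m -> dm m <= m.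
Proof.
move=> gm; have m0 : 0 <= m by apply: le_trans gm; exact: ltW.
rewrite -ler_sqr ?nnegrE// dm2// lerBlDr lerDl mulr_ge0 ?sqr_ge0//.
exact: ltW.
Qed.

Let nvS m : g * kap <= m -> nv (S m) = (bet * m + eta * dm m) / (bet ^+ 2 - 1).
Proof.
move=> gm; have m0 : 0 <= m by apply: le_trans gm; exact: ltW.
rewrite /nv (_ : _ + _ = ((bet * m + eta * dm m) / (bet ^+ 2 - 1)) ^+ 2).
  rewrite sqrtr_sqr ger0_norm// divr_ge0 ?(ltW b2)//; apply: eta_le => //.
  by apply: le_trans (dm_le gm) _; rewrite ler_peMl// ltW.
apply/eqP; rewrite -subr_eq0 /S; apply/eqP.
rewrite (_ : kap ^+ 2 = (m ^+ 2 - dm m ^+ 2) / (bet ^+ 2 - 1)); last first.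
  by rewrite dm2// opprB addrC subrK mulrC mulKf// gt_eqF.
rewrite (_ : _ - _ = ((eta ^+ 2 - 1) * (m ^+ 2 - dm m ^+ 2)) / (bet ^+ 2 - 1) ^+ 2).
  by rewrite eta1 subrr !mul0r.
field; exact: lt0r_neq0.
Qed.

Let FS m : F a <= m -> F (S m) = m.
Proof.
rewrite Fa => gm; rewrite /F nvS// /S.
rewrite (_ : _ - _ = (bet ^+ 2 - eta ^+ 2) * m / (bet ^+ 2 - 1)); last first.
  by field; exact: lt0r_neq0.
by rewrite eta1 mulrAC divff ?mul1r// gt_eqF.
Qed.

Let aS m : F a <= m -> a <= S m.
Proof.
rewrite Fa => gm; rewrite -subr_ge0 /S /a -g2.
rewrite (_ : _ - _ = (bet * dm m + eta * (m - g * kap)) / g ^+ 2); last first.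
  by field; exact: lt0r_neq0.
rewrite divr_ge0 ?sqr_ge0//; apply: eta_le; first by rewrite subr_ge0.
apply: le_trans (_ : dm m <= _); last by rewrite ler_peMl// ltW.
have m0 : 0 <= m by apply: le_trans gm; exact: ltW.
rewrite -ler_sqr ?nnegrE ?subr_ge0// dm2// -g2 -subr_ge0.
rewrite (_ : _ - _ = 2 * (g * kap) * (m - g * kap)); last by ring.
by rewrite mulr_ge0 ?subr_ge0// mulr_ge0// ltW.
Qed.

(** The case [eta = -1] is the delicate one: it requires dm m' - dm m >= m' - m. This follows on
    multiplying by dm m + dm m', since dm m' ^ 2 - dm m ^ 2 = m' ^ 2 - m ^ 2 and [dm] is at most the
    identity. *)
Let S_le m m' : F a <= m -> m <= m' -> S m <= S m'.
Proof.
rewrite Fa => gm mm'; have gm' := le_trans gm mm'.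
have m0 : 0 <= m by apply: le_trans gm; exact: ltW.
have m'0 : 0 <= m' by apply: le_trans mm'.
rewrite ler_pM2r ?invr_gt0// -subr_ge0.
rewrite (_ : _ - _ = bet * (dm m' - dm m) + eta * (m' - m)); last by ring.
apply: eta_le; first by rewrite subr_ge0.
have d_le : dm m <= dm m'.
  rewrite ler_sqrt; last first.
    by rewrite subr_ge0 -g2 -exprMn ler_sqr ?nnegrE// (ltW gk0).
  by rewrite lerB// ler_sqr.
apply: le_trans (_ : dm m' - dm m <= _); last by rewrite ler_peMl ?subr_ge0// ltW.
rewrite -subr_ge0; have [e|d_lt] := eqVneq (dm m + dm m') 0.
  have /eqP := e; rewrite paddr_eq0// => /andP[/eqP z /eqP z'].
  have e2 : m ^+ 2 = m' ^+ 2.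
    by have := dm2 gm; have := dm2 gm'; rewrite z z' => -> /subIr.
  by move/eqP: e2; rewrite eqrXn2// => /eqP ->; rewrite z' !subrr.
have d0 : 0 < dm m + dm m' by rewrite lt_neqAle eq_sym d_lt addr_ge0.
rewrite -(pmulr_rge0 _ d0).
rewrite (_ : _ * _ = (dm m' ^+ 2 - dm m ^+ 2) - (dm m + dm m') * (m' - m)); last by ring.
rewrite !dm2// (_ : _ - _ = (m' - m) * ((m - dm m) + (m' - dm m'))); last by ring.
by rewrite mulr_ge0 ?subr_ge0// addr_ge0 ?subr_ge0 ?dm_le.
Qed.

Let F_ge s : F a <= F s.
Proof.
have F0 : 0 <= F s.
  rewrite subr_ge0; apply: le_trans (ler_norm _) _.
  apply: le_trans (_ : nv s <= _); last by rewrite ler_peMl// ltW.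
  by rewrite -sqrtr_sqr exprMn eta1 mul1r ler_wsqrtr// lerDl sqr_ge0.
rewrite Fa -ler_sqr ?nnegrE ?(ltW gk0)// exprMn g2 -subr_ge0 F2.
exact: sqr_ge0.
Qed.

(** [S] is non-decreasing and inverts [F] to the right of [a], so [F y <= F x] would force
    [y <= x]. *)
Let Finc x y : a <= x -> x < y -> F x < F y.
Proof.
move=> ax xy; have ay : a <= y by rewrite (le_trans ax)// ltW.
rewrite ltNge; apply/negP => Fyx; move: xy; rewrite ltNge.
by rewrite -[X in X <= _](SF ay) -[X in _ <= X](SF ax) S_le.
Qed.

Let ball_disc m : g * kap < m -> 0 < chart_disc bet ((kap / m) ^+ 2).
Proof.
move=> gm; have m0 := lt_trans gk0 gm.
rewrite subr_gt0 -g2 -exprMn exprn_ilt1//.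
  by rewrite mulr_ge0 ?divr_ge0 ?ltW.
by rewrite mulrA ltr_pdivrMr// mul1r.
Qed.

(** In the chart w = m y, so [(kap / m) ^+ 2] is the squared norm of the chart coordinate y. *)
Let dmE m : g * kap < m -> dm m = m * Num.sqrt (chart_disc bet ((kap / m) ^+ 2)).
Proof.
move=> gm; have m0 := lt_trans gk0 gm.
rewrite /dm (_ : _ - _ = m ^+ 2 * chart_disc bet ((kap / m) ^+ 2)).
  by rewrite sqrtrM ?sqr_ge0// sqrtr_sqr gtr0_norm.
by rewrite /chart_disc; field; exact: lt0r_neq0.
Qed.

Let dF (x : R) : is_derive x 1 F (F' x).
Proof.
have dnv : is_derive x 1 nv (x / nv x).
  have d2 : is_derive x 1 (fun x : R => x ^+ 2 + kap ^+ 2) (2 * x).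
    by apply: is_derive_eq; rewrite /GRing.scale /=; ring.
  have ds := is_derive1_sqrt (nv2_gt0 x).
  have -> : x / nv x = (2 * Num.sqrt (x ^+ 2 + kap ^+ 2))^-1 * (2 * x).
    by rewrite /nv; field; exact: lt0r_neq0 (nv0 x).
  exact: (@is_derive1_comp R (@Num.sqrt R) (fun x : R => x ^+ 2 + kap ^+ 2)).
have -> : F = (bet *: nv) - (eta *: id) by [].
by apply: is_derive_eq; rewrite /F' /GRing.scale /= mulr1 mulrA.
Qed.

Let cnv : continuous nv.
Proof.
move=> x; apply: (@continuous_comp _ _ _ (fun x : R => x ^+ 2 + kap ^+ 2) Num.sqrt).
  by apply: cvgD; [exact: exprn_continuous|exact: cvg_cst].
exact: sqrt_continuous.
Qed.

Let cF' : continuous F'.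
Proof.
move=> x; apply: cvgB; last exact: cvg_cst.
apply: cvgM; first by apply: cvgM; [exact: cvg_cst|exact: cvg_id].
by apply: cvgV; [exact: lt0r_neq0|exact: cnv].
Qed.

Lemma ge0_integral_branch (Psi : RB -> \bar R) :
  measurable_fun setT Psi -> (forall x, 0 <= Psi x)%E ->
  (\int[mu]_(s in `]a, +oo[) Psi (eta * s)%R =
   \int[mu]_(m in `](g * kap)%R, +oo[)
     (Psi (m * (bet / chart_root bet (- eta) ((kap / m) ^+ 2) - 1))%R *
      ((chart_root bet (- eta) ((kap / m) ^+ 2) *
        Num.sqrt (chart_disc bet ((kap / m) ^+ 2)))^-1)%:E))%E.
Proof.
move=> mPsi Psi0.
(* The second factor is |v| / dm, the reciprocal of the derivative [F'], written in terms of m. The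
   absolute value makes [Phi] non-negative for every m, including those outside the range of [F]. *)
pose Phi (m : RB) : \bar R :=
  (Psi (eta * S m)%R * (`|bet * m + eta * dm m| / ((bet ^+ 2 - 1) * dm m))%:E)%E.
have Phi0 m : (0 <= Phi m)%E.
  apply: mule_ge0 => //; rewrite lee_fin divr_ge0// mulr_ge0 ?dm_ge0//.
  exact: ltW.
have mdm : measurable_fun setT (dm : RB -> RB).
  apply: continuous_measurable_fun => x.
  apply: (@continuous_comp _ _ _ (fun m : R => m ^+ 2 - (bet ^+ 2 - 1) * kap ^+ 2) Num.sqrt).
    by apply: cvgB; [exact: exprn_continuous|exact: cvg_cst].
  exact: sqrt_continuous.
have mS : measurable_fun setT (S : RB -> RB).
  apply: measurable_funM => //; apply: measurable_funD; apply: measurable_funM => //.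
have mPhi : measurable_fun setT Phi.
  apply: emeasurable_funM.
    by apply: (measurableT_comp mPsi); apply: measurable_funM.
  apply/measurable_EFinP; apply: measurable_funM.
    apply: measurableT_comp => //; apply: measurable_funD; apply: measurable_funM => //.
  have mdi : measurable_fun setT (fun x : RB => (bet ^+ 2 - 1) * dm x) by exact: measurable_funM.
  exact: measurable_funV.
have F'0 x : a < x -> 0 <= F' x by move=> ax; exact/ltW/F'_gt0.
have := ge0_integral_substitution dF cF' F'0 Finc aS FS mPhi Phi0.
rewrite Fa => E; transitivity (\int[mu]_(m in `](g * kap)%R, +oo[) Phi m)%E.
  rewrite E; apply: eq_integral => s; rewrite inE /= in_itv /= andbT => as_.
  rewrite /Phi SF ?(ltW as_)//.
  have dmn : dm (F s) = nv s * F' s by rewrite nvF' dmF// ltW.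
  have -> : bet * F s + eta * dm (F s) = (bet ^+ 2 - eta ^+ 2) * nv s.
    by rewrite dmF ?(ltW as_)// /F; ring.
  rewrite eta1 dmn gtr0_norm; last by rewrite mulr_gt0.
  rewrite -muleA -EFinM [X in X%:E](_ : _ = 1) ?mule1//.
  have := F'_gt0 as_ => /lt0r_neq0 F's; field.
  by rewrite F's lt0r_neq0// lt0r_neq0.
apply: eq_integral => m; rewrite inE /= in_itv /= andbT => gm.
have m0 := lt_trans gk0 gm.
set Y := (kap / m) ^+ 2; set D := Num.sqrt (chart_disc bet Y).
have D0 : 0 < D by rewrite sqrtr_gt0 ball_disc.
have Y0 : 0 <= Y by exact: sqr_ge0.
have dm_ : dm m = m * D by exact: dmE.
have eN : (- eta) ^+ 2 = 1 by rewrite sqrrN.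
have qV : (chart_root bet (- eta) Y)^-1 = (bet + eta * D) / (bet ^+ 2 - 1).
  by rewrite chart_rootV ?(ltW (ball_disc gm))// mulNr opprK.
have num0 : 0 < bet + eta * D.
  have := chart_root_gt0 bet1 eN Y0; rewrite -invr_gt0 qV.
  by rewrite pmulr_lgt0 ?invr_gt0.
rewrite /Phi; congr (Psi _ * _%:E)%E.
  rewrite qV /S dm_.
  rewrite (_ : eta * _ = (eta ^+ 2 * m + bet * eta * (m * D)) / (bet ^+ 2 - 1)); last by ring.
  by rewrite eta1; field; exact: lt0r_neq0.
rewrite [in RHS]invfM qV dm_ (_ : bet * m + _ = m * (bet + eta * D)); last by ring.
rewrite gtr0_norm ?mulr_gt0//; field.
by rewrite !lt0r_neq0.
Qed.

End branch.

Lemma ge0_integral_two_branches {R : realType} (bet kap : R)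
    (Psi : measurableTypeR R -> \bar R) :
  1 < bet -> 0 < kap -> measurable_fun setT Psi -> (forall x, 0 <= Psi x)%E ->
  let G (eta : R) (m : measurableTypeR R) :=
    (Psi (m * (bet / chart_root bet eta ((kap / m) ^+ 2) - 1))%R *
      ((chart_root bet eta ((kap / m) ^+ 2) *
        Num.sqrt (chart_disc bet ((kap / m) ^+ 2)))^-1)%:E)%E in
  let J := `](Num.sqrt (bet ^+ 2 - 1) * kap), +oo[%classic in
  (\int[@lebesgue_measure R]_s Psi s =
   \int[@lebesgue_measure R]_(m in J) G 1%R m +
   \int[@lebesgue_measure R]_(m in J) G (-1)%R m)%E.
Proof.
move=> bet1 kap0 mPsi Psi0 G J.
pose g := Num.sqrt (bet ^+ 2 - 1).
have mPsiN : measurable_fun setT (fun s : measurableTypeR R => Psi (- s)).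
  by apply: (measurableT_comp mPsi); exact: oppr_measurable.
have := ge0_integral_branch bet1 kap0 (expr1n _ 2) mPsi Psi0.
have N1 : (-1 : R) ^+ 2 = 1 by rewrite sqrrN expr1n.
have := ge0_integral_branch bet1 kap0 N1 mPsi Psi0.
rewrite opprK => E1 E2; rewrite /G /J -E1 -E2 {E1 E2}.
(* The line is cut at the minimum [kap / g] of m. The sign of a branch is opposite to that of its
   chart root: large s lies towards the exterior point and belongs to the smaller root. *)
rewrite -[in LHS](set_itvNyy R) (_ : `]-oo, +oo[%classic =
  `]-oo, (1 * kap / g)] `|` `](1 * kap / g), +oo[)%classic; last first.
  by apply/seteqP; split => x //= _; rewrite !in_itv /= andbT;
    case: (leP x (1 * kap / g)); [left|right].
rewrite ge0_integral_setU//=; last 2 first.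
- exact: measurable_funTS.
- by apply/disj_setPS => x /= []; rewrite !in_itv /= andbT leNgt => /negP.
congr (_ + _)%E; last by apply: eq_integral => s _; rewrite mul1r.
rewrite integral_mkcond [RHS]integral_mkcond ge0_integral_opp; last 2 first.
- by apply: measurable_fun_if_set => //; exact: measurable_funTS.
- by move=> x; rewrite patchE; case: ifP.
rewrite -[RHS]integral_mkcond.
rewrite integral_itv_obnd_cbnd; last first.
  by apply: measurable_funTS; under eq_fun do rewrite mulN1r.
rewrite [RHS]integral_mkcond; apply: eq_integral => s _.
rewrite !patchE !mem_setE !in_itv /= andbT mulN1r mul1r mulN1r mulNr lerNl.
by case: ifP.
Qed.

Section measurability.
Context {R : realType} d (T : measurableType d).

Lemma measurable_dotv k (f g : T -> 'rV[R]_k) :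
  measurable_fun setT f -> measurable_fun setT g ->
  measurable_fun setT (fun t => dotv (f t) (g t)).
Proof.
move=> mf mg; apply: measurable_sum => i.
by apply: measurable_funM; exact: measurable_coord_comp.
Qed.

Lemma measurable_sqrt (f : T -> R) :
  measurable_fun setT f -> measurable_fun setT (fun t => Num.sqrt (f t)).
Proof.
move=> mf; apply: (@measurableT_comp _ _ _ _ _ _ (@Num.sqrt R)) => //.
by apply: continuous_measurable_fun => x; exact: sqrt_continuous.
Qed.

Lemma measurable_chart_disc (bet : R) (f : T -> R) :
  measurable_fun setT f -> measurable_fun setT (fun t => chart_disc bet (f t)).
Proof. by move=> mf; apply: measurable_funB => //; exact: measurable_funM. Qed.

Lemma measurable_chart_root (bet eta : R) (f : T -> R) :
  measurable_fun setT f -> measurable_fun setT (fun t => chart_root bet eta (f t)).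
Proof.
move=> mf; apply: measurable_funM.
  apply: measurable_funD => //; apply: measurable_funM => //.
  exact/measurable_sqrt/measurable_chart_disc.
by apply: measurable_funV; exact: measurable_funD.
Qed.

Lemma measurable_gt0 (f : T -> R) :
  measurable_fun setT f -> measurable [set t | 0 < f t].
Proof.
move=> mf; have -> : [set t | 0 < f t] = setT `&` f @^-1` `]0, +oo[%classic.
  by rewrite setTI; apply/seteqP; split => t /=; rewrite in_itv /= andbT.
exact: mf.
Qed.

End measurability.

Section points.
Context {R : realType}.
Local Notation lam := (@lebesgue_rV R).

Lemma measurable_rV_set1 k (c : 'rV[R]_k) : measurable [set c].
Proof.
have -> : [set c] = \bigcap_(i in [set: 'I_k])
    ((fun v : 'rV[R]_k => v ord0 i) @^-1` [set c ord0 i]).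
  apply/seteqP; split => [v -> i //|v H /=]; apply/rowP => i; exact: (H i).
apply: fin_bigcap_measurable => // i _; rewrite -[X in measurable X]setTI.
exact: (measurable_coord i).
Qed.

Lemma lebesgue_rV_set1 k (c : 'rV[R]_k) : (0 < k)%N -> lam k [set c] = 0%E.
Proof.
move=> k0; apply/eqP; rewrite eq_le measure_ge0 andbT.
apply/lee_addgt0Pr => e e0; rewrite add0e.
(* Since x <= 1 and k > 0, the box of volume x ^ k has measure at most x <= e. *)
pose x : R := Num.min e 1.
have x0 : 0 < x by rewrite lt_min e0 ltr01.
apply: (@le_trans _ _ (lam k (rV_box c (x / 2)))).
  apply: le_measure; rewrite ?inE; [exact: measurable_rV_set1| |].
    exact: measurable_rV_box.
  by move=> v -> i; rewrite subrr normr0 divr_gt0.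
rewrite lebesgue_rV_box ?divr_gt0// mulrC divfK ?pnatr_eq0// lee_fin.
apply: (@le_trans _ _ x); last by rewrite ge_min lexx.
by rewrite ler_iXnr ?(ltW x0)// ge_min lexx orbT.
Qed.

End points.

(** * The surface measure of the unit sphere in the chart *)

Section chart.
Context {R : realType}.
Local Notation RB := (measurableTypeR R).
Local Notation mu := (@lebesgue_measure R).
Local Notation lam := (@lebesgue_rV R).

Definition chart_pt k (bet eta : R) (y : 'rV[R]_k) : 'rV[R]_k.+1 :=
  let q := chart_root bet eta (dotv y y) in rV_cons (bet - q, q *: y).

Definition chart_dom k (bet : R) : set 'rV[R]_k :=
  [set y | 0 < chart_disc bet (dotv y y)].

(** This is the density of surface measure in the coordinate y: solid angle contributes the k-th
    power of the distance from the exterior point, divided by the cosine of the angle between line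
    and normal. With direction d = (-1, y), all powers of |d| cancel and the inner product of the
    point with d is [eta] times the root of the discriminant. *)
Definition chart_weight k (bet eta : R) (y : 'rV[R]_k) : R :=
  chart_root bet eta (dotv y y) ^+ k / Num.sqrt (chart_disc bet (dotv y y)).

Lemma measurable_chart_dom k bet : measurable (@chart_dom k bet).
Proof.
by apply: measurable_gt0; apply: measurable_chart_disc; exact: measurable_dotv.
Qed.

Lemma measurable_chart_pt k bet eta : measurable_fun setT (@chart_pt k bet eta).
Proof.
have mq : measurable_fun setT (fun y : 'rV[R]_k => chart_root bet eta (dotv y y)).
  by apply: measurable_chart_root; exact: measurable_dotv.
apply: measurable_rV_cons2; first exact: measurable_funB.
exact: measurable_scale_comp.
Qed.

Lemma measurable_chart_weight k bet eta :
  measurable_fun setT (@chart_weight k bet eta).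
Proof.
have md : measurable_fun setT (fun y : 'rV[R]_k => dotv y y).
  exact: measurable_dotv.
apply: measurable_funM; first by apply: measurable_funX; exact: measurable_chart_root.
by apply: measurable_funV; apply: measurable_sqrt; exact: measurable_chart_disc.
Qed.

Lemma dotv_chart_pt k (bet eta : R) (y : 'rV[R]_k) : eta ^+ 2 = 1 ->
  0 <= chart_disc bet (dotv y y) ->
  dotv (chart_pt bet eta y) (chart_pt bet eta y) = 1.
Proof.
move=> eta1 d0; rewrite dotv_cons dotvZl dotvZr.
have := chart_root_eq eta1 (dotv_ge0 y) d0; set q := chart_root _ _ _ => E.
rewrite (_ : _ + _ = bet ^+ 2 - 2 * bet * q + (1 + dotv y y) * q ^+ 2); last by ring.
rewrite E; ring.
Qed.

Lemma chart_weight_ge0 k (bet eta : R) (y : 'rV[R]_k) : 1 < bet -> eta ^+ 2 = 1 ->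
  0 <= chart_weight bet eta y.
Proof.
move=> bet1 eta1; rewrite divr_ge0 ?sqrtr_ge0// exprn_ge0// ltW//.
exact: chart_root_gt0 (dotv_ge0 _).
Qed.

Lemma integral_exprn k (q : R) : 0 < q ->
  (\int[mu]_(m in `]0%R, q[) (m ^+ k)%:E = (q ^+ k.+1 / k.+1%:R)%:E)%E.
Proof.
move=> q0.
have mX : measurable_fun setT (fun m : RB => (m ^+ k)%:E : \bar R).
  by apply/measurable_EFinP; exact: exprn_measurable.
rewrite integral_itv_bndo_bndc; last exact: measurable_funTS.
rewrite integral_itv_obnd_cbnd; last exact: measurable_funTS.
have dF (x : R) : is_derive x 1 (fun m : R => m ^+ k.+1 / k.+1%:R) (x ^+ k).
  have dX : is_derive x 1 (fun m : R => m ^+ k.+1) (k.+1%:R * x ^+ k).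
    have -> : (fun m : R => m ^+ k.+1) = (id : R -> R) ^+ k.+1.
      by rewrite exprfctE.
    have := @is_deriveX R R (id : R -> R) k.+1 x 1 1 (is_derive_id x 1).
    by rewrite /GRing.scale /= mulr1.
  have -> : (fun m : R => m ^+ k.+1 / k.+1%:R) =
      k.+1%:R^-1 *: (fun m : R => m ^+ k.+1).
    by apply/funext => m; rewrite mulrC.
  by apply: is_derive_eq; rewrite /GRing.scale /= mulKf// pnatr_eq0.
have cF : continuous (fun m : R => m ^+ k.+1 / k.+1%:R).
  by move=> x; apply: differentiable_continuous; apply/derivable1_diffP;
    case: (dF x).
rewrite (continuous_FTC2 (F := fun m : R => m ^+ k.+1 / k.+1%:R))//.
- by rewrite expr0n mul0r sube0.
- by apply: continuous_subspaceT => x; exact: exprn_continuous.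
- split; first by move=> x _; case: (dF x).
  + exact/cvg_at_right_filter/cF.
  + exact/cvg_at_left_filter/cF.
- by move=> x _; rewrite derive1E; apply: derive_val.
Qed.

Lemma ge0_integral_sphere_area k (F : 'rV[R]_k -> \bar R) :
  measurable_fun setT F -> (forall v, 0 <= F v)%E ->
  (\int[sphere_area k]_x F x =
   k%:R%:E * \int[lam k]_(v in @eball R k) F (normalize v))%E.
Proof.
move=> mF F0; rewrite ge0_integral_mscale//; congr (_ * _)%E.
transitivity (\int[mrestr (lam k) (@measurable_eball R k)]_v F (normalize v))%E.
  have := @ge0_integral_pushforward _ _ _ _ R (@normalize R k)
    (@measurable_normalize R k) (mrestr (lam k) (@measurable_eball R k)) setT F
    measurableT mF (fun x _ => F0 x).
  by rewrite preimage_setT.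
apply: ge0_integral_mrestr => //.
by apply: (measurableT_comp mF); exact: measurable_normalize.
Qed.

Section chart_fixed.
Variables (k : nat) (bet : R) (F : 'rV[R]_k.+1 -> \bar R).
Hypotheses (k0 : (0 < k)%N) (bet1 : 1 < bet) (mF : measurable_fun setT F)
  (F0 : forall v, (0 <= F v)%E).

Let H (v : 'rV[R]_k.+1) : \bar R := ((fun v => F (normalize v)) \_ (@eball R k.+1)) v.

Let mH : measurable_fun setT H.
Proof.
apply: measurable_fun_if_set; first exact: measurable_eball.
apply: measurable_funTS; apply: (measurableT_comp mF).
exact: measurable_normalize.
Qed.

Let H0 v : (0 <= H v)%E. Proof. by rewrite /H patchE; case: ifP. Qed.

Let Yf (p : 'rV[R]_k * RB) : R := dotv p.1 p.1 / (p.2 : R) ^+ 2.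
Let A : set ('rV[R]_k * RB) :=
  [set p | 0 < (p.2 : R)] `&` [set p | 0 < chart_disc bet (Yf p)].
(** This is the integrand after s has been replaced by m at fixed w. [Yf (w, m)] is the squared norm
    of y = w / m, and [A] is the region where m > 0 and y lies in the chart domain. *)
Let K eta := (fun p : 'rV[R]_k * RB =>
  (H (rV_cons ((p.2 : R) * (bet / chart_root bet eta (Yf p) - 1), p.1)%R) *
   ((chart_root bet eta (Yf p) * Num.sqrt (chart_disc bet (Yf p)))^-1)%:E)%E) \_ A.

Let mYf : measurable_fun setT Yf.
Proof.
have mdd : measurable_fun setT (fun p : 'rV[R]_k * RB => dotv p.1 p.1).
  exact: measurable_dotv.
apply: measurable_funM => //; apply: measurable_funV.
by apply: measurable_funX; exact: measurable_snd.
Qed.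

Let mA : measurable A.
Proof.
apply: measurableI; first by apply: measurable_gt0; exact: measurable_snd.
by apply: measurable_gt0; exact: measurable_chart_disc.
Qed.

Let mK eta : measurable_fun setT (K eta).
Proof.
have mq := measurable_chart_root bet eta mYf.
apply: measurable_fun_if_set => //; apply: measurable_funTS.
apply: emeasurable_funM.
  apply: (measurableT_comp mH); apply: measurable_rV_cons2 => //.
  apply: measurable_funM; first exact: measurable_snd.
  apply: measurable_funB => //; apply: measurable_funM => //.
  exact: measurable_funV.
apply/measurable_EFinP; apply: measurable_funV; apply: measurable_funM => //.
exact/measurable_sqrt/measurable_chart_disc.
Qed.

Let Yf_ge0 p : 0 <= Yf p.
Proof. by rewrite divr_ge0 ?dotv_ge0 ?sqr_ge0. Qed.

Let K0 eta p : eta ^+ 2 = 1 -> (0 <= K eta p)%E.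
Proof.
move=> eta1; rewrite /K patchE; case: ifP => // _.
rewrite mule_ge0// lee_fin invr_ge0 mulr_ge0 ?sqrtr_ge0//.
exact/ltW/chart_root_gt0.
Qed.

Let slice w : w != 0 ->
  (\int[mu]_s H (rV_cons (s, w)) = \int[mu]_m K 1%R (w, m) + \int[mu]_m K (-1)%R (w, m))%E.
Proof.
move=> w0; pose kap := enorm w.
have kap0 : 0 < kap by rewrite lt_neqAle enorm_ge0 eq_sym enorm_eq0 w0.
have mPsi : measurable_fun setT (fun s : RB => H (rV_cons (s, w))).
  by apply: (measurableT_comp mH); exact: measurable_rV_cons2.
rewrite (ge0_integral_two_branches bet1 kap0 mPsi) => [|s]; last exact: H0.
have b2 : 0 < bet ^+ 2 - 1 by rewrite subr_gt0 exprn_egt1.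
have YE m : (kap / m) ^+ 2 = Yf (w, m) by rewrite /Yf /= exprMn exprVn enorm_sqr.
have AE m : (m \in `](Num.sqrt (bet ^+ 2 - 1) * kap), +oo[) = ((w, m) \in A).
  rewrite in_itv /= andbT; apply/idP/idP => [gm|/set_mem[/= m0]].
    have m0 : 0 < m by apply: lt_trans gm; rewrite mulr_gt0// sqrtr_gt0.
    apply/mem_set; split => //=; rewrite -YE subr_gt0.
    rewrite -[X in X * _](sqr_sqrtr (ltW b2)) -exprMn exprn_ilt1//.
      by rewrite mulr_ge0 ?sqrtr_ge0// divr_ge0 ?ltW.
    by rewrite mulrA ltr_pdivrMr// mul1r.
  rewrite -YE subr_gt0 -[X in X * _](sqr_sqrtr (ltW b2)) -exprMn.
  rewrite expr_lt1//; last by rewrite mulr_ge0 ?sqrtr_ge0// divr_ge0 ?ltW.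
  by rewrite mulrA ltr_pdivrMr// mul1r.
congr (_ + _)%E; rewrite integral_mkcond; apply: eq_integral => m _;
  by rewrite /K !patchE mem_setE AE YE.
Qed.

(** At w = m y the point (s, w) is m / q times the sphere point [chart_pt]. It therefore lies in the
    ball exactly when m < q, and its normalization does not depend on m. *)
Let fibre eta y m : eta ^+ 2 = 1 -> 0 < m ->
  (K eta (m *: y, m) =
   ((fun y => F (chart_pt bet eta y) * ((chart_root bet eta (dotv y y) *
       Num.sqrt (chart_disc bet (dotv y y)))^-1)%:E) \_ (@chart_dom k bet)) y *
   (\1_(`]0, chart_root bet eta (dotv y y)[%classic) m)%:E)%E.
Proof.
move=> eta1 m0; have m_neq0 := lt0r_neq0 m0.
have YE : Yf (m *: y, m) = dotv y y.
  by rewrite /Yf /= dotvZl dotvZr; field.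
rewrite /K !patchE YE.
have -> : ((m *: y, m) \in A) = (y \in @chart_dom k bet).
  apply/idP/idP => /set_mem; first by move=> [_ /=]; rewrite YE => h; exact/mem_set.
  by move=> h; apply/mem_set; split => //=; rewrite YE.
case: ifPn => [/set_mem yd|_]; last by rewrite mul0e.
set q := chart_root bet eta (dotv y y).
have q0 : 0 < q by exact: chart_root_gt0 (dotv_ge0 _).
have ptE : rV_cons (m * (bet / q - 1), m *: y) = (m / q) *: chart_pt bet eta y.
  rewrite /chart_pt -/q rV_consZ scalerA divfK ?gt_eqF//; congr rV_cons.
  by congr pair; field; exact: lt0r_neq0.
have pt1 : enorm (chart_pt bet eta y) = 1.
  by rewrite /enorm dotv_chart_pt ?sqrtr1// ltW.
have npt : enorm ((m / q) *: chart_pt bet eta y) = m / q.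
  by rewrite enormZ pt1 mulr1 gtr0_norm// divr_gt0.
have mem_pt : ((m / q) *: chart_pt bet eta y \in @eball R k.+1) = (m < q).
  by apply/idP/idP => [/set_mem|h]; [|apply/mem_set];
    rewrite /eball /= npt ltr_pdivrMr// mul1r.
rewrite ptE /H patchE mem_pt indicE mem_setE in_itv /= m0 /=.
case: ifPn => /= _; last by rewrite mul0e mule0.
rewrite mule1; congr (F _ * _)%E.
rewrite /normalize npt scalerA mulVf ?scale1r// gt_eqF// divr_gt0//.
Qed.

Let integral_K eta : eta ^+ 2 = 1 ->
  (k.+1%:R%:E * \int[lam k]_w \int[mu]_m K eta (w, m) =
   \int[lam k]_(y in @chart_dom k bet)
     (F (chart_pt bet eta y) * (chart_weight bet eta y)%:E))%E.
Proof.
move=> eta1.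
pose L := (fun y => F (chart_pt bet eta y) * ((chart_root bet eta (dotv y y) *
       Num.sqrt (chart_disc bet (dotv y y)))^-1)%:E)%E \_ (@chart_dom k bet).
have L0 y : (0 <= L y)%E.
  rewrite /L patchE; case: ifP => // _; rewrite mule_ge0// lee_fin invr_ge0.
  by rewrite mulr_ge0 ?sqrtr_ge0// ltW// chart_root_gt0 ?dotv_ge0.
have mq : measurable_fun setT (fun y : 'rV[R]_k => chart_root bet eta (dotv y y)).
  by apply: measurable_chart_root; exact: measurable_dotv.
have mL : measurable_fun setT L.
  apply: measurable_fun_if_set; first exact: measurable_chart_dom.
  apply: measurable_funTS; apply: emeasurable_funM.
    by apply: (measurableT_comp mF); exact: measurable_chart_pt.
  apply/measurable_EFinP; apply: measurable_funV; apply: measurable_funM => //.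
  by apply: measurable_sqrt; apply: measurable_chart_disc; exact: measurable_dotv.
pose C : set ('rV[R]_k * RB) := [set p | 0 < (p.2 : R)] `&`
  [set p | 0 < chart_root bet eta (dotv p.1 p.1) - (p.2 : R)].
pose B (p : 'rV[R]_k * RB) : \bar R :=
  (L p.1 * ((fun p : 'rV[R]_k * RB => ((p.2 : R) ^+ k)%:E) \_ C) p)%E.
have CE y m : ((y, m) \in C) = (m \in `]0, chart_root bet eta (dotv y y)[).
  rewrite in_itv /=; apply/idP/andP => [/set_mem[/= ? h]|[? h]].
    by rewrite subr_gt0 in h.
  by apply/mem_set; split => //=; rewrite subr_gt0.
have mB : measurable_fun setT B.
  apply: emeasurable_funM; first by apply: (measurableT_comp mL); exact: measurable_fst.
  apply: measurable_fun_if_set.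
    apply: measurableI; apply: measurable_gt0; first exact: measurable_snd.
    apply: measurable_funB; last exact: measurable_snd.
    by apply: (measurableT_comp mq); exact: measurable_fst.
  apply: measurable_funTS; apply/measurable_EFinP; apply: measurable_funX.
  exact: measurable_snd.
have B0 p : (0 <= B p)%E.
  rewrite /B mule_ge0// patchE; case: ifPn => // /set_mem[/= p0 _].
  by rewrite lee_fin exprn_ge0// ltW.
have E m : (\int[lam k]_w K eta (w, m) = \int[lam k]_y B (y, m))%E.
  have [m0|m0] := ltP 0 m; last first.
    transitivity (0 : \bar R).
      apply: integral0_eq => w _; rewrite /K patchE ifN//; apply/negP.
      by move=> /set_mem[/=]; rewrite ltNge m0.
    apply/esym; apply: integral0_eq => w _; rewrite /B patchE ifN ?mule0//.
    by apply/negP => /set_mem[/=]; rewrite ltNge m0.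
  rewrite (ge0_integral_rV_scale m0); last 2 first.
  - apply: (measurableT_comp (mK eta)); exact: measurable_fun_pair.
  - by move=> v; exact: K0.
  rewrite -ge0_integralZl//; last 3 first.
  - apply: (measurableT_comp (mK eta)); apply: measurable_fun_pair => //.
    exact: measurable_scale_rV.
  - by move=> v _; exact: K0.
  - by rewrite lee_fin exprn_ge0// ltW.
  apply: eq_integral => y _; rewrite fibre// -/(L y) muleCA /B /=; congr (_ * _)%E.
  rewrite patchE indicE -EFinM.
  rewrite CE mem_setE.
  by case: ifP => _; rewrite ?mulr1 ?mulr0.
rewrite (fubini_tonelli (m1 := lam k) (m2 := mu) (K eta)) => [|//|p]; last exact: K0.
under eq_integral do rewrite E.
rewrite -(fubini_tonelli (m1 := lam k) (m2 := mu) B)//.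
rewrite -ge0_integralZl//; last 2 first.
- exact: (measurable_fun_fubini_tonelli_F B).
- by move=> y _; exact: integral_ge0.
rewrite [RHS]integral_mkcond; apply: eq_integral => y _.
pose q := chart_root bet eta (dotv y y).
have q0 : 0 < q by exact: chart_root_gt0 (dotv_ge0 _).
(* The dilation w = m y produced the factor m ^ k. Integrating it over 0 < m < q gives q ^ (k+1) /
   (k+1), whose denominator cancels the factor in the definition of [sphere_area]. *)
have -> : (\int[mu]_m B (y, m) = L y * (q ^+ k.+1 / k.+1%:R)%:E)%E.
  rewrite -integral_exprn// -ge0_integralZl//; last 2 first.
  - by apply: measurable_funTS; apply/measurable_EFinP; exact: exprn_measurable.
  - move=> m; rewrite /= in_itv /= => /andP[m0 _].
    by rewrite lee_fin exprn_ge0// ltW.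
  rewrite [RHS]integral_mkcond; apply: eq_integral => m _.
  by rewrite /B /= !patchE CE mem_setE; case: ifP => // _; rewrite mule0.
rewrite /L !patchE; case: ifPn => [yd|_]; last by rewrite mul0e mule0.
rewrite muleCA -muleA -!EFinM; congr (_ * _%:E)%E.
rewrite /chart_weight -/q exprS invfM; field.
have D0 : Num.sqrt (chart_disc bet (dotv y y)) != 0.
  by rewrite gt_eqF// sqrtr_gt0; exact: set_mem yd.
by rewrite D0 (lt0r_neq0 q0) andbT nat1r pnatr_eq0.
Qed.

(** The cone integral is sliced at fixed w, each slice is split into its two branches, and
    [integral_K] turns each branch into an integral over y. The slice w = 0, where the substitution
    degenerates, is negligible because k > 0. *)
Lemma ge0_integral_chart :
  (\int[sphere_area k.+1]_x F x =
   \int[lam k]_(y in @chart_dom k bet)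
     (F (chart_pt bet 1%R y) * (chart_weight bet 1%R y)%:E) +
   \int[lam k]_(y in @chart_dom k bet)
     (F (chart_pt bet (-1)%R y) * (chart_weight bet (-1)%R y)%:E))%E.
Proof.
have e1 : (1 : R) ^+ 2 = 1 by rewrite expr1n.
have eN1 : (-1 : R) ^+ 2 = 1 by rewrite sqrrN expr1n.
rewrite ge0_integral_sphere_area// -!integral_K//.
have IK eta : eta ^+ 2 = 1 -> (0 <= \int[lam k]_w \int[mu]_m K eta (w, m))%E.
  by move=> h; apply: integral_ge0 => w _; apply: integral_ge0 => m _; exact: K0.
rewrite -ge0_muleDr ?IK//; congr (_ * _)%E.
rewrite integral_mkcond -/H ge0_integral_rV_cons'//.
have mIK eta : eta ^+ 2 = 1 ->
    measurable_fun setT (fun w => \int[mu]_m K eta (w, m))%E.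
  by move=> h; apply: (measurable_fun_fubini_tonelli_F (K eta)) => // p; exact: K0.
rewrite -ge0_integralD//; last 4 first.
- by move=> w _; apply: integral_ge0 => m _; exact: K0.
- exact: mIK.
- by move=> w _; apply: integral_ge0 => m _; exact: K0.
- exact: mIK.
have m0 := measurable_rV_set1 (0 : 'rV[R]_k).
have lam0 := lebesgue_rV_set1 (0 : 'rV[R]_k) k0.
have mIH : measurable_fun setT (fun w => \int[mu]_s H (rV_cons (s, w)))%E.
  apply: (measurable_fun_fubini_tonelli_F (fun p : 'rV[R]_k * RB => H (rV_cons (p.2, p.1)))).
    apply: (measurableT_comp mH); apply: measurable_rV_cons2 => //.
  by move=> p; exact: H0.
rewrite (ge0_negligible_integral m0 _ mIH _ lam0)//; last first.
  by move=> w _; exact: integral_ge0.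
rewrite [RHS](ge0_negligible_integral m0 _ _ _ lam0)//; last 2 first.
- by apply: emeasurable_funD; exact: mIK.
- by move=> w _; apply: adde_ge0; apply: integral_ge0 => m _; exact: K0.
apply: eq_integral => w; rewrite inE => -[_ /= /eqP w0].
exact: slice.
Qed.

End chart_fixed.
End chart.

(** * Measurability and boundedness of continuous functions on the sphere *)

Section topology_rV.
Context {R : realType}.

(** The sigma-algebra is generated by coordinates, hence contains boxes; an open set is the
    countable union of the boxes with rational centre and side parameter 1 / (n + 1) that it
    contains. *)
Lemma open_measurable_rV k (A : set 'rV[R]_k) : open A -> measurable A.
Proof.
move=> oA.
pose B (p : 'rV[rat]_k * nat) : set 'rV[R]_k :=
  rV_box (map_mx ratr p.1) p.2.+1%:R^-1.
have -> : A = \bigcup_p (if pselect (B p `<=` A) then B p else set0).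
  apply/seteqP; split => [x Ax|x [p _]]; last by case: pselect => // H; exact: H.
  have /nbhs_ballP[e /= e0 xeA] : nbhs x A by exact: open_nbhs_nbhs.
  have [n ne] : exists n : nat, n.+1%:R^-1 < e / 2.
    exists (Num.trunc (2 / e)); rewrite invf_plt ?posrE ?divr_gt0// invf_div.
    exact: truncnS_gt.
  pose d : R := n.+1%:R^-1; have d0 : 0 < d by rewrite invr_gt0 ltr0n.
  have Q i : exists q : rat, `|x ord0 i - ratr q| < d.
    have /rat_in_itvoo[q] : x ord0 i - d < x ord0 i + d by rewrite ltrD2l gtrN.
    by rewrite in_itv /= -ltr_distl distrC => h; exists q.
  pose q i := projT1 (cid (Q i)).
  exists (\row_i q i, n) => //; case: pselect => [_ i|H].
    by rewrite /= !mxE; exact: projT2 (cid (Q i)).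
  exfalso; apply: H => y By; apply: xeA; split => // i j.
  rewrite (ord1 i) /ball /=.
  have := By j; have := projT2 (cid (Q j)); rewrite -/(q j) /= !mxE => h1 h2.
  rewrite -(subrK (ratr (q j)) (x _ j)) -addrA (le_lt_trans (ler_normD _ _))//.
  rewrite [ltRHS]splitr ltrD// ?(lt_trans h1)// distrC (lt_trans h2)//.
apply: countable_bigcupT_measurable; first exact: countableP.
by move=> p; case: pselect => ?; [exact: measurable_rV_box|exact: measurable0].
Qed.

Lemma continuous_sum_fun (T : topologicalType) (I : Type) (s : seq I)
    (F : I -> T -> R) x :
  (forall i, {for x, continuous (F i)}) ->
  {for x, continuous (fun t => \sum_(i <- s) F i t)}.
Proof.
move=> cF; elim: s => [|i s IH].
  rewrite (_ : (fun _ => _) = cst 0); first exact: cst_continuous.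
  by apply/funext => t; rewrite big_nil.
rewrite (_ : (fun _ => _) = (fun t => F i t + \sum_(j <- s) F j t)); last first.
  by apply/funext => t; rewrite big_cons.
by apply: cvgD; [exact: cF|exact: IH].
Qed.

Lemma continuous_sqr_enorm k : continuous (fun Y : 'rV[R]_k => dotv Y Y).
Proof.
move=> x; apply: continuous_sum_fun => i.
by apply: (@continuousM _ _ (fun t : 'rV[R]_k => t ord0 i)
  (fun t : 'rV[R]_k => t ord0 i)); exact: coord_continuous.
Qed.

Lemma continuous_enorm m : continuous (@enorm R m).
Proof.
move=> x; apply: (@continuous_comp _ _ _ (fun v : 'rV[R]_m => dotv v v) Num.sqrt).
  exact: continuous_sqr_enorm.
exact: sqrt_continuous.
Qed.

Lemma enorm_normalize m (v : 'rV[R]_m) : v != 0 -> enorm (normalize v) = 1.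
Proof.
rewrite -enorm_eq0 => v0; rewrite /normalize enormZ ger0_norm ?invr_ge0 ?enorm_ge0//.
by rewrite mulVf.
Qed.

Lemma normalize_id m (v : 'rV[R]_m) : esphere v -> normalize v = v.
Proof. by rewrite /esphere /normalize /= => ->; rewrite invr1 scale1r. Qed.

Lemma esphere_neq0 m (v : 'rV[R]_m) : esphere v -> v != 0.
Proof. by move=> v1; rewrite -enorm_eq0 v1 oner_eq0. Qed.

Lemma open_neq0 m : open [set v : 'rV[R]_m | v != 0].
Proof.
have -> : [set v : 'rV[R]_m | v != 0] = @enorm R m @^-1` [set x | x != 0].
  by apply/seteqP; split => v /=; rewrite enorm_eq0.
apply: open_comp; last exact: open_neq.
by move=> x _; exact: continuous_enorm.
Qed.

Section continuous_on_sphere.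
Variables (m : nat) (f : 'rV[R]_m -> R).
Hypothesis cf : continuous_on_sphere f.

Lemma continuous_normalize_comp (v : 'rV[R]_m) : v != 0 ->
  {for v, continuous (fun v => f (normalize v))}.
Proof.
move=> v0.
have cn : {for v, continuous (@normalize R m)}.
  apply: (@continuousZ _ _ _ (fun u => (enorm u)^-1) id); last exact: cvg_id.
  apply: (@continuousV _ _ (@enorm R m)); first by rewrite enorm_eq0.
  exact: continuous_enorm.
have /subspace_continuousP/(_ _ (enorm_normalize v0)) fv := cf.
move=> U Uf.
have nU : nbhs (normalize v) [set u | esphere u -> U (f u)] := fv U Uf.
have n0 : nbhs v [set u | u != 0].
  by apply: open_nbhs_nbhs; split => //; exact: open_neq0.
change (nbhs v [set u | U (f (normalize u))]).
have nv : nbhs v [set u | esphere (normalize u) -> U (f (normalize u))] := cn _ nU.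
apply: (@filterS _ (nbhs v) _ _ _ _ (@filterI _ (nbhs v) _ _ _ nv n0)).
move=> u [H u0]; apply: H.
exact: enorm_normalize.
Qed.

(** Continuity is assumed on the sphere only, so [f] itself may fail to be measurable on the whole
    space. Its extension by homogeneity of degree zero is measurable and bounded everywhere; the
    value at the origin is a convention. *)
Definition sphere_ext (v : 'rV[R]_m) : R :=
  if v == 0 then 0 else f (normalize v).

Lemma sphere_extE v : esphere v -> sphere_ext v = f v.
Proof.
by move=> v1; rewrite /sphere_ext (negbTE (esphere_neq0 v1)) normalize_id.
Qed.

Lemma measurable_sphere_ext : measurable_fun setT sphere_ext.
Proof.
have -> : sphere_ext = (fun v => f (normalize v)) \_ [set v | v != 0].
  apply/funext => v; rewrite patchE /sphere_ext; case: eqVneq => [->|v0].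
    by rewrite ifN//; apply/negP => /set_mem /=; rewrite eqxx.
  by rewrite mem_set.
apply/(measurable_restrictT _ _).1.
  exact: open_measurable_rV (@open_neq0 m).
apply: (measurability _ (RGenOpens.measurableE R)).
move=> _ [_ [a [b ->] <-]]; apply: open_measurable_rV; rewrite openE => v [v0 vab].
apply: filterI; first by apply: open_nbhs_nbhs; split => //; exact: open_neq0.
apply: (continuous_normalize_comp v0); apply: open_nbhs_nbhs.
by split => //; exact: interval_open.
Qed.

Lemma bounded_on_sphere : exists2 M, 0 <= M & forall x, esphere x -> `|f x| <= M.
Proof.
have [->|/set0P S0] := eqVneq (@esphere R m) set0; first by exists 0.
have cS : compact (@esphere R m).
  apply: bounded_closed_compact.
    exists 1; split => // M M1 x x1; apply: ltW; apply: le_lt_trans M1.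
    rewrite [leLHS]mx_normrE; apply/bigmax_leP; split => // -[i j] _ /=.
    by rewrite (ord1 i) (le_trans (coord_le_enorm _ _))// x1.
  have -> : @esphere R m = @enorm R m @^-1` [set 1] by [].
  by apply: closed_comp => [x _|]; [exact: continuous_enorm|exact: closed_eq].
have [c _ cM] := EVT_max_rV S0 cS cf.
have [d _ dM] := EVT_min_rV S0 cS cf.
exists (`|f c| + `|f d|); first by rewrite addr_ge0.
move=> x x1; have xc := cM x (mem_set x1); have xd := dM x (mem_set x1).
rewrite ler_norml; apply/andP; split.
  apply: le_trans xd; rewrite lerNl; apply: le_trans (ler_norm _) _.
  by rewrite normrN lerDr.
by apply: le_trans xc _; apply: le_trans (ler_norm _) _; rewrite lerDl.
Qed.

Lemma bounded_sphere_ext : exists2 M, 0 <= M & forall v, `|sphere_ext v| <= M.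
Proof.
have [M M0 fM] := bounded_on_sphere; exists M => // v.
rewrite /sphere_ext; case: eqVneq => [_|v0]; first by rewrite normr0.
by apply: fM; exact: enorm_normalize.
Qed.

End continuous_on_sphere.
End topology_rV.

(** * Spherical sections *)

Section orthonormal.
Context {R : realType}.

Lemma dotv_scalar_mx m (u v : 'rV[R]_m) : u *m v^T = (dotv u v)%:M.
Proof. by rewrite dotvE -mx11_scalar. Qed.

(* The Householder reflection exchanging [u] and the first basis vector. *)
Lemma exists_orth_row0 k (u : 'rV[R]_k.+1) : dotv u u = 1 ->
  exists Q : 'M[R]_k.+1, Q *m Q^T = 1%:M /\ row ord0 Q = u.
Proof.
move=> u1; pose e : 'rV[R]_k.+1 := delta_mx 0 0.
have dot_e (v : 'rV[R]_k.+1) : dotv e v = v ord0 ord0.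
  rewrite /dotv (bigD1 ord0)//= big1 ?addr0 ?mxE ?eqxx ?mul1r// => i i0.
  by rewrite mxE (negbTE i0) andbF mul0r.
have [ue|ue] := eqVneq u e.
  by exists 1%:M; rewrite trmx1 mulmx1; split => //; rewrite ue row1.
pose w := u - e; have w0 : dotv w w != 0 by rewrite dotv_eq0 subr_eq0.
have ww : dotv w w = 2 - 2 * u ord0 ord0.
  rewrite /w dotvDl !dotvDr !dotvNl !dotvNr u1 (dotvC u e) !dot_e mxE eqxx /=.
  ring.
pose c := 2 / dotv w w; pose Q := 1%:M - c *: (w^T *m w).
have QT : Q^T = Q by rewrite /Q linearB /= trmx1 linearZ /= trmx_mul trmxK.
have cc : (c *: (w^T *m w)) *m (c *: (w^T *m w)) =
    c *: (w^T *m w) + c *: (w^T *m w).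
  rewrite -scalemxAl -scalemxAr mulmxA -(mulmxA w^T) dotv_scalar_mx.
  rewrite mul_mx_scalar -scalemxAl !scalerA -scalerDl; congr (_ *: _).
  by rewrite /c; field.
exists Q; split.
  rewrite QT {2}/Q mulmxBr mulmx1 mulmxBl mul1mx cc opprB addrK.
  by rewrite /Q subrK.
rewrite rowE -/e /Q mulmxBr mulmx1 -scalemxAr mulmxA dotv_scalar_mx dot_e.
rewrite mul_scalar_mx scalerA (_ : c * _ = -1).
  by rewrite scaleN1r opprK addrC subrK.
have e0 : e ord0 ord0 = 1 by rewrite mxE eqxx.
have -> : w ord0 ord0 = u ord0 ord0 - 1 by rewrite /w mxE [in X in _ + X]mxE e0.
by apply: (mulIf w0); rewrite /c mulrAC divfK// ww; ring.
Qed.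

(** This rotates a given vector onto the first coordinate axis. It is used for the frequency of an
    exponential and for the component of a point orthogonal to the axis through [a]. *)
Lemma exists_orth_row_multiple k (w : 'rV[R]_k.+1) :
  exists Q : 'M[R]_k.+1, Q *m Q^T = 1%:M /\ w = enorm w *: row ord0 Q.
Proof.
have [->|w0] := eqVneq w 0.
  exists 1%:M; rewrite trmx1 mulmx1; split => //.
  by rewrite /enorm dotv0l sqrtr0 scale0r.
have [|Q [QQ Q0]] := @exists_orth_row0 k (normalize w).
  by rewrite -enorm_sqr enorm_normalize// expr1n.
exists Q; split => //; rewrite Q0 /normalize scalerA divff ?scale1r//.
by rewrite enorm_eq0.
Qed.

Lemma orth_row_free k m (U : 'M[R]_(k, m)) : U *m U^T = 1%:M -> row_free U.
Proof. by move=> UU; apply/row_freeP; exists U^T. Qed.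

Lemma orth_proj k m (U : 'M[R]_(k, m)) l (A : 'M[R]_(l, m)) : U *m U^T = 1%:M ->
  (A <= U)%MS -> A *m U^T *m U = A.
Proof. by move=> UU /submxP[B ->]; rewrite -(mulmxA B) UU mulmx1. Qed.

Lemma orth_col_mx k m (u : 'rV[R]_m) (U : 'M[R]_(k, m)) :
  dotv u u = 1 -> U *m U^T = 1%:M -> u *m U^T = 0 ->
  col_mx u U *m (col_mx u U)^T = 1%:M.
Proof.
move=> uu UU uU.
have Uu : U *m u^T = 0 by rewrite -[LHS]trmxK trmx_mul trmxK uU trmx0.
by rewrite tr_col_mx mul_col_row dotv_scalar_mx uu UU uU Uu -scalar_mx_block.
Qed.

Lemma gram_schmidt k m (V : 'M[R]_(k, m)) : row_free V ->
  exists U : 'M[R]_(k, m), U *m U^T = 1%:M /\ (U :=: V)%MS.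
Proof.
elim: k V => [|k IH] V fV; first by exists V; split => //; rewrite !flatmx0.
pose v : 'rV[R]_m := usubmx (V : 'M[R]_(1 + k, m)).
pose V' : 'M[R]_(k, m) := dsubmx (V : 'M[R]_(1 + k, m)).
have VE : V = col_mx v V' :> 'M[R]_(1 + k, m) by rewrite vsubmxK.
have rk : \rank (col_mx v V') = (1 + k)%N by rewrite -VE; exact/eqP.
have fV' : row_free V'.
  rewrite /row_free eqn_leq rank_leq_row /= -(leq_add2l 1) -rk.
  rewrite -addsmxE.
  apply: leq_trans (mxrank_adds_leqif _ _) _.
  by rewrite leq_add2r rank_leq_row.
have [U' [UU' UV']] := IH V' fV'.
pose v' := v - v *m U'^T *m U'.
have v'U : v' *m U'^T = 0 by rewrite mulmxBl -(mulmxA (v *m _)) UU' mulmx1 subrr.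
have v'0 : v' != 0.
  apply/eqP => /subr0_eq vE; have vV' : (v <= V')%MS.
    by rewrite -UV' vE submxMl.
  have := rk; rewrite -addsmxE (addsmx_idPr vV') => rV'.
  by have := rank_leq_row V'; rewrite rV' ltnn.
have n0 : enorm v' != 0 by rewrite enorm_eq0.
pose u := (enorm v')^-1 *: v'.
have uu : dotv u u = 1.
  by rewrite dotvZl dotvZr -enorm_sqr; field.
have uU : u *m U'^T = 0 by rewrite -scalemxAl v'U scaler0.
have S1 : (col_mx u U' <= col_mx v V')%MS.
  rewrite col_mx_sub -!addsmxE; apply/andP; split; last first.
    by apply: submx_trans (addsmxSr _ _); rewrite UV'.
  apply: scalemx_sub; apply: addmx_sub; first exact: addsmxSl.
  rewrite eqmx_opp; apply: submx_trans (addsmxSr _ _).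
  by rewrite -UV' submxMl.
have S2 : (col_mx v V' <= col_mx u U')%MS.
  rewrite col_mx_sub -!addsmxE; apply/andP; split; last first.
    by apply: submx_trans (addsmxSr _ _); rewrite UV'.
  have -> : v = enorm v' *: u + v *m U'^T *m U'.
    by rewrite scalerA mulfV// scale1r subrK.
  apply: addmx_sub; first by apply: scalemx_sub; exact: addsmxSl.
  by apply: submx_trans (addsmxSr _ _); exact: submxMl.
exists (col_mx u U'); split; first exact: orth_col_mx.
by apply/eqmxP/andP; rewrite VE.
Qed.

End orthonormal.

Section sphere_area_theory.
Context {R : realType}.
Local Notation lam := (@lebesgue_rV R).

Let measurable_ball_ext k (F : 'rV[R]_k -> \bar R) : measurable_fun setT F ->
  measurable_fun setT ((fun v => F (normalize v)) \_ (@eball R k)).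
Proof.
move=> mF; apply: measurable_fun_if_set; first exact: measurable_eball.
apply: measurable_funTS; apply: (measurableT_comp mF).
exact: measurable_normalize.
Qed.

(** [sphere_area] is an image under [normalize], which maps every vector except the origin to the
    sphere; the origin is a null set because k > 0. *)
Lemma eq_integral_sphere_area k (F1 F2 : 'rV[R]_k -> \bar R) : (0 < k)%N ->
  measurable_fun setT F1 -> (forall v, 0 <= F1 v)%E ->
  measurable_fun setT F2 -> (forall v, 0 <= F2 v)%E ->
  (forall v, esphere v -> F1 v = F2 v) ->
  (\int[sphere_area k]_x F1 x = \int[sphere_area k]_x F2 x)%E.
Proof.
move=> k0 mF1 F10 mF2 F20 F12; rewrite !ge0_integral_sphere_area//; congr (_ * _)%E.
rewrite integral_mkcond [RHS]integral_mkcond.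
have m0 := measurable_rV_set1 (0 : 'rV[R]_k).
have lam0 := lebesgue_rV_set1 (0 : 'rV[R]_k) k0.
have P0 (F : 'rV[R]_k -> \bar R) v : (forall v, 0 <= F v)%E ->
    (0 <= ((fun v => F (normalize v)) \_ (@eball R k)) v)%E.
  by move=> F0; rewrite patchE; case: ifP.
rewrite (ge0_negligible_integral m0 _ (measurable_ball_ext mF1) _ lam0)//; last first.
  by move=> v _; exact: P0.
rewrite [RHS](ge0_negligible_integral m0 _ (measurable_ball_ext mF2) _ lam0)//; last first.
  by move=> v _; exact: P0.
apply: eq_integral => v; rewrite inE => -[_ /= /eqP v0].
by rewrite !patchE F12//; exact: enorm_normalize.
Qed.

Lemma ge0_integral_sphere_area_orth k (Q : 'M[R]_k) (F : 'rV[R]_k -> \bar R) :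
  Q *m Q^T = 1%:M -> measurable_fun setT F -> (forall v, 0 <= F v)%E ->
  (\int[sphere_area k]_x F (x *m Q)%R = \int[sphere_area k]_x F x)%E.
Proof.
move=> QQ mF F0; rewrite !ge0_integral_sphere_area//; last first.
  by apply: (measurableT_comp mF); exact: measurable_mulmx.
congr (_ * _)%E; rewrite integral_mkcond [RHS]integral_mkcond.
rewrite -[RHS](ge0_integral_rV_orth QQ (measurable_ball_ext mF)); last first.
  by move=> v; rewrite patchE; case: ifP.
apply: eq_integral => v _; rewrite !patchE /normalize enorm_mulmx// -scalemxAl.
have -> // : (v \in @eball R k) = (v *m Q \in @eball R k).
by apply/idP/idP => /set_mem h; apply/mem_set; rewrite /eball /= enorm_mulmx// in h *.
Qed.

Lemma sphere_area_fin k : (sphere_area k [set: 'rV[R]_k] < +oo)%E.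
Proof.
rewrite -[X in sphere_area k X]setIT -integral_indic// (_ : (fun _ => _) = cst 1%E);
  last by apply/funext => v; rewrite indicT.
rewrite ge0_integral_sphere_area// integral_cst//; last exact: measurable_eball.
rewrite mul1e lte_mul_pinfty// ?lee_fin//.
exact: lebesgue_eball_fin.
Qed.

End sphere_area_theory.

Section section_area.
Context {R : realType} {m : nat}.

Lemma exists_plane_frame k (tau : set 'rV[R]_m) : affine_plane k tau ->
  exists cU : 'rV[R]_m * 'M[R]_(k, m), plane_frame tau cU.
Proof.
move=> [p [V [fV ->]]]; have [U [UU UV]] := gram_schmidt fV.
exists (p - p *m U^T *m U, U); split => //=.
  by rewrite mulmxBl -(mulmxA (p *m _)) UU mulmx1 subrr.
apply/seteqP; split => x /=; rewrite opprB addrCA => h.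
  by rewrite addmx_sub ?submxMl// UV.
rewrite -UV -[x - p](addrK (p *m U^T *m U)) addmx_sub//.
  by rewrite addrC.
by rewrite eqmx_opp submxMl.
Qed.

(** The centre is the only point of the plane orthogonal to its direction, and two orthonormal bases
    of one subspace differ by the orthogonal matrix U' U^T. *)
Lemma plane_frame_eq k (tau : set 'rV[R]_m) (cU cU' : 'rV[R]_m * 'M[R]_(k, m)) :
  plane_frame tau cU -> plane_frame tau cU' ->
  cU.1 = cU'.1 /\ exists Q : 'M[R]_k, Q *m Q^T = 1%:M /\ cU'.2 = Q *m cU.2.
Proof.
case: cU cU' => [c U] [c' U'] [/= UU cU tauE] [/= UU' cU' tauE'].
have H x : (x - c <= U)%MS <-> (x - c' <= U')%MS.
  have : ([set x | (x - c <= U)%MS] = [set x | (x - c' <= U')%MS]) by rewrite -tauE.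
  by move=> /seteqP[h1 h2]; split => [/h1|/h2].
have c'c : (c' - c <= U)%MS by apply/H; rewrite subrr sub0mx.
have sub (w : 'rV[R]_m) : (w <= U')%MS -> (w <= U)%MS.
  move=> wU; have : (c' + w - c <= U)%MS by apply/H; rewrite addrAC subrr add0r.
  by rewrite addrAC => h; rewrite -[w](addKr (c' - c)) addmx_sub ?eqmx_opp.
have U'U : (U' <= U)%MS.
  by apply/row_subP => i; apply: sub; exact: row_sub.
have cc' : c = c'.
  apply/esym/eqP; rewrite -subr_eq0 -[X in X == _](orth_proj UU c'c) mulmxBl cU subr0.
  have cc : (c - c' <= U')%MS by apply/H; rewrite subrr sub0mx.
  have /submxP[B UE] : (U <= U')%MS.
    apply/row_subP => i; have : (c + row i U - c' <= U')%MS.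
      by apply/H; rewrite addrAC subrr add0r row_sub.
    by rewrite addrAC => h; rewrite -[row i U](addKr (c - c')) addmx_sub ?eqmx_opp.
  by rewrite [X in _ *m X^T]UE trmx_mul (mulmxA c') cU' !mul0mx.
split => //; exists (U' *m U^T); split; last by rewrite orth_proj.
by rewrite trmx_mul trmxK mulmxA orth_proj.
Qed.

Lemma measurable_plane k (tau : set 'rV[R]_m) (cU : 'rV[R]_m * 'M[R]_(k, m)) :
  plane_frame tau cU -> measurable tau.
Proof.
case: cU => c U [/= UU _ ->].
(* The plane is the set where the orthogonal projection U^T U onto its direction fixes x - c, hence
   the zero set of an affine map. *)
have -> : [set x | (x - c <= U)%MS] =
    (fun x => x *m (U^T *m U - 1%:M) + (- c *m (U^T *m U - 1%:M))) @^-1` [set 0].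
  apply/seteqP; split => x /=; rewrite -mulmxDl.
    by move=> /(orth_proj UU) E; rewrite mulmxBr mulmxA E mulmx1 subrr.
  by rewrite mulmxBr mulmxA mulmx1 => /subr0_eq <-; exact: submxMl.
rewrite -[X in measurable X]setTI; apply: measurable_affine_rV => //.
exact: measurable_rV_set1.
Qed.

Lemma measurable_esphere : measurable (@esphere R m).
Proof.
have -> : @esphere R m = setT `&` @enorm R m @^-1` [set 1] by rewrite setTI.
exact: measurable_enorm.
Qed.

Lemma ge0_integral_subsphere k (c : 'rV[R]_m) (U : 'M[R]_(k, m))
    (r : {nonneg R}) (D : set 'rV[R]_m) (Phi : 'rV[R]_m -> \bar R) : (0 < k)%N ->
  measurable D -> (forall t, esphere t -> D (c + r%:num *: (t *m U))) ->
  measurable_fun setT Phi -> (forall v, 0 <= Phi v)%E ->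
  (\int[subsphere_area c U r]_(x in D) Phi x =
   (r%:num ^+ k.-1)%:E * \int[sphere_area k]_t Phi (c + r%:num *: (t *m U))%R)%E.
Proof.
move=> k0 mD DS mPhi Phi0; have mP := measurable_subsphere_param c U r.
rewrite ge0_integral_mscale//; last exact: measurable_funTS.
congr (_ * _)%E.
rewrite (ge0_integral_pushforward mP)//; last exact: measurable_funTS.
have mPp : measurable_fun setT (fun t => Phi (subsphere_param c U r t)).
  exact: (measurableT_comp mPhi mP).
rewrite integral_mkcond; apply: eq_integral_sphere_area => //.
- apply: measurable_fun_if_set; last exact: measurable_funTS.
  by rewrite -[X in measurable X]setTI; exact: mP.
- by move=> v; rewrite patchE; case: ifP => // _; exact: Phi0.
- by move=> v v1; rewrite patchE mem_set//; exact: DS.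
Qed.

(** The frame selected by [xget] may be exchanged for any other: they share the centre, and the
    orthogonal matrix between their bases is absorbed by the rotation invariance of
    [sphere_area]. *)
Lemma ge0_integral_section k (tau : set 'rV[R]_m) c (U : 'M[R]_(k, m))
    (Phi : 'rV[R]_m -> \bar R) : (0 < k)%N ->
  plane_frame tau (c, U) -> dotv c c <= 1 ->
  measurable_fun setT Phi -> (forall v, 0 <= Phi v)%E ->
  (\int[section_area k tau]_(x in @esphere R m `&` tau) Phi x =
   (Num.sqrt (1 - dotv c c) ^+ k.-1)%:E *
   \int[sphere_area k]_t Phi (c + Num.sqrt (1 - dotv c c) *: (t *m U))%R)%E.
Proof.
move=> k0 fr c1 mPhi Phi0.
have ex : exists cU : 'rV[R]_m * 'M[R]_(k, m), plane_frame tau cU by exists (c, U).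
rewrite /section_area; set cU0 := xget _ _.
have fr0 : plane_frame tau cU0 by exact: xgetPex.
have [cE [Q [QQ UE]]] := plane_frame_eq fr fr0; rewrite /= in cE UE.
have mD : measurable (@esphere R m `&` tau).
  by apply: measurableI; [exact: measurable_esphere|exact: measurable_plane fr].
rewrite ge0_integral_subsphere//; last first.
  case: fr0 => UU0 cU0' tau0 t; rewrite {1}/esphere /= => t1.
  have tt : dotv t t = 1 by rewrite -enorm_sqr t1 expr1n.
  have c0t : dotv cU0.1 (t *m cU0.2) = 0.
    by rewrite dotvE trmx_mul mulmxA cU0' mul0mx mxE.
  split; last first.
    rewrite tau0 /= addrAC subrr add0r.
    by apply: scalemx_sub; exact: submxMl.
  rewrite /esphere /= /enorm dotvDl !dotvDr !dotvZl !dotvZr.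
  rewrite (dotvC (t *m _)) c0t dotv_mulmx// tt !mulr0 addr0 add0r mulr1 -expr2.
  rewrite sqr_sqrtr; last by rewrite -cE subr_ge0.
  by rewrite addrC subrK sqrtr1.
rewrite -cE; congr (_ * _)%E.
rewrite -[RHS](ge0_integral_sphere_area_orth QQ); last 2 first.
- apply: (measurableT_comp mPhi); apply: measurable_add_comp => //.
  by apply: measurable_scale_comp => //; exact: measurable_mulmx.
- by move=> v; exact: Phi0.
by apply: eq_integral => t _; rewrite UE mulmxA.
Qed.

End section_area.

(** * Exponential moments *)

(** The right-hand side is the square of exp(x/2) - exp(-x/2), and for x >= 0 this difference is at
    least x/2. With [eps = 0] the bound gives non-negativity. *)
Lemma cosh_ge {R : realType} (eps x : R) : 0 <= eps -> eps <= `|x| ->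
  eps ^+ 2 / 4 <= expR x + expR (- x) - 2.
Proof.
move=> e0; wlog x0 : x / 0 <= x => [H|].
  have [x0|x0] := leP 0 x; first exact: H.
  by rewrite -normrN (addrC (expR x)) -[x in X in _ <= _ + X - _]opprK => h;
    apply: H => //; rewrite oppr_ge0 ltW.
rewrite ger0_norm// => ex.
have E (y : R) : expR y = expR (y / 2) ^+ 2 by rewrite expr2 -expRD -splitr.
have EE : expR (x / 2) * expR (- x / 2) = 1 by rewrite -expRD mulNr subrr expR0.
have -> : expR x + expR (- x) - 2 = (expR (x / 2) - expR (- x / 2)) ^+ 2.
  by rewrite sqrrB EE (E x) (E (- x)); ring.
rewrite (_ : _ / 4 = (eps / 2) ^+ 2); last by field.
have h1 : 1 + x / 2 <= expR (x / 2) by exact: expR_ge1Dx.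
have h2 : expR (- x / 2) <= 1.
  by rewrite -expR0 ler_expR mulNr oppr_le0 divr_ge0.
rewrite ler_sqr ?nnegrE ?divr_ge0//; first lra.
by rewrite subr_ge0; lra.
Qed.

Lemma near_rV_box {R : realType} k (Y0 : 'rV[R]_k) (P : set 'rV[R]_k) :
  nbhs Y0 P -> exists2 eps, 0 < eps & rV_box Y0 eps `<=` P.
Proof.
move=> /nbhs_ballP[e /= e0 eP]; exists e => // Y YE; apply: eP; split => // i j.
by rewrite (ord1 i) /ball /= distrC; exact: YE.
Qed.

Lemma bernoulli_unbounded {R : realType} (q A : R) : 1 < q -> exists N, A < q ^+ N.
Proof.
move=> q1; have x0 : 0 < q - 1 by rewrite subr_gt0.
have bern N : 1 + N%:R * (q - 1) <= q ^+ N.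
  elim: N => [|N IH]; first by rewrite mul0r addr0.
  rewrite exprS; apply: le_trans (ler_wpM2l _ IH); last by lra.
  have : 0 <= N%:R * (q - 1) * (q - 1) by rewrite !mulr_ge0// ltW.
  rewrite -natr1; lra.
exists (Num.bound (`|A| / (q - 1))); apply: lt_le_trans (bern _).
have := @archi_boundP R (`|A| / (q - 1)) (divr_ge0 (normr_ge0 _) (ltW x0)).
rewrite ltr_pdivrMr// => h; apply: le_lt_trans (ler_norm A) _; lra.
Qed.

Section exponential_moments.
Context {R : realType} (k : nat).
Local Notation lam := (@lebesgue_rV R k).
Variables (rho h : 'rV[R]_k -> R) (b M : R) (Y0 : 'rV[R]_k).
Hypotheses (mrho : measurable_fun setT rho) (mh : measurable_fun setT h)
  (rho0 : forall Y, 0 <= rho Y) (hM : forall Y, `|h Y| <= M)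
  (rho_fin : (\int[lam]_Y (rho Y)%:E < +oo)%E)
  (rho_supp : forall Y, rho Y != 0 -> forall i, `|Y ord0 i - Y0 ord0 i| <= b)
  (ch : {for Y0, continuous h})
  (rho_pos : forall eps, 0 < eps ->
    (0 < \int[lam]_Y (rho Y * \1_(rV_box Y0 eps) Y)%:E)%E)
  (moments : forall theta,
    \int[lam]_Y (rho Y * h Y * expR (dotv theta Y)) = 0).

Definition bounded_on_supp (phi : 'rV[R]_k -> R) :=
  measurable_fun setT phi /\ exists B, forall Y, rho Y != 0 -> `|phi Y| <= B.

Lemma integrable_bounded_on_supp phi : bounded_on_supp phi ->
  lam.-integrable setT (EFin \o (fun Y => rho Y * phi Y)).
Proof.
move=> [mphi [B phiB]].
apply: (@le_integrable _ _ _ _ _ _ _ (fun Y => B%:E * (rho Y)%:E)%E) => //.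
- by apply/measurable_EFinP; exact: measurable_funM.
- move=> Y _; rewrite -EFinM !abse_EFin lee_fin !normrM (ger0_norm (rho0 Y)).
  have [->|r0] := eqVneq (rho Y) 0; first by rewrite mul0r mulr0.
  rewrite mulrC ler_wpM2r//; apply: le_trans (phiB Y r0) (ler_norm _).
apply: integrableZl => //; apply/integrableP; split; first exact/measurable_EFinP.
by under eq_integral do rewrite abse_EFin ger0_norm//.
Qed.

(** The test functions annihilated by [rho * h]. They form a vector space containing the
    exponentials; boundedness on the support of [rho] provides the integrability that linearity
    requires. *)
Let Z phi := bounded_on_supp phi /\ \int[lam]_Y (rho Y * (h Y * phi Y)) = 0.

Let bd_mulh phi : bounded_on_supp phi -> bounded_on_supp (fun Y => h Y * phi Y).
Proof.
move=> [mphi [B phiB]]; split; first exact: measurable_funM.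
exists (M * B) => Y r0; rewrite normrM ler_pM//; exact: phiB.
Qed.

Let ZD phi psi : Z phi -> Z psi -> Z (fun Y => phi Y + psi Y).
Proof.
move=> [[mp [B pB]] p0] [[mq [C qC]] q0]; split.
  split; first exact: measurable_funD.
  exists (B + C) => Y r0; apply: le_trans (ler_normD _ _) _.
  by rewrite lerD ?pB ?qC.
transitivity (\int[lam]_Y (rho Y * (h Y * phi Y) + rho Y * (h Y * psi Y))).
  by apply: eq_Rintegral => Y _; rewrite !mulrDr.
rewrite RintegralD// ?p0 ?q0 ?addr0//.
- by apply: (integrable_bounded_on_supp (bd_mulh _)); split => //; exists B.
- by apply: (integrable_bounded_on_supp (bd_mulh _)); split => //; exists C.
Qed.

Let ZZ a phi : Z phi -> Z (fun Y => a * phi Y).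
Proof.
move=> [[mp [B pB]] p0]; split.
  split; first exact: measurable_funM.
  by exists (`|a| * B) => Y r0; rewrite normrM ler_wpM2l// pB.
transitivity (\int[lam]_Y (a * (rho Y * (h Y * phi Y)))).
  by apply: eq_Rintegral => Y _; ring.
rewrite RintegralZl// ?p0 ?mulr0//.
by apply: (integrable_bounded_on_supp (bd_mulh _)); split => //; exists B.
Qed.

Let Z_sum (I : Type) (s : seq I) (phi : I -> 'rV[R]_k -> R) :
  (forall i, Z (phi i)) -> Z (fun Y => \sum_(i <- s) phi i Y).
Proof.
move=> Zphi; elim: s => [|i s IH].
  have -> : (fun Y => \sum_(i <- [::]) phi i Y) = cst 0.
    by apply/funext => Y; rewrite big_nil.
  split; first by split => //; exists 0 => Y _; rewrite normr0.
  by rewrite /Rintegral integral0_eq// => Y _; rewrite /= !mulr0.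
have -> : (fun Y => \sum_(j <- i :: s) phi j Y) =
    (fun Y => phi i Y + \sum_(j <- s) phi j Y).
  by apply/funext => Y; rewrite big_cons.
exact: ZD.
Qed.

Let E theta (Y : 'rV[R]_k) := expR (dotv theta (Y - Y0)).

Let mE theta : measurable_fun setT (E theta).
Proof.
apply: (measurableT_comp (@measurable_expR R)).
by apply: measurable_dotv => //; exact: measurable_addr_rV.
Qed.

Let Z_E theta : Z (E theta).
Proof.
split.
  split; first exact: mE.
  exists (expR (\sum_i `|theta ord0 i| * b)) => Y r0.
  rewrite ger0_norm ?expR_ge0// ler_expR; apply: ler_sum => i _.
  apply: le_trans (ler_norm _) _; rewrite normrM ler_wpM2l// !mxE.
  exact: rho_supp.
transitivity (\int[lam]_Y (expR (- dotv theta Y0) *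
    (rho Y * h Y * expR (dotv theta Y)))).
  apply: eq_Rintegral => Y _; rewrite /E dotvDr dotvNr expRD; ring.
rewrite RintegralZl// ?moments ?mulr0//.
have -> : (fun Y => rho Y * h Y * expR (dotv theta Y)) =
    (fun Y => rho Y * (h Y * expR (dotv theta Y))).
  by apply/funext => Y; rewrite mulrA.
apply: (integrable_bounded_on_supp (bd_mulh _)); split.
  by apply: (measurableT_comp (@measurable_expR R)); exact: measurable_dotv.
exists (expR (\sum_i `|theta ord0 i| * (b + `|Y0 ord0 i|))) => Y r0.
rewrite ger0_norm ?expR_ge0// ler_expR; apply: ler_sum => i _.
apply: le_trans (ler_norm _) _; rewrite normrM ler_wpM2l//.
rewrite -[Y _ _](subrK (Y0 ord0 i)); apply: le_trans (ler_normD _ _) _.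
by rewrite lerD2r; exact: rho_supp.
Qed.

Let Sf (Y : 'rV[R]_k) := \sum_(i < k)
  (expR (Y ord0 i - Y0 ord0 i) + expR (- (Y ord0 i - Y0 ord0 i)) - 2).

(** The frequency [theta] stays arbitrary in the induction, because multiplication by [Sf] combines
    the exponentials of frequencies theta + e_i, theta - e_i and theta. *)
Let Z_pow c N theta : Z (fun Y => (1 - c * Sf Y) ^+ N * E theta Y).
Proof.
elim: N theta => [|N IH] theta.
  have -> : (fun Y => (1 - c * Sf Y) ^+ 0 * E theta Y) = E theta.
    by apply/funext => Y; rewrite expr0 mul1r.
  exact: Z_E.
pose de i : 'rV[R]_k := delta_mx 0 i.
have dot_de i (Y : 'rV[R]_k) : dotv (de i) Y = Y ord0 i.
  rewrite /dotv (bigD1 i)//= big1 ?addr0 ?mxE ?eqxx ?mul1r// => j ji.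
  by rewrite mxE (negbTE ji) andbF mul0r.
pose L Y := 1 - c * Sf Y.
have -> : (fun Y => L Y ^+ N.+1 * E theta Y) = (fun Y =>
  L Y ^+ N * E theta Y + (- c) * (\sum_(i < k)
    (L Y ^+ N * E (theta + de i) Y + (L Y ^+ N * E (theta - de i) Y +
     (- 2) * (L Y ^+ N * E theta Y))))).
  apply/funext => Y.
  have -> : \sum_(i < k) (L Y ^+ N * E (theta + de i) Y +
      (L Y ^+ N * E (theta - de i) Y + (- 2) * (L Y ^+ N * E theta Y))) =
      L Y ^+ N * E theta Y * Sf Y.
    rewrite /Sf mulr_sumr; apply: eq_bigr => i _.
    have -> : E (theta + de i) Y = E theta Y * expR (Y ord0 i - Y0 ord0 i).
      by rewrite /E dotvDl expRD dot_de !mxE.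
    have -> : E (theta - de i) Y = E theta Y * expR (- (Y ord0 i - Y0 ord0 i)).
      by rewrite /E dotvDl expRD dotvNl dot_de !mxE.
    ring.
  rewrite exprSr {2}/L; ring.
apply: ZD => //; apply: ZZ; apply: Z_sum => i; apply: ZD => //.
by apply: ZD => //; exact: ZZ.
Qed.

(* The function [(1 - c Sf) ^ N] is a linear combination of exponentials, and it
   peaks at [Y0]: were [h Y0] positive, the integral of [rho h (1 - c Sf) ^ N],
   which vanishes, would be positive for large [N]. *)
Lemma exponential_moments_le0 : h Y0 <= 0.
Proof.
rewrite leNgt; apply/negP => h0.
pose del := h Y0 / 2; have del0 : 0 < del by rewrite divr_gt0.
have Sf0 Y : 0 <= Sf Y.
  apply: sumr_ge0 => i _; have := @cosh_ge R 0 (Y ord0 i - Y0 ord0 i) (lexx _).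
  by rewrite expr0n mul0r; apply.
have SY0 : Sf Y0 = 0.
  by apply: big1 => i _; rewrite subrr oppr0 expR0; ring.
have cS : {for Y0, continuous Sf}.
  apply: continuous_sum_fun => i.
  pose g x := expR (x - Y0 ord0 i) + expR (- (x - Y0 ord0 i)) - 2.
  have cg : continuous g.
    move=> x; apply: cvgB; last exact: cvg_cst.
    apply: cvgD; apply: continuous_comp; try exact: continuous_expR.
      by apply: cvgB; [exact: cvg_id|exact: cvg_cst].
    by apply: cvgN; apply: cvgB; [exact: cvg_id|exact: cvg_cst].
  apply: (@continuous_comp _ _ _ (fun Y : 'rV[R]_k => Y ord0 i) g).
    exact: coord_continuous.
  exact: cg.
have [eps eps0 h_eps] : exists2 eps, 0 < eps & forall Y, rV_box Y0 eps Y -> del <= h Y.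
  have no : nbhs (h Y0) [set x | del < x].
    by apply: open_nbhs_nbhs; split; [exact: open_gt|rewrite /= /del; lra].
  have nb : nbhs Y0 [set Y | del < h Y] := ch no.
  by have [e e0 eh] := near_rV_box nb; exists e => // Y /eh /ltW.
have [eps' /andP[e'0 e'e] S_eps] : exists2 eps', 0 < eps' <= eps &
    forall Y, rV_box Y0 eps' Y -> Sf Y <= eps ^+ 2 / 8.
  have no : nbhs (Sf Y0) [set x : R | x < eps ^+ 2 / 8].
    apply: open_nbhs_nbhs; split; first exact: open_lt.
    by rewrite /= SY0 divr_gt0// exprn_gt0.
  have nb : nbhs Y0 [set Y | Sf Y < eps ^+ 2 / 8] by exact: (cS _ no).
  have [e e0 eS] := near_rV_box nb; exists (Num.min e eps).
    by rewrite lt_min e0 eps0 ge_min lexx orbT.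
  move=> Y Yin; apply/ltW/eS => i; apply: lt_le_trans (Yin i) _.
  by rewrite ge_min lexx.
pose Smax := k%:R * (2 * expR b).
have SfM Y : rho Y != 0 -> Sf Y <= Smax.
  move=> r0; rewrite /Smax mulr_natl -[k in X in _ <= X]card_ord -sumr_const.
  apply: ler_sum => i _; have := rho_supp r0 i; rewrite ler_norml => /andP[l1 l2].
  have : expR (Y ord0 i - Y0 ord0 i) <= expR b by rewrite ler_expR.
  have : expR (- (Y ord0 i - Y0 ord0 i)) <= expR b by rewrite ler_expR lerNl.
  lra.
have Smax0 : 0 <= Smax by rewrite mulr_ge0// mulr_ge0// expR_ge0.
(* This scaling gives c Sf <= 1 on the support, so the test function is non-negative there, and c
   eps ^ 2 <= 1, so that [r0] is positive. *)
pose c := (Smax + eps ^+ 2)^-1.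
have c0 : 0 < c by rewrite invr_gt0 ltr_wpDl// exprn_gt0.
have cS1 : c * Smax <= 1.
  by rewrite mulrC ler_pdivrMr ?ltr_wpDl ?exprn_gt0// mul1r lerDl sqr_ge0.
have ce1 : c * eps ^+ 2 <= 1.
  by rewrite mulrC ler_pdivrMr ?ltr_wpDl ?exprn_gt0// mul1r lerDr.
have ce0 : 0 < c * eps ^+ 2 by rewrite mulr_gt0// exprn_gt0.
(* [r0] bounds 1 - c Sf from above on the support outside the box of size [eps], where one cosh term
   is at least eps ^ 2 / 4; [r1] > [r0] bounds it from below on the smaller box. *)
pose r0 := 1 - c * (eps ^+ 2 / 4).
pose r1 := 1 - c * (eps ^+ 2 / 8).
have r00 : 0 < r0 by rewrite /r0; lra.
have r01 : r0 < r1 by rewrite /r0 /r1; lra.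
pose m := \int[lam]_Y rho Y.
pose m' := \int[lam]_Y (rho Y * \1_(rV_box Y0 eps') Y).
have bd1 : bounded_on_supp (cst 1) by split => //; exists 1 => Y _; rewrite normr1.
have bdI : bounded_on_supp (\1_(rV_box Y0 eps') : 'rV[R]_k -> R).
  split; first by apply: measurable_indic; exact: measurable_rV_box.
  by exists 1 => Y _; rewrite indicE; case: (_ \in _); rewrite ?normr1 ?normr0.
have m'0 : 0 < m'.
  have := rho_pos e'0; rewrite /m' /Rintegral.
  have := integrable_fin_num measurableT (integrable_bounded_on_supp bdI).
  rewrite /comp /=; set I := (\int[_]_(_ in _) _)%E.
  by case: I => //= x _; rewrite lte_fin.
have M0 : 0 <= M by apply: le_trans (hM Y0); exact: normr_ge0.
have key N : del * r1 ^+ N * m' <= M * r0 ^+ N * m.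
  pose L Y := 1 - c * Sf Y.
  have [bdL ZL] := Z_pow c N 0.
  have E0 Y : E 0 Y = 1 by rewrite /E dotv0l expR0.
  (* There are three zones: on the small box h >= del and L >= r1; between the boxes the product h L
     ^ N is non-negative; outside the large box |h| <= M and 0 <= L <= r0. *)
  have pt Y : rho Y * (del * r1 ^+ N * \1_(rV_box Y0 eps') Y - M * r0 ^+ N) <=
      rho Y * (h Y * (L Y ^+ N * E 0 Y)).
    have [->|rY] := eqVneq (rho Y) 0; first by rewrite !mul0r.
    rewrite ler_wpM2l// E0 mulr1.
    have L0 : 0 <= L Y.
      rewrite subr_ge0; apply: le_trans cS1; rewrite ler_pM2l//; exact: SfM.
    have Mr : 0 <= M * r0 ^+ N by rewrite mulr_ge0// exprn_ge0// ltW.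
    rewrite indicE; have [inb'|outb'] := boolP (Y \in rV_box Y0 eps').
      move/set_mem in inb'; rewrite mulr1.
      have inb : rV_box Y0 eps Y by move=> i; exact: lt_le_trans (inb' i) e'e.
      apply: le_trans (_ : del * r1 ^+ N <= _); first by rewrite lerBlDr lerDl.
      have r10 : 0 <= r1 by exact/ltW/(lt_trans r00).
      apply: ler_pM; [exact: ltW|exact: exprn_ge0|exact: h_eps|].
      rewrite lerXn2r ?nnegrE ?(ltW (lt_trans r00 r01))//.
      by rewrite lerD2l lerN2 ler_pM2l// S_eps.
    rewrite mulr0 sub0r; have [inb|outb] := pselect (rV_box Y0 eps Y).
      apply: le_trans (_ : 0 <= _); first by rewrite oppr_le0.
      by rewrite mulr_ge0 ?exprn_ge0// (le_trans (ltW del0))// h_eps.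
    have [i ei] : exists i, eps <= `|Y ord0 i - Y0 ord0 i|.
      apply: contra_notP outb => H i; rewrite ltNge; apply/negP => ei.
      by apply: H; exists i.
    have Lr0 : L Y <= r0.
      rewrite lerD2l lerN2 ler_pM2l//; apply: le_trans (cosh_ge (ltW eps0) ei) _.
      rewrite /Sf (bigD1 i)//= lerDl; apply: sumr_ge0 => j _.
      have := @cosh_ge R 0 (Y ord0 j - Y0 ord0 j) (lexx _).
      by rewrite expr0n mul0r; apply.
    rewrite lerNl; apply: le_trans (ler_norm _) _; rewrite normrN normrM.
    apply: ler_pM => //; rewrite ger0_norm ?exprn_ge0//.
    by rewrite lerXn2r ?nnegrE// ltW.
  have bdL' : bounded_on_supp (fun Y => h Y * (L Y ^+ N * E 0 Y)) by exact: bd_mulh.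
  have ZL' : \int[lam]_Y (rho Y * (h Y * (L Y ^+ N * E 0 Y))) = 0 by [].
  rewrite -subr_le0 -ZL'.
  have i1 := integrable_bounded_on_supp bd1; have i2 := integrable_bounded_on_supp bdI.
  have -> : del * r1 ^+ N * m' - M * r0 ^+ N * m =
      \int[lam]_Y (del * r1 ^+ N * (rho Y * \1_(rV_box Y0 eps') Y) -
        M * r0 ^+ N * (rho Y * cst 1 Y)).
    rewrite RintegralB//; last 2 first.
    - exact: (integrableZl measurableT (del * r1 ^+ N) i2).
    - exact: (integrableZl measurableT (M * r0 ^+ N) i1).
    rewrite !RintegralZl//; congr (_ - _ * _).
    by apply: eq_Rintegral => Y _; rewrite mulr1.
  apply: le_Rintegral => //.
  - apply: (@integrableB _ _ _ _ _ _
      (EFin \o (fun Y => del * r1 ^+ N * (rho Y * \1_(rV_box Y0 eps') Y)))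
      (EFin \o (fun Y => M * r0 ^+ N * (rho Y * cst 1 Y)))) => //.
      exact: (integrableZl measurableT (del * r1 ^+ N) i2).
    exact: (integrableZl measurableT (M * r0 ^+ N) i1).
  - exact: integrable_bounded_on_supp.
  - move=> Y _; apply: le_trans (pt Y); rewrite le_eqVlt; apply/orP; left.
    by apply/eqP; rewrite /=; ring.
have m0 : 0 <= m by apply: Rintegral_ge0.
have q1 : 1 < r1 / r0 by rewrite ltr_pdivlMr// mul1r.
(* [key] would bound all powers of r1 / r0 > 1 by the constant M m / (del m'), which is
   impossible. *)
have [N HN] := bernoulli_unbounded (M * m / (del * m')) q1.
have := key N; rewrite leNgt => /negP; apply.
have rN0 : 0 < r0 ^+ N by exact: exprn_gt0.
move: HN; rewrite ltr_pdivrMr ?mulr_gt0// exprMn exprVn -(ltr_pM2r rN0) => HN.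
have e1 : M * r0 ^+ N * m = M * m * r0 ^+ N by ring.
have e2 : del * r1 ^+ N * m' = r1 ^+ N / r0 ^+ N * (del * m') * r0 ^+ N.
  by field; rewrite lt0r_neq0.
by rewrite e1 e2.
Qed.

End exponential_moments.

(** * Secants through the exterior point and the chart of a section *)

Section secants.
Context {R : realType}.

Lemma rV_cons_mul_col k m (p : R * 'rV[R]_k) (u : 'rV[R]_m) (V : 'M[R]_(k, m)) :
  rV_cons p *m (col_mx u V : 'M[R]_(k.+1, m)) = p.1 *: u + p.2 *m V.
Proof.
transitivity (p.1%:M *m u + p.2 *m V); last by rewrite mul_scalar_mx.
exact: (@mul_row_col R 1 1 k m p.1%:M p.2 u V).
Qed.

(** The product hypothesis is Vieta's relation for |a + q d| ^ 2 = 1, so q' is the other root. As |x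
    - a| ^ 2 = q ^ 2 |d| ^ 2, the base of the weight in [Wop] becomes q' / q. *)
Lemma secant_second_point m (a d : 'rV[R]_m) (q q' : R) : 1 < enorm a ->
  0 < q -> 0 < q' -> esphere (a + q *: d) ->
  q * q' * dotv d d = dotv a a - 1 ->
  second_point a (a + q *: d) = a + q' *: d /\
  forall k f, Wop a k f (a + q *: d) = (q' / q) ^+ k.-1 * f (a + q' *: d).
Proof.
move=> a1 q0 q'0 X1 qq; have A1 : 0 < dotv a a - 1.
  by rewrite subr_gt0 -enorm_sqr exprn_egt1.
have dd : dotv d d != 0.
  by apply/eqP => d0; move: A1; rewrite -qq d0 mulr0 ltxx.
have XX : dotv a a + 2 * q * dotv a d + q ^+ 2 * dotv d d = 1.
  have := enorm_sqr (a + q *: d); rewrite X1 expr1n dotvDl !dotvDr !dotvZl !dotvZr.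
  by rewrite (dotvC d a) => E1; rewrite [RHS]E1; ring.
have Xa : enorm (a + q *: d - a) ^+ 2 = q ^+ 2 * dotv d d.
  by rewrite addrAC subrr add0r enorm_sqr dotvZl dotvZr mulrA expr2.
have aX : enorm (a - (a + q *: d)) ^+ 2 = q ^+ 2 * dotv d d.
  by rewrite -opprB enormN Xa.
have sp : second_point a (a + q *: d) = a + q' *: d.
  rewrite /second_point Xa enorm_sqr dotvDl dotvZl (dotvC d a).
  apply/rowP => i; rewrite !mxE -qq.
  have -> : 2 * (1 - (dotv a a + q * dotv a d)) =
      q ^+ 2 * dotv d d - q * q' * dotv d d.
    by rewrite qq; move: XX; lra.
  by field; rewrite dd lt0r_neq0.
split=> // k f; rewrite /Wop sp aX enorm_sqr -qq; congr (_ ^+ _ * _).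
by field; rewrite dd lt0r_neq0.
Qed.

Lemma ge0_integral_section_chart k m (tau : set 'rV[R]_m) (c u : 'rV[R]_m)
    (V : 'M[R]_(k, m)) (bet : R) (Phi : 'rV[R]_m -> \bar R) :
  (0 < k)%N -> plane_frame (k := k.+1) tau (c, col_mx u V) ->
  dotv c c <= 1 -> 1 < bet ->
  measurable_fun setT Phi -> (forall v, 0 <= Phi v)%E ->
  let r := Num.sqrt (1 - dotv c c) in
  let X eta y := c + (r * bet) *: u +
    (r * chart_root bet eta (dotv y y)) *: (- u + y *m V) in
  (\int[section_area k.+1 tau]_(x in @esphere R m `&` tau) Phi x =
   (r ^+ k)%:E *
   (\int[lebesgue_rV k]_(y in @chart_dom R k bet)
      (Phi (X 1%R y) * (chart_weight bet 1%R y)%:E) +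
    \int[lebesgue_rV k]_(y in @chart_dom R k bet)
      (Phi (X (-1)%R y) * (chart_weight bet (-1)%R y)%:E)))%E.
Proof.
move=> k0 fr c1 bet1 mPhi Phi0 r X.
rewrite (ge0_integral_section _ fr)//; congr (_ * _)%E.
have XE eta y : X eta y =
    c + r *: (chart_pt bet eta y *m (col_mx u V : 'M[R]_(k.+1, m))).
  rewrite /X /chart_pt rV_cons_mul_col /= -addrA; congr (_ + _).
  rewrite -scalemxAl -scalerA -(scalerA r) -scalerDr; congr (_ *: _).
  by rewrite scalerBl scalerDr scalerN addrA.
rewrite (ge0_integral_chart k0 bet1) => [||t]; last exact: Phi0.
  by congr (_ + _)%E; apply: eq_integral => y _; rewrite XE.
apply: (measurableT_comp mPhi); apply: measurable_add_comp => //.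
by apply: measurable_scale_comp => //; exact: measurable_mulmx.
Qed.

Lemma esphere_section_point k m (c u : 'rV[R]_m) (V : 'M[R]_(k, m)) bet eta y :
  let U : 'M[R]_(k.+1, m) := col_mx u V in
  U *m U^T = 1%:M -> c *m U^T = 0 -> dotv c c <= 1 -> eta ^+ 2 = 1 ->
  0 <= chart_disc bet (dotv y y) ->
  let r := Num.sqrt (1 - dotv c c) in
  esphere (c + (r * bet) *: u +
    (r * chart_root bet eta (dotv y y)) *: (- u + y *m V)).
Proof.
move=> U UU cU c1 eta1 d0 r.
have -> : c + (r * bet) *: u + (r * chart_root bet eta (dotv y y)) *: (- u + y *m V)
    = c + r *: (chart_pt bet eta y *m U).
  rewrite /chart_pt rV_cons_mul_col /= -addrA; congr (_ + _).
  rewrite -scalemxAl -scalerA -(scalerA r) -scalerDr; congr (_ *: _).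
  by rewrite scalerBl scalerDr scalerN addrA.
have cp : dotv c (chart_pt bet eta y *m U) = 0.
  by rewrite dotvE trmx_mul mulmxA cU mul0mx mxE.
rewrite /esphere /= /enorm dotvDl !dotvDr !dotvZl !dotvZr (dotvC _ c) cp.
rewrite dotv_mulmx// dotv_chart_pt// !mulr0 mulr1 addr0 add0r -expr2 sqr_sqrtr ?subr_ge0//.
by rewrite addrC subrK sqrtr1.
Qed.

(** The first basis vector is turned from the centre c of the section towards [a], and [bet] is the
    distance from c to [a] measured in radii. By Pythagoras in the plane, a point of the ball gives
    |c| < 1, and |a| > 1 gives [bet] > 1. *)
Lemma plane_frame_toward k m (a : 'rV[R]_m) (tau : set 'rV[R]_m) : 1 < enorm a ->
  planes_through a k.+1 tau ->
  exists (c u : 'rV[R]_m) (V : 'M[R]_(k, m)) (bet : R),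
    [/\ plane_frame (k := k.+1) tau (c, col_mx u V), dotv c c < 1, 1 < bet &
        a = c + (Num.sqrt (1 - dotv c c) * bet) *: u].
Proof.
move=> a1 [ap ta [x0 [tx0 bx0]]]; have [[c U] fr] := exists_plane_frame ap.
have [/= UU cU tauE] := fr.
have pyth x : tau x -> dotv x x = dotv c c + dotv (x - c) (x - c).
  rewrite tauE /= => xU; have cw : dotv c (x - c) = 0.
    by rewrite dotvE -(orth_proj UU xU) trmx_mul mulmxA cU mul0mx mxE.
  have xE : x = (x - c) + c by rewrite subrK.
  move: cw xE; move: (x - c) => w cw ->.
  rewrite dotvDl !dotvDr (dotvC w c) cw; ring.
have c1 : dotv c c < 1.
  apply: le_lt_trans (_ : dotv x0 x0 < 1).
    by rewrite (pyth _ tx0) lerDl dotv_ge0.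
  by rewrite -enorm_sqr exprn_ilt1// enorm_ge0.
have A1 : 1 < dotv a a by rewrite -enorm_sqr exprn_egt1.
have r0 : 0 < Num.sqrt (1 - dotv c c) by rewrite sqrtr_gt0 subr_gt0.
set r := Num.sqrt (1 - dotv c c) in r0 *.
have rs : r < enorm (a - c).
  rewrite -ltr_sqr ?nnegrE ?enorm_ge0 ?(ltW r0)// sqr_sqrtr ?subr_ge0 ?(ltW c1)//.
  by rewrite enorm_sqr ltrBlDl -pyth.
have s0 : 0 < enorm (a - c) by exact: lt_trans rs.
pose b := (enorm (a - c))^-1 *: ((a - c) *m U^T).
have acU : (a - c <= U)%MS by move: ta; rewrite tauE.
have bU : b *m U = (enorm (a - c))^-1 *: (a - c).
  by rewrite -scalemxAl orth_proj.
have b1 : dotv b b = 1.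
  rewrite -(dotv_mulmx _ _ UU) bU dotvZl dotvZr -enorm_sqr; field.
  exact: lt0r_neq0.
have [Q [QQ Q0]] := exists_orth_row0 b1.
pose V : 'M[R]_(1 + k, m) := Q *m U.
have VV : V *m V^T = 1%:M by rewrite trmx_mul mulmxA -(mulmxA Q) UU mulmx1.
exists c, (usubmx V), (dsubmx V), (enorm (a - c) / r); rewrite vsubmxK.
have -> : usubmx V = (enorm (a - c))^-1 *: (a - c).
  rewrite /V -[LHS](@mul_usub_mx _ 1 k) -bU -Q0; congr (_ *m _).
  by apply/rowP => j; rewrite !mxE; congr (Q _ j); exact: val_inj.
split => //.
- split => //=; first by rewrite trmx_mul mulmxA cU mul0mx.
  rewrite tauE; apply/seteqP; split => x /= xU.
    apply: submx_trans xU _; rewrite -[U]mul1mx -(mulmx1C QQ) -mulmxA.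
    exact: submxMl.
  by apply: submx_trans xU (submxMl _ _).
- by rewrite ltr_pdivlMr// mul1r.
- rewrite scalerA mulrCA divff ?gt_eqF// mulr1 divff ?gt_eqF// scale1r.
  by rewrite addrC subrK.
Qed.

End secants.

(** * Sections by planes through a point *)

Lemma orth_col_mxE (R : realType) k m (u : 'rV[R]_m) (V : 'M[R]_(k, m)) :
  (col_mx u V : 'M[R]_(1 + k, m)) *m (col_mx u V)^T = 1%:M ->
  [/\ dotv u u = 1, u *m V^T = 0 & V *m V^T = 1%:M].
Proof.
rewrite tr_col_mx mul_col_row scalar_mx_block => /eq_block_mx[h11 h12 _ h22].
by split => //; rewrite dotvE h11 mxE eqxx.
Qed.

Lemma orth_to_col_mxE (R : realType) k m (c u : 'rV[R]_m) (V : 'M[R]_(k, m)) :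
  c *m (col_mx u V : 'M[R]_(1 + k, m))^T = 0 -> dotv c u = 0 /\ c *m V^T = 0.
Proof.
rewrite tr_col_mx mul_mx_row -row_mx0 => /eq_row_mx[h1 h2].
by split => //; rewrite dotvE h1 mxE.
Qed.

Section funk_positive_negative.
Context {R : realType} {m : nat}.

(** The negative part of [f] is treated as [pos_ext] of - f, so that one set of formulas for
    non-negative functions covers both parts. *)
Definition pos_ext (f : 'rV[R]_m -> R) v : \bar R := (Num.max (sphere_ext f v) 0)%:E.

Lemma sphere_extN (f : 'rV[R]_m -> R) v :
  sphere_ext (fun x => (- f x)%R) v = - sphere_ext f v.
Proof. by rewrite /sphere_ext; case: ifP; rewrite ?oppr0. Qed.

Lemma continuous_on_sphereN (f : 'rV[R]_m -> R) :
  continuous_on_sphere f -> continuous_on_sphere (fun x => (- f x)%R).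
Proof. by move=> cf x; apply: continuousN; exact: cf. Qed.

Lemma measurable_pos_ext (f : 'rV[R]_m -> R) : continuous_on_sphere f ->
  measurable_fun setT (pos_ext f).
Proof.
move=> cf; apply/measurable_EFinP; apply: measurable_maxr => //.
exact: measurable_sphere_ext.
Qed.

Lemma pos_ext_ge0 (f : 'rV[R]_m -> R) v : (0 <= pos_ext f v)%E.
Proof. by rewrite lee_fin le_max lexx orbT. Qed.

Lemma section_integral_fin k (tau : set 'rV[R]_m) c (U : 'M[R]_(k, m)) (B : R)
    (Phi : 'rV[R]_m -> \bar R) : (0 < k)%N ->
  plane_frame tau (c, U) -> dotv c c <= 1 ->
  measurable_fun setT Phi -> (forall v, 0 <= Phi v)%E -> (forall v, Phi v <= B%:E)%E ->
  (\int[section_area k tau]_(x in @esphere R m `&` tau) Phi x < +oo)%E.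
Proof.
move=> k0 fr c1 mPhi Phi0 PhiB; rewrite (ge0_integral_section k0 fr)//.
apply: lte_mul_pinfty; [by rewrite lee_fin exprn_ge0// sqrtr_ge0|by []|].
have B0 : 0 <= B by have := le_trans (Phi0 0) (PhiB 0); rewrite lee_fin.
apply: (@le_lt_trans _ _ (\int[sphere_area k]_t (cst B%:E) t)%E).
  apply: ge0_le_integral => //.
  apply: (measurableT_comp mPhi); apply: measurable_add_comp => //.
  by apply: measurable_scale_comp => //; exact: measurable_mulmx.
by rewrite integral_cst// lte_mul_pinfty ?lee_fin// sphere_area_fin.
Qed.

Lemma funkE k (f : 'rV[R]_m -> R) (tau : set 'rV[R]_m) :
  funk k f tau = fine
    (\int[section_area k tau]_(x in @esphere R m `&` tau) pos_ext f x -
     \int[section_area k tau]_(x in @esphere R m `&` tau)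
       pos_ext (fun x => (- f x)%R) x)%E.
Proof.
rewrite /funk /Rintegral; congr fine; rewrite integralE.
have E v : (@esphere R m `&` tau) v -> sphere_ext f v = f v.
  by move=> [v1 _]; exact: sphere_extE.
congr (_ - _)%E; apply: eq_integral => x /set_mem xD.
  by rewrite /pos_ext E// funeposE EFin_max.
by rewrite /pos_ext sphere_extN E// funenegE EFin_max EFinN.
Qed.

Variables (k : nat) (f : 'rV[R]_m -> R) (tau : set 'rV[R]_m).
Variables (c : 'rV[R]_m) (U : 'M[R]_(k, m)).
Hypotheses (k0 : (0 < k)%N) (cf : continuous_on_sphere f)
  (fr : plane_frame tau (c, U)) (c1 : dotv c c <= 1).
Let D := @esphere R m `&` tau.

Lemma pos_ext_fin : (\int[section_area k tau]_(x in D) pos_ext f x < +oo)%E.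
Proof.
have [M M0 fM] := bounded_sphere_ext cf.
apply: (@section_integral_fin k tau c U M) => //.
- exact: measurable_pos_ext.
- exact: pos_ext_ge0.
- move=> v; rewrite lee_fin ge_max M0 andbT.
  exact: le_trans (ler_norm _) (fM v).
Qed.

Lemma section_integrable : (section_area k tau).-integrable D (EFin \o f).
Proof.
have mD : measurable D.
  by apply: measurableI; [exact: measurable_esphere|exact: measurable_plane fr].
have [M M0 fM] := bounded_on_sphere cf.
apply: measurable_bounded_integrable => //.
- rewrite -[X in section_area k tau X]setIid -integral_indic//.
  rewrite (_ : (\int[_]_(_ in _) _)%E =
    \int[section_area k tau]_(x in D) (cst 1%E) x)%E.
    by apply: (@section_integral_fin k tau c U 1) => // v; rewrite lee_fin.
  by apply: eq_integral => x xD; rewrite indicE xD.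
- apply: (@eq_measurable_fun _ _ _ _ _ (sphere_ext f)).
    by move=> v /set_mem[v1 _]; rewrite sphere_extE.
  by apply: measurable_funTS; exact: measurable_sphere_ext.
- exists M; split => [|x Mx v [v1 _]]; first exact: num_real.
  apply: le_trans (fM v v1) (ltW Mx).
Qed.

End funk_positive_negative.

Section kernel.
Context {R : realType}.

Lemma funkB m k (f g : 'rV[R]_m -> R) (tau : set 'rV[R]_m) c (U : 'M[R]_(k, m)) :
  (0 < k)%N -> continuous_on_sphere f -> continuous_on_sphere g ->
  plane_frame tau (c, U) -> dotv c c <= 1 ->
  funk k (fun x => f x - g x) tau = funk k f tau - funk k g tau.
Proof.
move=> k0 cf cg fr c1; apply: RintegralB.
- by apply: measurableI; [exact: measurable_esphere|exact: measurable_plane fr].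
- exact: section_integrable fr c1.
- exact: section_integrable fr c1.
Qed.

(** [fine] also sends infinite values to 0; finiteness of both integrals, from the boundedness of
    [f] on the sphere, is what turns a vanishing difference into an equality. *)
Lemma funk_eq0 m k (f : 'rV[R]_m -> R) (tau : set 'rV[R]_m) c (U : 'M[R]_(k, m)) :
  (0 < k)%N -> continuous_on_sphere f ->
  plane_frame tau (c, U) -> dotv c c <= 1 -> funk k f tau = 0 ->
  (\int[section_area k tau]_(x in @esphere R m `&` tau) pos_ext f x =
   \int[section_area k tau]_(x in @esphere R m `&` tau)
     pos_ext (fun x => (- f x)%R) x)%E.
Proof.
move=> k0 cf fr c1; rewrite funkE.
have := pos_ext_fin k0 cf fr c1.
have := pos_ext_fin k0 (continuous_on_sphereN cf) fr c1.
have : (0 <= \int[section_area k tau]_(x in @esphere R m `&` tau) pos_ext f x)%E.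
  by apply: integral_ge0 => x _; exact: pos_ext_ge0.
have : (0 <= \int[section_area k tau]_(x in @esphere R m `&` tau)
     pos_ext (fun x => (- f x)%R) x)%E.
  by apply: integral_ge0 => x _; exact: pos_ext_ge0.
move: (\int[_]_(_ in _) pos_ext f _)%E (\int[_]_(_ in _) pos_ext _ _)%E.
by move=> [x| |] [y| |] //= _ _ _ _ /subr0_eq ->.
Qed.

(** Exchanging the two sheets of the chart carries the positive part of [f] to its negative part,
    because the ratio of the chart weights is inverse to the factor in [Wop]. *)
Lemma funk_antisym m k (a : 'rV[R]_m) (f : 'rV[R]_m -> R) (tau : set 'rV[R]_m) :
  (0 < k)%N -> 1 < enorm a -> continuous_on_sphere f ->
  (forall x, esphere x -> f x = - Wop a k.+1 f x) ->
  planes_through a k.+1 tau -> funk k.+1 f tau = 0.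
Proof.
move=> k0 a1 cf fW ptau.
have [c [u [V [bet [fr c1 bet1 aE]]]]] := plane_frame_toward a1 ptau.
have [UU cU _] := fr; rewrite /= in UU cU.
have e1 : (1 : R) ^+ 2 = 1 by rewrite expr1n.
have eN1 : (-1 : R) ^+ 2 = 1 by rewrite sqrrN expr1n.
set r := Num.sqrt (1 - dotv c c) in aE.
have r0 : 0 < r by rewrite sqrtr_gt0 subr_gt0.
pose X eta (y : 'rV[R]_k) := c + (r * bet) *: u +
    (r * chart_root bet eta (dotv y y)) *: (- u + y *m V).
have key (g : 'rV[R]_m -> R) eta y : eta ^+ 2 = 1 ->
    (forall x, esphere x -> g x = - Wop a k.+1 g x) -> y \in @chart_dom R k bet ->
    (pos_ext g (X eta y) * (chart_weight bet eta y)%:E =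
     pos_ext (fun x => (- g x)%R) (X (- eta)%R y) * (chart_weight bet (- eta)%R y)%:E)%E.
  move=> h1 gW /set_mem yd; have hN1 : (- eta) ^+ 2 = 1 by rewrite sqrrN.
  have SX e : e ^+ 2 = 1 -> esphere (X e y).
    by move=> he; apply: esphere_section_point => //; exact: ltW.
  rewrite /pos_ext sphere_extN !sphere_extE; [|exact: SX|exact: SX].
  have q0 := chart_root_gt0 bet1 h1 (dotv_ge0 y).
  have q'0 := chart_root_gt0 bet1 hN1 (dotv_ge0 y).
  set q := chart_root bet eta (dotv y y) in q0.
  set q' := chart_root bet (- eta) (dotv y y) in q'0.
  have Y1 : 1 + dotv y y != 0 by rewrite gt_eqF// ltr_pwDl// dotv_ge0.
  have [uu uV VV] := orth_col_mxE UU.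
  have cu : dotv c u = 0 := (orth_to_col_mxE cU).1.
  have uyV : dotv u (y *m V) = 0.
    by rewrite dotvE trmx_mul mulmxA uV mul0mx mxE.
  have dd : dotv (- u + y *m V) (- u + y *m V) = 1 + dotv y y.
    rewrite dotvDl !dotvDr !dotvNl !dotvNr (dotvC (y *m V)) uyV dotv_mulmx// uu.
    ring.
  have aa : dotv a a - 1 = r ^+ 2 * (bet ^+ 2 - 1).
    rewrite aE dotvDl !dotvDr !dotvZl !dotvZr (dotvC u) cu uu.
    by rewrite mulrBr -exprMn /r sqr_sqrtr ?subr_ge0 ?ltW//; ring.
  have qq : r * q * (r * q') * dotv (- u + y *m V) (- u + y *m V) = dotv a a - 1.
    rewrite dd aa mulrACA (chart_rootN h1 (dotv_ge0 y) (ltW yd)).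
    by field.
  have XE : X eta y = a + (r * q) *: (- u + y *m V) by rewrite aE.
  have XE' : X (- eta) y = a + (r * q') *: (- u + y *m V) by rewrite aE.
  have SXe := SX _ h1; rewrite XE in SXe.
  have [_ WE] := secant_second_point a1 (mulr_gt0 r0 q0) (mulr_gt0 r0 q'0) SXe qq.
  rewrite XE gW// WE -XE' /=.
  have -> : (r * q') / (r * q) = q' / q by field; rewrite !lt0r_neq0.
  rewrite -!EFinM; congr EFin.
  rewrite /chart_weight -/q -/q'.
  have qk0 : 0 <= (q' / q) ^+ k by rewrite exprn_ge0// divr_ge0 ?ltW.
  (* The factor (q' / q) ^ k is non-negative and therefore passes through the maximum. *)
  rewrite -mulrN -[X in Num.max _ X](mulr0 ((q' / q) ^+ k)) -maxr_pMr//.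
  rewrite exprMn exprVn; field.
  rewrite expf_neq0 ?lt0r_neq0//= sqrtr_gt0.
  exact: yd.
have fWN x : esphere x -> (fun x => (- f x)%R) x = - Wop a k.+1 (fun x => (- f x)%R) x.
  by move=> x1; rewrite /= [in LHS]fW// /Wop mulrN.
rewrite funkE.
have mP := measurable_pos_ext cf.
have mN := measurable_pos_ext (continuous_on_sphereN cf).
rewrite (ge0_integral_section_chart k0 fr (ltW c1) bet1 mP (@pos_ext_ge0 _ _ f)).
rewrite (ge0_integral_section_chart k0 fr (ltW c1) bet1 mN
  (@pos_ext_ge0 _ _ (fun x => (- f x)%R))).
rewrite -/r [X in (_ * X - _)%E](_ : _ = (\int[lebesgue_rV k]_(y in @chart_dom R k bet)
      (pos_ext (fun x => (- f x)%R) (X 1%R y) * (chart_weight bet 1%R y)%:E) +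
    \int[lebesgue_rV k]_(y in @chart_dom R k bet)
      (pos_ext (fun x => (- f x)%R) (X (-1)%R y) * (chart_weight bet (-1)%R y)%:E))%E).
  (* [fine (z - z)] is 0 for infinite z as well, by the default value of [fine]. *)
  rewrite /X; move: (_ * _)%E => [z| |] //=; exact: subrr.
rewrite addeC; congr (_ + _)%E; apply: eq_integral => y yd.
  have := key f (-1) y eN1 fW yd; rewrite opprK /X; exact.
by have := key f 1 y e1 fW yd; rewrite /X; exact.
Qed.

End kernel.

Section secants_through_point.
Context {R : realType} {m : nat}.
Variable a : 'rV[R]_m.
Local Notation bet := (enorm a).
Local Notation e := ((enorm a)^-1 *: a).

(* [Y] is the affine coordinate of the direction [- e + Y E] of a line through
   [a], and the points [secant_pt E 1 Y], [secant_pt E (-1) Y] are the two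
   intersections of that line with the sphere.  Planes through [a] become affine
   hyperplanes of the [Y]-space, and by [secant_slice] the integral of [g] over
   a spherical section is, up to a constant, the Lebesgue integral of
   [secant_density * secant_sum E g] over such a hyperplane. *)
Definition secant_pt k (E : 'M[R]_(k, m)) eta (Y : 'rV[R]_k) : 'rV[R]_m :=
  a + chart_root bet eta (dotv Y Y) *: (- e + Y *m E).

Definition secant_density k (Y : 'rV[R]_k) : R :=
  \1_(@chart_dom R k bet) Y / Num.sqrt (chart_disc bet (dotv Y Y)).

Definition secant_sum k (E : 'M[R]_(k, m)) (g : 'rV[R]_m -> R) (Y : 'rV[R]_k) : R :=
  g (secant_pt E 1 Y) * chart_root bet 1 (dotv Y Y) ^+ k.-1 +
  g (secant_pt E (-1) Y) * chart_root bet (-1) (dotv Y Y) ^+ k.-1.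

Lemma measurable_secant_pt k (E : 'M[R]_(k, m)) eta :
  measurable_fun setT (secant_pt E eta).
Proof.
apply: measurable_add_comp => //; apply: measurable_scale_comp.
  by apply: measurable_chart_root; exact: measurable_dotv.
apply: measurable_add_comp => //; exact: measurable_mulmx.
Qed.

Lemma measurable_secant_density k : measurable_fun setT (@secant_density k).
Proof.
apply: measurable_funM.
  by apply: measurable_indic; exact: measurable_chart_dom.
apply: measurable_funV; apply: measurable_sqrt; apply: measurable_chart_disc.
exact: measurable_dotv.
Qed.

Lemma secant_density_ge0 k (Y : 'rV[R]_k) : 0 <= secant_density Y.
Proof. by rewrite divr_ge0// sqrtr_ge0. Qed.

Lemma measurable_secant_sum k (E : 'M[R]_(k, m)) (g : 'rV[R]_m -> R) :
  measurable_fun setT g -> measurable_fun setT (secant_sum E g).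
Proof.
move=> mg; apply: measurable_funD; apply: measurable_funM;
  do ?[by apply: (measurableT_comp mg); exact: measurable_secant_pt];
  by apply: measurable_funX; apply: measurable_chart_root; exact: measurable_dotv.
Qed.

Hypothesis a1 : 1 < enorm a.

Lemma secant_sum_ge0 k (E : 'M[R]_(k, m)) (g : 'rV[R]_m -> R) Y :
  (forall v, 0 <= g v) -> 0 <= secant_sum E g Y.
Proof.
move=> g0; have e1 : (1 : R) ^+ 2 = 1 by rewrite expr1n.
have eN1 : (-1 : R) ^+ 2 = 1 by rewrite sqrrN expr1n.
by rewrite addr_ge0// mulr_ge0// exprn_ge0// ltW// chart_root_gt0// dotv_ge0.
Qed.

(** The lines with first coordinate t fill the plane through [a] spanned by u = (e - t E1) / s and
    the rows of [E'], where s ^ 2 = 1 + t ^ 2. Its section has radius sqrt T / s and its centre lies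
    at distance bet / s from [a]; T > 0 says that the plane meets the ball. The chart coordinate of
    the section is y = z / s. *)
Lemma secant_slice k (E1 : 'rV[R]_m) (E' : 'M[R]_(k, m)) (t : R) : (0 < k)%N ->
  let E : 'M[R]_(k.+1, m) := col_mx E1 E' in
  E *m E^T = 1%:M -> a *m E^T = 0 -> 0 < chart_disc bet (t ^+ 2) ->
  exists (tau : set 'rV[R]_m) (C : R), [/\ planes_through a k.+1 tau, 0 < C &
    forall g : 'rV[R]_m -> R, measurable_fun setT g -> (forall v, 0 <= g v) ->
    (\int[section_area k.+1 tau]_(x in @esphere R m `&` tau) (g x)%:E =
     C%:E * \int[lebesgue_rV k]_z
       (secant_density (rV_cons (t, z)) * secant_sum E g (rV_cons (t, z)))%:E)%E].
Proof.
move=> k0 E EE aE T0; have [E11 E1E' E'E'] := orth_col_mxE EE.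
have [aE1 aE'] := orth_to_col_mxE aE.
have b0 : 0 < bet by exact: lt_trans a1.
have aa : dotv a a = bet ^+ 2 by rewrite enorm_sqr.
set T := chart_disc bet (t ^+ 2) in T0.
have TE : T = 1 - (bet ^+ 2 - 1) * t ^+ 2 by [].
pose s := Num.sqrt (1 + t ^+ 2).
have t21 : 0 < 1 + t ^+ 2 by rewrite ltr_pwDl// sqr_ge0.
have s0 : 0 < s by rewrite sqrtr_gt0.
have s2 : s ^+ 2 = 1 + t ^+ 2 by rewrite sqr_sqrtr// ltW.
have sT0 : 0 < Num.sqrt T by rewrite sqrtr_gt0.
have sT2 : Num.sqrt T ^+ 2 = T by rewrite sqr_sqrtr// ltW.
have [u uE] : exists u : 'rV[R]_m, u = s^-1 *: (e - t *: E1) by eexists.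
pose c := a - (bet / s) *: u.
have au : dotv a u = bet / s.
  rewrite uE dotvZr dotvDr dotvNr !dotvZr aE1 aa; field.
  by rewrite !lt0r_neq0.
have uu : dotv u u = 1.
  rewrite uE dotvZl dotvZr dotvDl !dotvDr !dotvNl !dotvNr !dotvZl !dotvZr.
  rewrite (dotvC E1) aE1 aa E11.
  transitivity ((1 + t ^+ 2) / s ^+ 2); last by rewrite s2 divff// lt0r_neq0.
  by field; rewrite !lt0r_neq0.
have uE' : u *m E'^T = 0.
  by rewrite uE -scalemxAl mulmxBl -!scalemxAl aE' E1E' !scaler0 subrr scaler0.
have UU := orth_col_mx uu E'E' uE'.
have cu : dotv c u = 0 by rewrite /c dotvDl dotvNl dotvZl au uu mulr1 subrr.
have cE' : c *m E'^T = 0 by rewrite /c mulmxBl -scalemxAl aE' uE' scaler0 subrr.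
have cU : c *m (col_mx u E')^T = 0.
  by rewrite tr_col_mx mul_mx_row cE' dotv_scalar_mx cu raddf0 row_mx0.
have cc : 1 - dotv c c = T / s ^+ 2.
  rewrite /c dotvDl !dotvDr !dotvNl !dotvNr !dotvZl !dotvZr (dotvC u) au uu aa.
  transitivity (1 - bet ^+ 2 + bet ^+ 2 / s ^+ 2); first by field; rewrite lt0r_neq0.
  have -> : T = 1 - (bet ^+ 2 - 1) * (s ^+ 2 - 1) by rewrite TE s2; ring.
  by field; rewrite lt0r_neq0.
have c1 : dotv c c < 1 by rewrite -subr_gt0 cc divr_gt0// exprn_gt0.
have rE : Num.sqrt (1 - dotv c c) = Num.sqrt T / s.
  by rewrite cc sqrtrM ?ltW// sqrtrV ?exprn_ge0 ?(ltW s0)// sqrtr_sqr gtr0_norm.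
pose U : 'M[R]_(k.+1, m) := col_mx u E'.
pose tau := [set x | (x - c <= U)%MS].
have acE : a - c = (bet / s) *: u by rewrite /c opprB addrC subrK.
have fr : plane_frame (k := k.+1) tau (c, U) by split.
exists tau, (Num.sqrt T); split => //.
  split.
  - by exists c, U; split => //; exact: orth_row_free UU.
  - rewrite /tau /= acE; apply: scalemx_sub.
    have uU : (u <= (col_mx u E' : 'M[R]_(1 + k, m)))%MS.
      by rewrite -addsmxE addsmxSl.
    exact: uU.
  - exists c; split; first by rewrite /tau /= subrr sub0mx.
    by rewrite /eball /= /enorm -[ltRHS]sqrtr1 ltr_sqrt.
move=> g mg g0.
(* This is the distance bet / s from the centre of the section to [a], divided by the radius sqrt T
   / s. *)
pose bet' := bet / Num.sqrt T.
have bet'1 : 1 < bet'.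
  rewrite ltr_pdivlMr// mul1r; apply: le_lt_trans a1.
  by rewrite sqrt_chart_disc_le1// sqr_ge0.
rewrite (ge0_integral_section_chart k0 fr (ltW c1) bet'1); last 2 first.
- exact/measurable_EFinP.
- by move=> v; rewrite lee_fin.
pose W eta (z : 'rV[R]_k) : R := secant_density (rV_cons (t, z)) *
  (g (secant_pt E eta (rV_cons (t, z))) *
   chart_root bet eta (dotv (rV_cons (t, z)) (rV_cons (t, z))) ^+ k).
have W0 eta z : eta ^+ 2 = 1 -> (0 <= (W eta z)%:E)%E.
  move=> eta1; rewrite lee_fin mulr_ge0 ?secant_density_ge0// mulr_ge0//.
  by rewrite exprn_ge0// ltW// chart_root_gt0// dotv_ge0.
have mcons : measurable_fun setT (fun z : 'rV[R]_k => rV_cons (t, z)).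
  exact: measurable_rV_cons2.
have mW eta : measurable_fun setT (EFin \o W eta).
  apply/measurable_EFinP; apply: measurable_funM.
    by apply: (measurableT_comp (@measurable_secant_density k.+1)).
  apply: measurable_funM.
    apply: (measurableT_comp mg); apply: (measurableT_comp _ mcons).
    exact: measurable_secant_pt.
  apply: measurable_funX; apply: measurable_chart_root; exact: measurable_dotv.
have e1 : (1 : R) ^+ 2 = 1 by rewrite expr1n.
have eN1 : (-1 : R) ^+ 2 = 1 by rewrite sqrrN expr1n.
rewrite rE.
have key eta : eta ^+ 2 = 1 ->
  (((Num.sqrt T / s) ^+ k)%:E * \int[lebesgue_rV k]_(y in @chart_dom R k bet')
     ((g (c + (Num.sqrt T / s * bet')%R *: u +
          (Num.sqrt T / s * chart_root bet' eta (dotv y y))%R *: (- u + y *m E'))%R)%:E *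
      (chart_weight bet' eta y)%:E) =
   (Num.sqrt T)%:E * \int[lebesgue_rV k]_z (W eta z)%:E)%E.
  move=> eta1; rewrite integral_mkcond.
  (* [B] is the ratio of the two integrands at y = z / s. Together with the factor (sqrt T / s) ^ k
     of the section and s ^ (- k) from the dilation it leaves the constant sqrt T. *)
  set H := (X in integral _ _ X); pose B := (s ^+ 2 / Num.sqrt T) ^+ k * Num.sqrt T.
  have HW z : H (s^-1 *: z) = (B%:E * (W eta z)%:E)%E.
    rewrite /H patchE; set y := s^-1 *: z; set Y := rV_cons (t, z).
    have YY : dotv Y Y = t ^+ 2 + dotv z z by rewrite dotv_cons expr2.
    have yy : dotv y y = dotv z z / s ^+ 2.
      by rewrite dotvZl dotvZr mulrA mulrC -invfM -expr2.
    have dE : chart_disc bet' (dotv y y) = chart_disc bet (dotv Y Y) / T.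
      rewrite yy YY /chart_disc /bet' expr_div_n sT2 s2.
      have T0' : T != 0 by rewrite lt0r_neq0.
      move: T0'; rewrite TE => T0'; field; rewrite T0' lt0r_neq0//.
    have -> : (y \in @chart_dom R k bet') = (Y \in @chart_dom R k.+1 bet).
      by apply/idP/idP => /set_mem; rewrite /chart_dom /= => h; apply/mem_set;
        move: h; rewrite /chart_dom /= dE pmulr_lgt0 ?invr_gt0.
    rewrite /W -/Y /secant_density indicE; case: ifPn => [/set_mem YD|_]; last first.
      by rewrite !mul0r mule0.
    have d0 : 0 < chart_disc bet (dotv Y Y) := YD.
    have sd0 : 0 < Num.sqrt (chart_disc bet (dotv Y Y)) by rewrite sqrtr_gt0.
    have sdE : Num.sqrt (chart_disc bet' (dotv y y)) =
        Num.sqrt (chart_disc bet (dotv Y Y)) / Num.sqrt T.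
      by rewrite dE sqrtrM ?ltW// sqrtrV// ltW.
    have zz0 := dotv_ge0 z.
    have qE : chart_root bet' eta (dotv y y) =
        chart_root bet eta (dotv Y Y) * (s ^+ 2 / Num.sqrt T).
      rewrite /chart_root sdE yy YY /bet' s2; field.
      by rewrite !lt0r_neq0//= ltr_pwDl// addr_ge0// sqr_ge0.
    have -> : c + (Num.sqrt T / s * bet') *: u +
        (Num.sqrt T / s * chart_root bet' eta (dotv y y)) *: (- u + y *m E') =
        secant_pt E eta Y.
      have -> : c + (Num.sqrt T / s * bet') *: u = a.
        rewrite -[RHS](subrK c) acE addrC /bet'; congr (_ *: _ + _).
        by field; rewrite !lt0r_neq0.
      rewrite /secant_pt qE rV_cons_mul_col /=; congr (a + _).
      transitivity ((chart_root bet eta (dotv Y Y) * s) *: (- u + y *m E')).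
        by congr (_ *: _); field; rewrite !lt0r_neq0.
      rewrite -scalerA; congr (_ *: _).
      rewrite uE /y -scalemxAl scalerDr scalerN !scalerA divff ?lt0r_neq0// !scale1r.
      by rewrite opprB [_ - e]addrC addrA.
    rewrite -!EFinM; congr EFin.
    rewrite /chart_weight qE sdE /B exprMn mul1r; field.
    by rewrite !lt0r_neq0.
  have mH : measurable_fun setT H.
    apply: measurable_fun_if_set; first exact: measurable_chart_dom.
    apply: measurable_funTS; apply: emeasurable_funM.
      apply/measurable_EFinP; apply: (measurableT_comp mg).
      apply: measurable_add_comp => //; apply: measurable_scale_comp.
        apply: measurable_funM => //; apply: measurable_chart_root.
        exact: measurable_dotv.
      by apply: measurable_add_comp => //; exact: measurable_mulmx.
    by apply/measurable_EFinP; exact: measurable_chart_weight.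
  have H0 y : (0 <= H y)%E.
    rewrite /H patchE; case: ifP => // _.
    by rewrite mule_ge0// lee_fin ?g0// chart_weight_ge0.
  rewrite (@ge0_integral_rV_scale R k s^-1 H) ?invr_gt0//.
  under eq_integral do rewrite HW.
  have B0 : 0 <= B.
    by rewrite mulr_ge0 ?(ltW sT0)// exprn_ge0// divr_ge0 ?sqr_ge0 ?(ltW sT0).
  rewrite ge0_integralZl_EFin; [|exact: measurableT|by move=> z _; exact: W0|exact: mW|exact: B0].
  rewrite !muleA -!EFinM; congr ((_)%:E * _)%E.
  rewrite /B !mulrA -!exprMn (_ : _ / s / s * _ = 1) ?expr1n ?mul1r//.
  by field; rewrite !lt0r_neq0.
have I0 eta : eta ^+ 2 = 1 -> (0 <= \int[lebesgue_rV k]_z (W eta z)%:E)%E.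
  by move=> eta1; apply: integral_ge0 => z _; exact: W0.
have J0 eta : eta ^+ 2 = 1 -> (0 <= \int[lebesgue_rV k]_(y in @chart_dom R k bet')
     ((g (c + (Num.sqrt T / s * bet')%R *: u +
          (Num.sqrt T / s * chart_root bet' eta (dotv y y))%R *: (- u + y *m E'))%R)%:E *
      (chart_weight bet' eta y)%:E))%E.
  move=> eta1; apply: integral_ge0 => y _.
  by rewrite mule_ge0// lee_fin ?g0// chart_weight_ge0.
rewrite ge0_muleDr; [|exact: J0|exact: J0].
rewrite (key 1 e1) (key (-1) eN1) -ge0_muleDr; [|exact: I0|exact: I0].
rewrite -ge0_integralD; [|exact: measurableT|by move=> z _; exact: W0|exact: mW|
  by move=> z _; exact: W0|exact: mW].
congr (_ * _)%E; apply: eq_integral => z _.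
by rewrite -EFinD -mulrDr.
Qed.

End secants_through_point.

Section secant_density_theory.
Context {R : realType} {m : nat}.
Variable a : 'rV[R]_m.
Hypothesis a1 : 1 < enorm a.
Local Notation bet := (enorm a).

Let b2 : 0 < bet ^+ 2 - 1. Proof. by rewrite subr_gt0 exprn_egt1. Qed.

Lemma secant_density_neq0 k (Y : 'rV[R]_k) : secant_density a Y != 0 ->
  0 < chart_disc bet (dotv Y Y).
Proof.
rewrite /secant_density indicE; case: (boolP (_ \in _)) => [/set_mem//|_].
by rewrite mul0r eqxx.
Qed.

Lemma secant_density_supp k (Y : 'rV[R]_k) : secant_density a Y != 0 ->
  dotv Y Y <= (bet ^+ 2 - 1)^-1.
Proof.
move=> /secant_density_neq0; rewrite /chart_disc subr_gt0 mulrC => h.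
by rewrite -[leRHS]mul1r ler_pdivlMr// ltW.
Qed.

Lemma secant_density_mulmx k (Q : 'M[R]_k) (Y : 'rV[R]_k) : Q *m Q^T = 1%:M ->
  secant_density a (Y *m Q) = secant_density a Y.
Proof.
move=> QQ; rewrite /secant_density !indicE dotv_mulmx//; congr ((nat_of_bool _)%:R / _).
by apply: (congr1 asbool); rewrite /chart_dom /= dotv_mulmx.
Qed.

Lemma secant_sum_mulmx k (Q : 'M[R]_k) (E : 'M[R]_(k, m)) g (Y : 'rV[R]_k) :
  Q *m Q^T = 1%:M -> secant_sum a E g (Y *m Q) = secant_sum a (Q *m E) g Y.
Proof.
by move=> QQ; rewrite /secant_sum /secant_pt dotv_mulmx// !mulmxA.
Qed.

Lemma chart_root_le eta (Y : R) : eta ^+ 2 = 1 -> 0 <= Y ->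
  chart_root bet eta Y <= bet + 1.
Proof.
move=> eta1 Y0; have [Y1 S1] := (ltr_pwDl ltr01 Y0, sqrt_chart_disc_le1 a1 Y0).
rewrite /chart_root ler_pdivrMr//; apply: (@le_trans _ _ (bet + 1)).
  rewrite lerD2l; apply: le_trans (ler_norm _) _.
  rewrite normrM (ger0_norm (sqrtr_ge0 _)) -sqrtr_sqr eta1 sqrtr1 mul1r //.
by rewrite ler_peMr ?lerDl// addr_ge0// ltW// (lt_trans _ a1).
Qed.

Lemma secant_sum_bounded k (E : 'M[R]_(k, m)) (g : 'rV[R]_m -> R) :
  (exists M, forall v, `|g v| <= M) -> exists M, forall Y, `|secant_sum a E g Y| <= M.
Proof.
move=> [M gM]; pose B := M * (bet + 1) ^+ k.-1; exists (B + B) => Y.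
have e1 : (1 : R) ^+ 2 = 1 by rewrite expr1n.
have eN1 : (-1 : R) ^+ 2 = 1 by rewrite sqrrN expr1n.
apply: le_trans (ler_normD _ _) _.
have H eta : eta ^+ 2 = 1 ->
    `|g (secant_pt a E eta Y) * chart_root bet eta (dotv Y Y) ^+ k.-1| <= B.
  move=> h; have q0 := ltW (chart_root_gt0 a1 h (dotv_ge0 Y)).
  have b0 : 0 <= bet + 1 by rewrite addr_ge0// ltW// (lt_trans _ a1).
  rewrite normrM ler_pM// normrX ger0_norm// lerXn2r ?nnegrE//.
  exact: chart_root_le (dotv_ge0 Y).
by rewrite lerD ?H.
Qed.

(** Integrability at the singular boundary is read off from the sphere: the density is at most a
    constant times [chart_weight], whose integral is bounded by the area of the unit sphere. *)
Lemma secant_density_fin k : (0 < k)%N ->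
  (\int[lebesgue_rV k]_Y (secant_density a Y)%:E < +oo)%E.
Proof.
move=> k0; have bet0 : 0 < bet by exact: lt_trans a1.
(* [c] is a lower bound for q ^ k on the chart domain: q >= 1 / (1 + Y), since [bet] > 1, and Y is
   below the inverse of bet ^ 2 - 1. *)
pose c := ((1 + (bet ^+ 2 - 1)^-1)^-1) ^+ k.
have c0 : 0 < c by rewrite exprn_gt0// invr_gt0 addr_gt0// invr_gt0.
pose W eta (Y : 'rV[R]_k) :=
  ((cst 1%E : 'rV[R]_k.+1 -> \bar R) (chart_pt bet eta Y) *
   (chart_weight bet eta Y)%:E)%E.
have e1 : (1 : R) ^+ 2 = 1 by rewrite expr1n.
have eN1 : (-1 : R) ^+ 2 = 1 by rewrite sqrrN expr1n.
have W0 eta Y : eta ^+ 2 = 1 -> (0 <= W eta Y)%E.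
  by move=> h; rewrite /W mul1e lee_fin chart_weight_ge0.
have H : (c%:E * \int[lebesgue_rV k]_Y (secant_density a Y)%:E <=
    \int[lebesgue_rV k]_(Y in @chart_dom R k bet) W 1%R Y)%E.
  rewrite -ge0_integralZl_EFin ?(ltW c0)//; last 2 first.
  - by move=> Y _; rewrite lee_fin secant_density_ge0.
  - by apply/measurable_EFinP; exact: measurable_secant_density.
  rewrite [leRHS]integral_mkcond; apply: ge0_le_integral => //.
  - by move=> Y _; rewrite -EFinM lee_fin mulr_ge0 ?(ltW c0)// secant_density_ge0.
  - apply: measurable_funeM.
    by apply/measurable_EFinP; exact: measurable_secant_density.
  - apply: measurable_fun_if_set; first exact: measurable_chart_dom.
    apply: measurable_funTS; rewrite /W; under eq_fun do rewrite mul1e.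
    by apply/measurable_EFinP; exact: measurable_chart_weight.
  move=> Y _; rewrite -EFinM patchE /secant_density indicE.
  case: ifPn => [/set_mem Yd|_]; last by rewrite mul0r mulr0.
  rewrite /W mul1e lee_fin /chart_weight mul1r ler_wpM2r ?invr_ge0 ?sqrtr_ge0//.
  rewrite lerXn2r ?nnegrE ?invr_ge0 ?addr_ge0 ?invr_ge0 ?(ltW b2)//.
    by rewrite ltW// chart_root_gt0 ?dotv_ge0.
  rewrite /chart_root; apply: (@le_trans _ _ ((1 + dotv Y Y)^-1)).
    rewrite lef_pV2 ?posrE ?ltr_pwDl ?dotv_ge0 ?invr_ge0 ?(ltW b2)//.
    rewrite lerD2l; move: Yd; rewrite /chart_dom /= /chart_disc subr_gt0 mulrC => h.
    by rewrite -[leRHS]mul1r ler_pdivlMr// ltW.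
  rewrite -[leLHS]mul1r ler_wpM2r ?invr_ge0 ?addr_ge0 ?dotv_ge0// mul1r.
  by rewrite (le_trans (ltW a1))// lerDl sqrtr_ge0.
have : (\int[lebesgue_rV k]_(Y in @chart_dom R k bet) W 1%R Y < +oo)%E.
  apply: (@le_lt_trans _ _ (\int[sphere_area k.+1]_x (cst 1%E x))%E).
    rewrite (ge0_integral_chart k0 a1)//= leeDl//.
    by apply: integral_ge0 => Y _; exact: W0.
  by rewrite integral_cst// mul1e sphere_area_fin.
move=> /(le_lt_trans H).
have : (0 <= \int[lebesgue_rV k]_Y (secant_density a Y)%:E)%E.
  by apply: integral_ge0 => Y _; rewrite lee_fin secant_density_ge0.
case: (\int[_]_Y _)%E => [x _ _||]//=; first by rewrite ltry.
move=> _; by rewrite gt0_muley// lte_fin.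
Qed.

End secant_density_theory.

(** * Exponential moments of the weighted sum over the two points of a secant *)

Section moments.
Context {R : realType} {m k' : nat}.
Local Notation k := k'.+1.
Variables (a : 'rV[R]_m) (f : 'rV[R]_m -> R) (E : 'M[R]_(k, m)).
Hypotheses (a1 : 1 < enorm a) (k'0 : (0 < k')%N) (cf : continuous_on_sphere f)
  (funk0 : forall tau, planes_through a k tau -> funk k f tau = 0)
  (EE : E *m E^T = 1%:M) (aE : a *m E^T = 0).
Local Notation bet := (enorm a).
Local Notation lam := (@lebesgue_rV R k).

Let pos (g : 'rV[R]_m -> R) v := Num.max (sphere_ext g v) 0.
Let fN x := - f x.

Let mpos g : continuous_on_sphere g -> measurable_fun setT (pos g).
Proof.
move=> cg; apply: measurable_maxr => //; exact: measurable_sphere_ext.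
Qed.

Let pos0 g v : 0 <= pos g v. Proof. by rewrite le_max lexx orbT. Qed.

Let bounded_pos g : continuous_on_sphere g -> exists M, forall v, `|pos g v| <= M.
Proof.
move=> cg; have [M M0 gM] := bounded_sphere_ext cg; exists M => v.
rewrite ger0_norm// ge_max M0 andbT; exact: le_trans (ler_norm _) (gM v).
Qed.

(** The frame [F] is arbitrary because the moments use frames rotated according to the frequency. *)
Let slice_eq (F : 'M[R]_(k, m)) (t : R) : F *m F^T = 1%:M -> a *m F^T = 0 ->
  (\int[lebesgue_rV k']_z
     (secant_density a (rV_cons (t, z)) * secant_sum a F (pos f) (rV_cons (t, z)))%:E =
   \int[lebesgue_rV k']_z
     (secant_density a (rV_cons (t, z)) * secant_sum a F (pos fN) (rV_cons (t, z)))%:E)%E.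
Proof.
move=> FF aF; have [T0|T0] := ltP 0 (chart_disc bet (t ^+ 2)).
  pose F1 : 'rV[R]_m := usubmx (F : 'M[R]_(1 + k', m)).
  pose F2 : 'M[R]_(k', m) := dsubmx (F : 'M[R]_(1 + k', m)).
  have FE : F = col_mx F1 F2 by rewrite vsubmxK.
  rewrite FE in FF aF *.
  have [tau [C [ptau C0 H]]] := secant_slice a1 k'0 FF aF T0.
  have [c [u [V [_ [fr c1 _ _]]]]] := plane_frame_toward a1 ptau.
  have := funk_eq0 (ltn0Sn k') cf fr (ltW c1) (funk0 ptau).
  rewrite [LHS](H _ (mpos cf) (pos0 f)).
  rewrite [RHS](H _ (mpos (continuous_on_sphereN cf)) (pos0 fN)).
  move=> /(congr1 (fun z => (C^-1)%:E * z)%E).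
  by rewrite !muleA -!EFinM mulVf ?lt0r_neq0// !mul1e.
(* Here the whole slice lies outside the support of the density, since adding |z| ^ 2 only lowers
   the discriminant. *)
apply: eq_integral => z _; have [->|] := eqVneq (secant_density a (rV_cons (t, z))) 0.
  by rewrite !mul0r.
move=> /secant_density_neq0; rewrite dotv_cons -expr2 => h; exfalso.
move: h; apply/negP; rewrite -leNgt; apply: le_trans T0.
rewrite /chart_disc lerD2l lerN2 ler_wpM2l ?lerDl ?dotv_ge0//.
by rewrite subr_ge0 exprn_ege1// ltW.
Qed.

(** After a rotation taking the first axis to the direction of [theta], the exponential depends on
    the first coordinate only, and Tonelli's theorem reduces the claim to the slices. *)
Lemma moment_eq (theta : 'rV[R]_k) :
  (\int[lam]_Y (secant_density a Y * (secant_sum a E (pos f) Y * expR (dotv theta Y)))%:E =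
   \int[lam]_Y (secant_density a Y * (secant_sum a E (pos fN) Y * expR (dotv theta Y)))%:E)%E.
Proof.
have [Q [QQ thE]] := exists_orth_row_multiple theta.
have mG g : continuous_on_sphere g -> measurable_fun setT (fun Y : 'rV[R]_k =>
    (secant_density a Y * (secant_sum a E (pos g) Y * expR (dotv theta Y)))%:E).
  move=> cg; apply/measurable_EFinP; apply: measurable_funM.
    exact: measurable_secant_density.
  apply: measurable_funM; first by apply: measurable_secant_sum; exact: mpos.
  by apply: measurableT_comp => //; exact: measurable_dotv.
have G0 g Y : (0 <=
    (secant_density a Y * (secant_sum a E (pos g) Y * expR (dotv theta Y)))%:E)%E.
  rewrite lee_fin mulr_ge0 ?secant_density_ge0// mulr_ge0 ?expR_ge0//.
  exact: secant_sum_ge0.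
have red g : continuous_on_sphere g ->
  (\int[lam]_Y (secant_density a Y * (secant_sum a E (pos g) Y * expR (dotv theta Y)))%:E =
   \int[@lebesgue_measure R]_s ((expR (enorm theta * s))%:E *
     \int[lebesgue_rV k']_w (secant_density a (rV_cons (s, w)) *
       secant_sum a (Q *m E) (pos g) (rV_cons (s, w)))%:E))%E.
  move=> cg; rewrite -(ge0_integral_rV_orth QQ (mG g cg) (G0 g)).
  rewrite ge0_integral_rV_cons; last 2 first.
  - by apply: (measurableT_comp (mG g cg)); exact: measurable_mulmx.
  - by move=> v; exact: G0.
  apply: eq_integral => s _.
  rewrite -ge0_integralZl_EFin ?expR_ge0//; last 2 first.
  - by move=> w _; rewrite lee_fin mulr_ge0 ?secant_density_ge0// secant_sum_ge0.
  - apply/measurable_EFinP.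
    have mc : measurable_fun setT (fun z : 'rV[R]_k' => rV_cons (s, z)).
      exact: measurable_rV_cons2.
    apply: measurable_funM; apply: measurableT_comp mc.
      exact: measurable_secant_density.
    by apply: measurable_secant_sum; exact: mpos.
  apply: eq_integral => w _.
  rewrite secant_density_mulmx// secant_sum_mulmx// -EFinM; congr EFin.
  have -> : dotv theta (rV_cons (s, w) *m Q) = enorm theta * s.
    rewrite [in LHS]thE dotvZl rowE dotv_mulmx//; congr (_ * _).
    rewrite /dotv (bigD1 ord0)//= big1 ?addr0.
      by rewrite rV_cons0 mxE eqxx mul1r.
    by move=> i i0; rewrite mxE (negbTE i0) andbF mul0r.
  ring.
rewrite (red f cf) (red fN (continuous_on_sphereN cf)).
apply: eq_integral => s _; congr (_ * _)%E; apply: slice_eq.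
  by rewrite trmx_mul mulmxA -(mulmxA Q) EE mulmx1.
by rewrite trmx_mul mulmxA aE mul0mx.
Qed.

Lemma moment0 (theta : 'rV[R]_k) :
  \int[lam]_Y (secant_density a Y * secant_sum a E (sphere_ext f) Y *
    expR (dotv theta Y)) = 0.
Proof.
have bd g : continuous_on_sphere g -> bounded_on_supp (@secant_density R m a k)
    (fun Y => secant_sum a E (pos g) Y * expR (dotv theta Y)).
  move=> cg; split.
    apply: measurable_funM; first by apply: measurable_secant_sum; exact: mpos.
    by apply: measurableT_comp => //; exact: measurable_dotv.
  have [B HB] := secant_sum_bounded a1 E (bounded_pos cg).
  (* The inner product of theta and Y is at most |theta| ^ 2 + |Y| ^ 2, because |theta + Y| ^ 2 and
     |theta - Y| ^ 2 are non-negative; on the support |Y| ^ 2 is at most the inverse of bet ^ 2 -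
     1. *)
  exists (B * expR (dotv theta theta + (bet ^+ 2 - 1)^-1)) => Y /(secant_density_supp a1) YY.
  rewrite normrM ler_pM// ger0_norm ?expR_ge0// ler_expR.
  apply: (@le_trans _ _ (dotv theta theta + dotv Y Y)); last by rewrite lerD2l.
  have := dotv_ge0 (theta - Y); rewrite dotvDl !dotvDr !dotvNl !dotvNr (dotvC Y).
  have := dotv_ge0 (theta + Y); rewrite dotvDl !dotvDr (dotvC Y).
  lra.
have ig g : continuous_on_sphere g -> lam.-integrable setT (EFin \o (fun Y : 'rV[R]_k =>
    secant_density a Y * (secant_sum a E (pos g) Y * expR (dotv theta Y)))).
  move=> cg; apply: integrable_bounded_on_supp (bd g cg).
  - exact: measurable_secant_density.
  - exact: secant_density_ge0.
  - exact: secant_density_fin.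
transitivity (\int[lam]_Y
   (secant_density a Y * (secant_sum a E (pos f) Y * expR (dotv theta Y)) -
    secant_density a Y * (secant_sum a E (pos fN) Y * expR (dotv theta Y)))).
  apply: eq_Rintegral => Y _.
  have posB v : sphere_ext f v = pos f v - pos fN v.
    rewrite /pos sphere_extN; case: (leP 0 (sphere_ext f v)) => h.
      by rewrite max_r ?subr0// oppr_le0.
    by rewrite max_l ?sub0r ?opprK// oppr_ge0 ltW.
  by rewrite /secant_sum !posB; ring.
rewrite RintegralB//; [|exact: ig|exact/ig/continuous_on_sphereN].
by rewrite /Rintegral moment_eq subrr.
Qed.

End moments.

(** * Vanishing of the kernel *)

Section continuity.
Context {R : realType}.

(* The product and the sum in a form that unifies with lambda abstractions. *)
Lemma continuousM_fun (T : topologicalType) (f g : T -> R) x :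
  {for x, continuous f} -> {for x, continuous g} ->
  {for x, continuous (fun t => f t * g t)}.
Proof. exact: continuousM. Qed.

Lemma continuousD_fun (T : topologicalType) (f g : T -> R) x :
  {for x, continuous f} -> {for x, continuous g} ->
  {for x, continuous (fun t => f t + g t)}.
Proof. exact: continuousD. Qed.

Lemma continuous_rV_coord (T : topologicalType) k (F : T -> 'rV[R]_k) x :
  (forall i, {for x, continuous (fun t => F t ord0 i)}) -> {for x, continuous F}.
Proof.
move=> cF P /near_rV_box[e e0 eP].
have : \forall t \near x, forall i, `|F t ord0 i - F x ord0 i| < e.
  apply: filter_forall => i; have /cvgrPdist_lt/(_ e e0) := cF i.
  by apply: filterS => t; rewrite distrC.
by apply: filterS => t Ht; exact: eP.
Qed.

Lemma continuous_chart_disc k bet : continuous (fun Y : 'rV[R]_k => chart_disc bet (dotv Y Y)).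
Proof.
move=> Y; rewrite /chart_disc; apply: (@continuousD_fun 'rV[R]_k); first exact: cst_continuous.
apply: (@continuousN _ _ _ (fun Y : 'rV[R]_k => (bet ^+ 2 - 1) * dotv Y Y)).
by apply: (@continuousM_fun 'rV[R]_k); [exact: cst_continuous|exact: continuous_sqr_enorm].
Qed.

Lemma continuous_chart_root k bet eta :
  continuous (fun Y : 'rV[R]_k => chart_root bet eta (dotv Y Y)).
Proof.
move=> Y; rewrite /chart_root; apply: (@continuousM_fun 'rV[R]_k).
  apply: (@continuousD_fun 'rV[R]_k); first exact: cst_continuous.
  apply: (@continuousM_fun 'rV[R]_k); first exact: cst_continuous.
  apply: (@continuous_comp _ _ _ (fun Y : 'rV[R]_k => chart_disc bet (dotv Y Y)) Num.sqrt).
    exact: continuous_chart_disc.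
  exact: sqrt_continuous.
apply: (@continuousV _ _ (fun Y : 'rV[R]_k => 1 + dotv Y Y)).
  by rewrite gt_eqF// ltr_pwDl// dotv_ge0.
by apply: (@continuousD_fun 'rV[R]_k); [exact: cst_continuous|exact: continuous_sqr_enorm].
Qed.

Lemma continuous_secant_pt m (a : 'rV[R]_m) k (E : 'M[R]_(k, m)) eta :
  continuous (secant_pt a E eta).
Proof.
move=> Y; apply: continuous_rV_coord => i.
rewrite (_ : (fun _ => _) = (fun Z : 'rV[R]_k => a ord0 i +
  chart_root (enorm a) eta (dotv Z Z) * ((- ((enorm a)^-1 *: a)) ord0 i +
   \sum_(j < k) Z ord0 j * E j i))); last by apply/funext => Z; rewrite !mxE.
apply: (@continuousD_fun 'rV[R]_k); first exact: cst_continuous.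
apply: (@continuousM_fun 'rV[R]_k); first exact: continuous_chart_root.
apply: (@continuousD_fun 'rV[R]_k); first exact: cst_continuous.
apply: continuous_sum_fun => j; apply: (@continuousM_fun 'rV[R]_k); last exact: cst_continuous.
exact: coord_continuous.
Qed.

Lemma continuous_sphere_ext m (f : 'rV[R]_m -> R) (v : 'rV[R]_m) :
  continuous_on_sphere f -> v != 0 -> {for v, continuous (sphere_ext f)}.
Proof.
move=> cf v0; have H := continuous_normalize_comp cf v0.
have E : sphere_ext f v = f (normalize v) by rewrite /sphere_ext (negbTE v0).
suff : sphere_ext f w @[w --> v] --> f (normalize v) by rewrite -E.
apply: cvg_trans (H : f (normalize w) @[w --> v] --> f (normalize v)).
apply: (@near_eq_cvg _ _ (nbhs v)).
have : nbhs v [set v : 'rV[R]_m | v != 0].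
  by apply: open_nbhs_nbhs; split => //; exact: open_neq0.
by apply: filterS => w /= w0; rewrite /sphere_ext (negbTE w0).
Qed.

End continuity.

Section vanishing.
Context {R : realType} {m k : nat}.
Variables (a : 'rV[R]_m) (E : 'M[R]_(k, m)) (Y0 : 'rV[R]_k).
Hypotheses (a1 : 1 < enorm a) (EE : E *m E^T = 1%:M) (aE : a *m E^T = 0)
  (d0 : 0 <= chart_disc (enorm a) (dotv Y0 Y0)).
Local Notation bet := (enorm a).
Local Notation lam := (@lebesgue_rV R k).

Lemma secant_pt_sphere eta : eta ^+ 2 = 1 -> esphere (secant_pt a E eta Y0).
Proof.
move=> eta1; have b0 : 0 < bet by exact: lt_trans a1.
have := chart_root_eq eta1 (dotv_ge0 Y0) d0.
rewrite /secant_pt; set q := chart_root _ _ _ => qE.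
have aa : dotv a a = bet ^+ 2 by rewrite enorm_sqr.
have aY : dotv a (Y0 *m E) = 0 by rewrite dotvE trmx_mul mulmxA aE mul0mx mxE.
set X := a + _; suff : dotv X X = 1 by move=> h; rewrite /esphere /= /enorm h sqrtr1.
rewrite /X {X}.
rewrite dotvDl !dotvDr !dotvZl !dotvZr (dotvC _ a) dotvDl !dotvDr !dotvNl !dotvNr.
rewrite !dotvZl !dotvZr (dotvC _ a) aY dotv_mulmx// aa.
transitivity ((1 + dotv Y0 Y0) * q ^+ 2 - (2 * bet * q - (bet ^+ 2 - 1)) + 1).
  by field; rewrite lt0r_neq0.
by rewrite qE subrr add0r.
Qed.

Lemma continuous_secant_sum (f : 'rV[R]_m -> R) : continuous_on_sphere f ->
  {for Y0, continuous (secant_sum a E (sphere_ext f))}.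
Proof.
move=> cf.
have H eta : eta ^+ 2 = 1 -> {for Y0, continuous (fun Y => sphere_ext f (secant_pt a E eta Y) *
    chart_root bet eta (dotv Y Y) ^+ k.-1)}.
  move=> eta1; apply: (@continuousM_fun _ 'rV[R]_k
    (fun Y : 'rV[R]_k => sphere_ext f (secant_pt a E eta Y))
    (fun Y : 'rV[R]_k => chart_root bet eta (dotv Y Y) ^+ k.-1)).
    apply: (@continuous_comp _ _ _ (secant_pt a E eta) (sphere_ext f)).
      exact: continuous_secant_pt.
    by apply: continuous_sphere_ext => //; exact/esphere_neq0/secant_pt_sphere.
  apply: (@continuous_comp _ _ _ (fun Y => chart_root bet eta (dotv Y Y)) (fun x => x ^+ k.-1)).
    exact: continuous_chart_root.
  exact: exprn_continuous.
by apply: (@continuousD_fun _ 'rV[R]_k); apply: H; rewrite ?sqrrN expr1n.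
Qed.

(** [Y0] may lie on the boundary of the chart domain, at a tangent line. The domain is a ball about
    0, so shrinking [Y0] slightly gives an interior point, and around it the density is at least
    1. *)
Lemma secant_density_pos eps : 0 < eps ->
  (0 < \int[lam]_Y (secant_density a Y * \1_(rV_box Y0 eps) Y)%:E)%E.
Proof.
move=> eps0; have N0 := enorm_ge0 Y0.
(* With this choice del <= 1, and the displacement del |Y0| stays below eps. *)
pose del := eps / (eps + enorm Y0).
have del0 : 0 < del by rewrite divr_gt0// ltr_pwDl.
have del1 : del <= 1 by rewrite ler_pdivrMr ?ltr_pwDl// mul1r lerDl.
have delY : del * enorm Y0 < eps.
  by rewrite /del mulrAC ltr_pdivrMr ?ltr_pwDl// ltr_pM2l// ltrDr.
pose Y1 := (1 - del) *: Y0.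
have d1 : 0 < chart_disc bet (dotv Y1 Y1).
  have : 0 <= (1 - del) ^+ 2 * chart_disc bet (dotv Y0 Y0).
    by rewrite mulr_ge0// sqr_ge0.
  rewrite /Y1 dotvZl dotvZr /chart_disc; set z := dotv Y0 Y0.
  have : (1 - del) ^+ 2 < 1 by rewrite exprn_ilt1// ?subr_ge0// ltrBlDr ltrDl.
  move=> h1 h2; apply: lt_le_trans (_ : 1 - (1 - del) ^+ 2 <= _); first by rewrite subr_gt0.
  by rewrite -subr_ge0; apply: le_trans h2 _; rewrite le_eqVlt; apply/orP; left; apply/eqP; ring.
have [e1 e10 He1] : exists2 e1, 0 < e1 & rV_box Y1 e1 `<=` @chart_dom R k bet.
  apply: near_rV_box; have /cvgr_gt := @continuous_chart_disc R k bet Y1.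
  by move=> /(_ _ d1).
pose e := Num.min e1 (eps - del * enorm Y0).
have e0 : 0 < e by rewrite lt_min e10 subr_gt0.
have sub : rV_box Y1 e `<=` rV_box Y0 eps.
  move=> Y YY i.
  have -> : Y ord0 i - Y0 ord0 i = (Y ord0 i - Y1 ord0 i) - del * Y0 ord0 i.
    by rewrite /Y1 mxE; ring.
  apply: le_lt_trans (ler_normB _ _) _.
  rewrite normrM (gtr0_norm del0) -(subrK (del * enorm Y0) eps).
  apply: ltr_leD; last by rewrite ler_wpM2l ?coord_le_enorm// ltW.
  by apply: lt_le_trans (YY i) _; rewrite ge_min lexx orbT.
apply: (@lt_le_trans _ _ (\int[lam]_Y (\1_(rV_box Y1 e) Y)%:E)%E).
  rewrite integral_indic_rV; last exact: measurable_rV_box.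
  by rewrite lebesgue_rV_box// lte_fin exprn_gt0// mulr_gt0.
apply: ge0_le_integral => //.
- apply/measurable_EFinP/measurable_indic; exact: measurable_rV_box.
- apply/measurable_EFinP; apply: measurable_funM.
    exact: measurable_secant_density.
  apply: measurable_indic; exact: measurable_rV_box.
move=> Y _; rewrite lee_fin [leLHS]indicE; case: (boolP (Y \in _)) => [/set_mem YY|_]; last first.
  by rewrite mulr_ge0// secant_density_ge0.
rewrite indicE mem_set; last exact: sub.
have Yd : chart_dom bet Y.
  by apply: He1 => i; apply: lt_le_trans (YY i) _; rewrite ge_min lexx.
rewrite mulr1 /secant_density indicE mem_set// mul1r.
rewrite -[leLHS]invr1 lef_pV2 ?posrE ?sqrtr_gt0//.
exact: sqrt_chart_disc_le1 (dotv_ge0 _).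
Qed.

End vanishing.

Section conclusion.
Context {R : realType} {m k' : nat}.
Local Notation k := k'.+1.
Variables (a : 'rV[R]_m) (E : 'M[R]_(k, m)) (Y0 : 'rV[R]_k).
Hypotheses (a1 : 1 < enorm a) (k'0 : (0 < k')%N) (EE : E *m E^T = 1%:M)
  (aE : a *m E^T = 0) (d0 : 0 <= chart_disc (enorm a) (dotv Y0 Y0)).

Let secant_sum_le0 (f : 'rV[R]_m -> R) : continuous_on_sphere f ->
  (forall tau, planes_through a k tau -> funk k f tau = 0) ->
  secant_sum a E (sphere_ext f) Y0 <= 0.
Proof.
move=> cf funk0.
have [M HM] : exists M, forall Y, `|secant_sum a E (sphere_ext f) Y| <= M.
  apply: (secant_sum_bounded a1 E); have [M _ fM] := bounded_sphere_ext cf.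
  by exists M.
(* It bounds |Y| + |Y0| on the support through |Y| <= 1 + |Y| ^ 2. *)
pose b := 1 + (enorm a ^+ 2 - 1)^-1 + enorm Y0.
apply: (@exponential_moments_le0 R k (@secant_density R m a k)
  (secant_sum a E (sphere_ext f)) b M Y0).
- exact: measurable_secant_density.
- by apply: measurable_secant_sum; exact: measurable_sphere_ext.
- exact: secant_density_ge0.
- exact: HM.
- exact: secant_density_fin.
- move=> Y /(secant_density_supp a1) YY i; apply: le_trans (ler_normB _ _) _.
  rewrite lerD ?coord_le_enorm//; apply: le_trans (coord_le_enorm _ _) _.
  apply: (@le_trans _ _ (1 + dotv Y Y)); last by rewrite lerD2l.
  rewrite -enorm_sqr; have := sqr_ge0 (enorm Y - 1); have := enorm_ge0 Y; nra.
- exact: continuous_secant_sum.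
- by move=> eps; exact: secant_density_pos.
- by move=> theta; exact: moment0.
Qed.

(** The one-sided bound is applied to [f] and to - f, whose transform vanishes as well because it
    exchanges the integrals of the positive and negative parts. *)
Lemma secant_sum_eq0 (f : 'rV[R]_m -> R) : continuous_on_sphere f ->
  (forall tau, planes_through a k tau -> funk k f tau = 0) ->
  secant_sum a E (sphere_ext f) Y0 = 0.
Proof.
move=> cf funk0; apply/eqP; rewrite eq_le secant_sum_le0//= -oppr_le0.
have -> : - secant_sum a E (sphere_ext f) Y0 =
    secant_sum a E (sphere_ext (fun x => - f x)) Y0.
  by rewrite /secant_sum !sphere_extN; ring.
apply: secant_sum_le0; first exact: continuous_on_sphereN.
move=> tau ptau; have [c [u [V [_ [fr c1 _ _]]]]] := plane_frame_toward a1 ptau.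
have := funk_eq0 (ltn0Sn k') cf fr (ltW c1) (funk0 _ ptau).
rewrite funkE => h.
have -> : (fun x => - - f x) = f by apply/funext => x; rewrite opprK.
rewrite -h; move: (\int[_]_(_ in _) _)%E => [z| |] //=; exact: subrr.
Qed.

End conclusion.

Section antisymmetry.
Context {R : realType}.

(** This places x and the axis e in one (k+2)-dimensional linear subspace, in which the (k+1)-planes
    through [a] are hyperplanes. The first row of E carries the part of x orthogonal to e, the other
    rows complete it, and [k < n.+1] leaves room for them. *)
Lemma exists_chart_frame n k (e x : 'rV[R]_n.+2) : (k < n.+1)%N -> dotv e e = 1 ->
  exists (E : 'M[R]_(k.+1, n.+2)) (y : 'rV[R]_k.+1),
    [/\ E *m E^T = 1%:M, e *m E^T = 0 & x = dotv x e *: e + y *m E].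
Proof.
move=> kn ee; have [Q [QQ Q0]] := exists_orth_row0 ee.
pose N : 'M[R]_(n.+1, n.+2) := dsubmx (Q : 'M[R]_(1 + n.+1, n.+2)).
have QE : Q = col_mx e N :> 'M[R]_(1 + n.+1, n.+2).
  rewrite -[LHS](@vsubmxK _ 1 n.+1); congr col_mx; rewrite -Q0.
  by apply/rowP => j; rewrite !mxE; congr (Q _ j); exact: val_inj.
have QQ' : (col_mx e N : 'M[R]_(1 + n.+1, n.+2)) *m (col_mx e N)^T = 1%:M by rewrite -QE.
have [_ eN NN] := orth_col_mxE QQ'.
pose w := x *m N^T.
have xE : x = dotv x e *: e + w *m N.
  rewrite -[LHS]mulmx1 -(mulmx1C QQ').
  by rewrite tr_col_mx mul_row_col mulmxDr !mulmxA dotv_scalar_mx mul_scalar_mx.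
have [Q2 [QQ2 wE]] := exists_orth_row_multiple w.
pose E2 : 'M[R]_(k.+1, n.+1) := rowsub (widen_ord kn) Q2.
have EE2 : E2 *m E2^T = 1%:M.
  apply/matrixP => i j.
  transitivity ((Q2 *m Q2^T) (widen_ord kn i) (widen_ord kn j)).
    by rewrite !mxE; apply: eq_bigr => l _; rewrite !mxE.
  by rewrite QQ2 !mxE.
exists (E2 *m N), (enorm w *: delta_mx ord0 ord0); split.
- by rewrite trmx_mul mulmxA -(mulmxA E2) NN mulmx1.
- by rewrite trmx_mul mulmxA eN mul0mx.
rewrite [LHS]xE mulmxA -scalemxAl -rowE [in LHS]wE; congr (_ + _ *: _ *m _).
by apply/rowP => j; rewrite !mxE; congr (Q2 _ j); exact: val_inj.
Qed.

Lemma funk_kernel_antisym n k (a : 'rV[R]_n.+2) (f : 'rV[R]_n.+2 -> R) :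
  (0 < k)%N -> (k < n.+1)%N -> 1 < enorm a -> continuous_on_sphere f ->
  (forall tau, planes_through a k.+1 tau -> funk k.+1 f tau = 0) ->
  forall x, esphere x -> f x = - Wop a k.+1 f x.
Proof.
move=> k0 kn a1 cf funk0 x x1.
set bet := enorm a in a1 *; have b0 : 0 < bet by exact: lt_trans a1.
have [e edef] : exists e : 'rV[R]_n.+2, e = bet^-1 *: a by eexists.
have aE : a = bet *: e by rewrite edef scalerA divff ?scale1r// lt0r_neq0.
have aa : dotv a a = bet ^+ 2 by rewrite -enorm_sqr.
have ee : dotv e e = 1 by rewrite edef dotvZl dotvZr aa; field; rewrite lt0r_neq0.
have [E [y [EE eE xE]]] := exists_chart_frame x kn ee.
have aE0 : a *m E^T = 0 by rewrite aE -scalemxAl eE scaler0.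
have eyE : dotv e (y *m E) = 0 by rewrite dotvE trmx_mul mulmxA eE mul0mx mxE.
set p := dotv x e in xE.
have xx : dotv x x = 1 by rewrite -enorm_sqr x1 expr1n.
have yy : dotv y y = 1 - p ^+ 2.
  move: xx; rewrite xE dotvDl !dotvDr !dotvZl !dotvZr (dotvC _ e) eyE ee.
  rewrite dotv_mulmx// => <-; ring.
have p1 : p <= 1.
  have := dotv_ge0 (x - e); rewrite dotvDl !dotvDr !dotvNl !dotvNr (dotvC e x) xx ee -/p.
  lra.
(* The direction of the secant is normalized to have component -1 along e, so the parameter of x is
   the difference of the components of [a] and x. *)
pose q := bet - p; have q0 : 0 < q by rewrite subr_gt0; exact: le_lt_trans a1.
pose Y := q^-1 *: y.
have YY : dotv Y Y = (1 - p ^+ 2) / q ^+ 2.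
  by rewrite dotvZl dotvZr yy; field; rewrite lt0r_neq0.
have dE : chart_disc bet (dotv Y Y) = ((1 - bet * p) / q) ^+ 2.
  by rewrite YY /chart_disc /q; field; rewrite lt0r_neq0.
have d0 : 0 <= chart_disc bet (dotv Y Y) by rewrite dE sqr_ge0.
have Y1 : 0 < 1 + dotv Y Y by rewrite ltr_pwDl// dotv_ge0.
(* The discriminant is a perfect square, and the sign of 1 - bet p tells whether x is the far or the
   near point of its secant. At tangency both signs describe the same point. *)
have [eta [eta1 etaE]] : exists eta : R, (eta = 1 \/ eta = -1) /\
    eta * Num.sqrt (chart_disc bet (dotv Y Y)) = (1 - bet * p) / q.
  rewrite dE sqrtr_sqr; have [h|h] := leP 0 ((1 - bet * p) / q).
    by exists 1; rewrite mul1r ger0_norm//; split => //; left.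
  by exists (-1); rewrite mulN1r ltr0_norm// opprK; split => //; right.
have eta2 : eta ^+ 2 = 1 by case: eta1 => ->; rewrite ?sqrrN expr1n.
have etaN2 : (- eta) ^+ 2 = 1 by rewrite sqrrN.
have qE : chart_root bet eta (dotv Y Y) = q.
  have Y1' : 1 + dotv Y Y != 0 by rewrite lt0r_neq0.
  rewrite /chart_root etaE; apply: (mulIf Y1'); rewrite divfK//.
  by rewrite YY /q; field; rewrite lt0r_neq0.
pose d := - e + Y *m E.
have xqd : x = a + q *: d.
  rewrite [LHS]xE aE /d /Y -scalemxAl scalerDr scalerA divff ?lt0r_neq0// scale1r.
  by rewrite addrA scalerN -scalerBl; congr (_ *: _ + _); rewrite /q; ring.
set q' := chart_root bet (- eta) (dotv Y Y).
have q'0 : 0 < q' by apply: chart_root_gt0 => //; exact: dotv_ge0.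
have dd : dotv d d = 1 + dotv Y Y.
  rewrite /d dotvDl !dotvDr !dotvNl !dotvNr (dotvC (Y *m E)).
  have -> : dotv e (Y *m E) = 0 by rewrite dotvE trmx_mul mulmxA eE mul0mx mxE.
  by rewrite dotv_mulmx// ee; ring.
have qq' : q * q' * dotv d d = dotv a a - 1.
  rewrite -{1}qE (chart_rootN eta2 (dotv_ge0 Y) d0) dd aa divfK// lt0r_neq0//.
have x1' := x1; rewrite xqd in x1'.
have [_ WE] := secant_second_point a1 q0 q'0 x1' qq'.
have S0 : f (a + q *: d) * q ^+ k + f (a + q' *: d) * q' ^+ k = 0.
  have := secant_sum_eq0 a1 k0 EE aE0 d0 cf funk0.
  rewrite /secant_sum !sphere_extE; last 2 first.
  - by apply: secant_pt_sphere => //; rewrite sqrrN expr1n.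
  - by apply: secant_pt_sphere => //; rewrite expr1n.
  rewrite /secant_pt -/bet -edef -/d /=; move: qE; rewrite /q'.
  by case: eta1 => -> ->; rewrite ?opprK// addrC.
rewrite xqd WE /=; apply: (mulIf (lt0r_neq0 (exprn_gt0 k q0))).
rewrite exprMn exprVn mulNr mulrAC divfK ?expf_neq0 ?lt0r_neq0//.
by apply/eqP; rewrite -addr_eq0 [_ ^+ k * f _]mulrC S0.
Qed.

End antisymmetry.

Theorem theorem5p3 (R : realType) (n k : nat) (a : 'rV[R]_n.+1)
    (hn : (2 <= n)%N) (hk1 : (1 < k)%N) (hkn : (k <= n)%N)
    (ha : 1 < enorm a) :
  (forall f g : 'rV[R]_n.+1 -> R,
     continuous_on_sphere f ->
     (forall x, esphere x -> f x = Wop a k f x) ->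
     continuous_on_sphere g ->
     (forall x, esphere x -> g x = Wop a k g x) ->
     (forall tau, planes_through a k tau -> funk k f tau = funk k g tau) ->
     forall x, esphere x -> f x = g x)
  /\
  [set f : 'rV[R]_n.+1 -> R | continuous_on_sphere f /\
     (forall tau, planes_through a k tau -> funk k f tau = 0)] =
  [set f : 'rV[R]_n.+1 -> R | continuous_on_sphere f /\
     (forall x, esphere x -> f x = - Wop a k f x)].
Proof.
case: n => [//|n] in a hn hkn ha *; case: k => [//|k] in hk1 hkn *.
have k0 : (0 < k)%N by [].
split; last first.
  apply/seteqP; split => f [cf Hf]; split => //.
    exact: funk_kernel_antisym Hf.
  by move=> tau; exact: funk_antisym.
move=> f g cf fW cg gW fg x x1; apply/eqP; rewrite -subr_eq0; apply/eqP.
have cfg : continuous_on_sphere (fun x => f x - g x).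
  by move=> z; apply: continuousB; [exact: cf|exact: cg].
have := funk_kernel_antisym k0 hkn ha cfg _ x1.
(* The difference f - g is fixed by [Wop] by linearity, while membership in the kernel makes it the
   negative of its image; hence it equals its own negative. *)
have -> : Wop a k.+1 (fun x => f x - g x) x = f x - g x.
  by rewrite [in RHS]fW// [in RHS]gW// /Wop mulrBr.
move=> H; have : f x - g x = - (f x - g x).
  apply: H => tau ptau.
  have [c [u [V [_ [fr c1 _ _]]]]] := plane_frame_toward ha ptau.
  by rewrite (funkB _ cf cg fr (ltW c1))// fg// subrr.
lra.
Qed.
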